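(* Let $n\in\mathbb{N}$ and let $s,t$ be non-negative integers with $s,t\le n$. Then $$\|f\|_{L^2_{(s,t+1)}(\mathbb{C}^n)}^2\le\|T_n^*f\|_{L^2_{(s,t)}(\mathbb{C}^n)}^2+\|S_nf\|_{L^2_{(s,t+2)}(\mathbb{C}^n)}^2\qquad\text{for all } f\in D_{T_n^*}\cap D_{S_n}.$$
   Context: Fix positive reals $(a_i)_{i\ge1}$ with $\sum_{i\ge1}a_i<1$. For $a>0$ let $\mathcal{N}_a$ be the probability measure on $\mathbb{C}=\mathbb{R}^2$ with density $\frac1{2\pi a^2}e^{-(x^2+y^2)/(2a^2)}$, and $\mathcal{N}^n=\prod_{i=1}^n\mathcal{N}_{a_i}$ on $\mathbb{C}^n$. $\mathscr{C}_c^\infty(\mathbb{C}^n)$ is the set of complex-valued $C^\infty$ compactly supported functions on $\mathbb{C}^n=\mathbb{R}^{2n}$. With $\frac{\partial}{\partial z_j}=\frac12(\frac{\partial}{\partial x_j}-\sqrt{-1}\frac{\partial}{\partial y_j})$, $\delta_j\varphi=\frac{\partial\varphi}{\partial z_j}-\frac{\overline{z_j}}{2a_j^2}\varphi$. Multi-indices $I=(i_1<\dots<i_s)$, $J=(j_1<\dots<j_t)$ are strictly increasing with entries in $\{1,\dots,n\}$ (possibly empty), $\sum'$ means summation over such multi-indices, and $\mathbf{a}^{I,J}=\prod_{l=1}^sa_{i_l}^2\prod_{r=1}^ta_{j_r}^2$ (empty products are $1$). $L^2_{(s,t)}(\mathbb{C}^n)$ is the Hilbert space of forms $f=\sum'_{|I|=s,|J|=t}f_{I,J}\,dz^I\wedge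 d\bar z^J$ with $f_{I,J}\in L^2(\mathbb{C}^n,\mathcal{N}^n)$ and inner product $(f,g)=\sum'2^{s+t}\mathbf{a}^{I,J}\int_{\mathbb{C}^n}f_{I,J}\overline{g_{I,J}}\,d\mathcal{N}^n$ (it is $\{0\}$ if $s>n$ or $t>n$). For $j\le n$ and strictly increasing $J,K$ with $|J|=t$, $|K|=t+1$: $\varepsilon^K_{j,J}=0$ if $K\ne J\cup\{j\}$ as sets, otherwise it is the sign of the permutation taking $(j,j_1,\dots,j_t)$ to $K$. A form $f\in L^2_{(s,t)}(\mathbb{C}^n)$ is in the domain of $\overline\partial$ if there are $g_{I,K}\in L^2(\mathbb{C}^n,\mathcal{N}^n)$ ($|I|=s$, $|K|=t+1$) with $$\int_{\mathbb{C}^n}g_{I,K}\overline\varphi\,d\mathcal{N}^n=-\int_{\mathbb{C}^n}\sum_{1\le i\le n}\sum_{|J|=t}{}'\varepsilon^K_{i,J}f_{I,J}\overline{\delta_i\varphi}\,d\mathcal{N}^n\quad\forall\varphi\in\mathscr{C}_c^\infty(\mathbb{C}^n);$$ then $\overline\partial f=(-1)^s\sum'_{|I|=s,|K|=t+1}g_{I,K}\,dz^I\wedge d\bar z^K$. $T_n$ and $S_n$ are the (closed, densely defined) operators $\overline\partial:L^2_{(s,t)}(\mathbb{C}^n)\to L^2_{(s,t+1)}(\mathbb{C}^n)$ and $\overline\partial:L^2_{(s,t+1)}(\mathbb{C}^n)\to L^2_{(s,t+2)}(\mathbb{C}^n)$; $T_n^*$ is the Hilbert-space adjoint of $T_n$,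 and $D_A$ is the domain of an operator $A$. *)

(* Defs.v *)
From HB Require Import structures.
From mathcomp Require Import all_boot all_order all_algebra perm.
From mathcomp Require Import complex.
From mathcomp Require Import all_classical all_reals all_analysis.
From mathcomp Require Import measurable_realfun.

Set Implicit Arguments.
Unset Strict Implicit.
Unset Printing Implicit Defensive.

Import Order.TTheory GRing.Theory Num.Theory.
Import numFieldNormedType.Exports.

Local Open Scope classical_set_scope.
Local Open Scope ring_scope.
Local Open Scope complex_scope.

Section one_variable_gaussian.
Variable R : realType.
Implicit Type a : {posnum R}.

Definition gauss_pdf a (z : R * R) : R :=
  (2 * pi * a%:num ^+ 2)^-1 *
  expR (- (z.1 ^+ 2 + z.2 ^+ 2) / (2 * a%:num ^+ 2)).

Definition gauss1 a (A : set (R * R)) : \bar R :=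
  (\int[lebesgue_measure \x lebesgue_measure]_(z in A) (gauss_pdf a z)%:E)%E.

Lemma gauss_pdf_ge0 a z : 0 <= gauss_pdf a z.
Proof.
rewrite mulr_ge0 ?expR_ge0// invr_ge0 mulr_ge0 ?exprn_ge0// mulr_ge0//.
exact: pi_ge0.
Qed.

Lemma gauss_pdf_normal a z :
  gauss_pdf a z = normal_pdf 0 a%:num z.1 * normal_pdf 0 a%:num z.2.
Proof.
have a0 : a%:num != 0 by [].
rewrite !normal_pdfE// /normal_peak /normal_fun !subr0.
rewrite mulrACA -expRD -invfM -expr2 sqr_sqrtr; last first.
  by rewrite mulrn_wge0// mulr_ge0 ?sqr_ge0// pi_ge0.
rewrite /gauss_pdf -(mulr_natl (_ * _)) -(mulr_natl (_ ^+ 2)) -mulrDl opprD.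
by rewrite mulrA mulrAC.
Qed.

Lemma measurable_gauss_pdf a : measurable_fun setT (gauss_pdf a).
Proof.
rewrite (_ : gauss_pdf a =
  (normal_pdf 0 a%:num \o fst) \* (normal_pdf 0 a%:num \o snd)).
  by apply: measurable_funM; apply: measurableT_comp => //;
    exact: measurable_normal_pdf.
by apply/funext => z; rewrite gauss_pdf_normal.
Qed.

Let gauss1_0 a : gauss1 a set0 = 0%E.
Proof. by rewrite /gauss1 integral_set0. Qed.

Let gauss1_ge0 a A : (0 <= gauss1 a A)%E.
Proof. by apply: integral_ge0 => z _; rewrite lee_fin gauss_pdf_ge0. Qed.

Let gauss1_sigma_additive a : semi_sigma_additive (gauss1 a).
Proof.
move=> F mF tF mUF; rewrite /gauss1 ge0_integral_bigcup//=; last 2 first.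
- apply/measurable_EFinP; apply: measurable_funTS; exact: measurable_gauss_pdf.
- by move=> z _; rewrite lee_fin gauss_pdf_ge0.
apply: is_cvg_ereal_nneg_natsum_cond => // n _ _.
by apply: integral_ge0 => z _; rewrite lee_fin gauss_pdf_ge0.
Qed.

HB.instance Definition _ a := isMeasure.Build _ _ _
  (gauss1 a) (gauss1_0 a) (@gauss1_ge0 a) (@gauss1_sigma_additive a).

Let gauss1_setT a : gauss1 a setT = 1%E.
Proof.
rewrite /gauss1 fubini_tonelli1//=; last 2 first.
- by apply/measurable_EFinP; exact: measurable_gauss_pdf.
- by move=> z; rewrite lee_fin gauss_pdf_ge0.
rewrite /fubini_F.
under eq_integral => x _.
  under eq_integral => y _ do rewrite gauss_pdf_normal/= EFinM.
  rewrite ge0_integralZl//; last 3 first.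
  - by apply/measurable_EFinP; exact: measurable_normal_pdf.
  - by move=> y _; rewrite lee_fin normal_pdf_ge0.
  - by rewrite lee_fin normal_pdf_ge0.
  rewrite integral_normal_pdf mule1.
  over.
exact: integral_normal_pdf.
Qed.

HB.instance Definition _ a :=
  @Measure_isProbability.Build _ _ R (gauss1 a) (gauss1_setT a).

End one_variable_gaussian.

Section product_of_sequence.
Context d (T : measurableType d) (R : realType).

Definition tuple_cons n (p : T * n.-tuple T) : n.+1.-tuple T :=
  [the n.+1.-tuple T of p.1 :: p.2].

Lemma measurable_tuple_cons n : measurable_fun setT (@tuple_cons n).
Proof. exact: measurable_cons. Qed.

HB.instance Definition _ n :=
  isMeasurableFun.Build _ _ _ _ (@tuple_cons n) (@measurable_tuple_cons n).

(* The product measure P 0 x ... x P (n - 1). *)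
Fixpoint iprod (P : nat -> probability T R) (n : nat) :
    probability (n.-tuple T) R :=
  match n with
  | 0%N => dirac [tuple]
  | n'.+1 =>
    distribution (P 0%N \x iprod (fun i => P i.+1) n')%E (@tuple_cons n')
  end.

Lemma iprodE (P : nat -> probability T R) (n : nat) (A : nat -> set T) :
  (forall i, measurable (A i)) ->
  iprod P n [set u | forall i : 'I_n, A i (tnth u i)] =
  (\prod_(i < n) P i (A i))%E.
Proof.
elim: n P A => [|n ih] P A mA.
  by rewrite big_ord0 /= diracE mem_set//= => -[].
have mB : measurable [set u : n.-tuple T | forall i : 'I_n, A i.+1 (tnth u i)].
  rewrite (_ : [set u | _] = \bigcap_(i in [set: 'I_n])
      ((fun u : n.-tuple T => tnth u i) @^-1` (A i.+1))); last first.
    by apply/seteqP; split=> u h i; [move=> _; exact: h|exact: h].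
  apply: fin_bigcap_measurable => // i _.
  by rewrite -[X in measurable X]setTI; exact: measurable_tnth.
rewrite big_ord_recl /= /distribution /pushforward.
rewrite (_ : _ @^-1` _ = A 0%N `*`
    [set u : n.-tuple T | forall i : 'I_n, A i.+1 (tnth u i)]).
  rewrite product_measure1E//.
  by have := ih (fun i => P i.+1) (fun i => A i.+1) (fun i => mA i.+1) => <-.
apply/seteqP; split=> -[x u] /=.
  move=> h; split; first exact: (h ord0).
  by move=> i; have := h (lift ord0 i); rewrite tnthS.
move=> [hx hu] i; case: (unliftP ord0 i) => [j|] ->; last by [].
by rewrite tnthS; exact: hu.
Qed.

End product_of_sequence.

Section Cn.
Variables (R : realType) (n : nat).

(* C^n = R^(2n): row j of the matrix is (x_j, y_j).  The sigma-algebra below is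
   the product one, generated by the coordinates. *)
Definition Cn := 'M[R]_(n, 2).

HB.instance Definition _ := NormedModule.on Cn.

Definition xcoord (z : Cn) (j : 'I_n) : R := z j 0.
Definition ycoord (z : Cn) (j : 'I_n) : R := z j 1.

Definition pair_coord (j : 'I_n) (z : Cn) : R * R := (xcoord z j, ycoord z j).

Let Cn_set0 : g_sigma_preimage pair_coord set0.
Proof. exact: sigma_algebra0. Qed.

Let Cn_setC A : g_sigma_preimage pair_coord A ->
  g_sigma_preimage pair_coord (~` A).
Proof. exact: sigma_algebraC. Qed.

Let Cn_bigcup (F : _^nat) : (forall i, g_sigma_preimage pair_coord (F i)) ->
  g_sigma_preimage pair_coord (\bigcup_i (F i)).
Proof. exact: sigma_algebra_bigcup. Qed.

HB.instance Definition _ := @isMeasurable.Build default_measure_display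
  Cn (g_sigma_preimage pair_coord) Cn_set0 Cn_setC Cn_bigcup.

Definition Cn_of_tuple (u : n.-tuple (R * R)) : Cn :=
  \matrix_(j < n, k < 2) if k == 0 then (tnth u j).1 else (tnth u j).2.

Lemma pair_coord_Cn_of_tuple j u : pair_coord j (Cn_of_tuple u) = tnth u j.
Proof. by rewrite /pair_coord /xcoord /ycoord !mxE/=; case: (tnth u j). Qed.

Lemma measurable_Cn_of_tuple : measurable_fun setT Cn_of_tuple.
Proof.
move=> _ A mA; rewrite setTI.
have := g_sigma_preimage_comp pair_coord Cn_of_tuple.
have -> : (fun i => pair_coord i \o Cn_of_tuple) = fun i u => tnth u i.
  by apply/funext => i; apply/funext => u /=; rewrite pair_coord_Cn_of_tuple.
move=> h; rewrite /measurable/= h; exists A => //; exact: setTI.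
Qed.

HB.instance Definition _ :=
  isMeasurableFun.Build _ _ _ _ Cn_of_tuple measurable_Cn_of_tuple.

End Cn.

Section gaussian_L2.
Variables (R : realType) (a : nat -> {posnum R}) (n : nat).
Implicit Types f g phi : Cn R n -> R[i].

(* The sequence a_1, a_2, ... is indexed from 0: a_(i+1) is [a i]. *)
Definition gaussCn : probability (Cn R n) R :=
  distribution (iprod (fun i => gauss1 (a i)) n) (@Cn_of_tuple R n).

Definition cmeasurable f : Prop :=
  measurable_fun setT (fun z => complex.Re (f z)) /\
  measurable_fun setT (fun z => complex.Im (f z)).

(* Elements of L^2 are represented by everywhere defined functions. *)
Definition L2 f : Prop :=
  cmeasurable f /\
  (\int[gaussCn]_z (complex.Re (f z) ^+ 2 + complex.Im (f z) ^+ 2)%:E < +oo)%E.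

Definition cint f : R[i] :=
  (\int[gaussCn]_z complex.Re (f z))%R +i* (\int[gaussCn]_z complex.Im (f z))%R.

(* Basis vectors of R^(2n): (j, 0) is the direction of x_j, (j, 1) of y_j. *)
Definition evec (k : 'I_n * 'I_2) : Cn R n := delta_mx k.1 k.2.

Definition iter_partial (l : seq ('I_n * 'I_2)) (g : Cn R n -> R) :
    Cn R n -> R :=
  foldr (fun k h => fun z => 'D_(evec k) h z) g l.

(* C^infty: the iterated partial derivatives of all orders exist and are
   continuous. *)
Definition smooth (g : Cn R n -> R) : Prop :=
  forall l : seq ('I_n * 'I_2),
    continuous (iter_partial l g) /\
    forall k z, derivable (iter_partial l g) z (evec k).

Definition Cc_infty phi : Prop :=
  [/\ smooth (fun z => complex.Re (phi z)),
      smooth (fun z => complex.Im (phi z)) &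
      compact (closure [set z | phi z != 0])].

Definition partial (k : 'I_n * 'I_2) phi : Cn R n -> R[i] := fun z =>
  ('D_(evec k) (fun w => complex.Re (phi w)) z) +i*
  ('D_(evec k) (fun w => complex.Im (phi w)) z).

Definition partial_z (j : 'I_n) phi : Cn R n -> R[i] := fun z =>
  2^-1 * (partial (j, 0) phi z - 'i%C * partial (j, 1) phi z).

Definition zcoord (z : Cn R n) (j : 'I_n) : R[i] := xcoord z j +i* ycoord z j.

Definition delta (j : 'I_n) phi : Cn R n -> R[i] := fun z =>
  partial_z j phi z - (zcoord z j)^*%C / (2 * (a j)%:num ^+ 2)%:C * phi z.

End gaussian_L2.

Definition multi_index (n s : nat) :=
  {I : s.-tuple 'I_n | sorted (fun i j : 'I_n => (i < j)%N) I}.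

(* The sign of the permutation taking (i, j_1, ..., j_t) to K; such a
   permutation exists iff K = J `|` {i} as sets, and is then unique. *)
Definition eps (R : realType) (n t : nat) (i : 'I_n) (J : multi_index n t)
    (K : multi_index n t.+1) : R[i] :=
  if [pick p : 'S_t.+1 |
       [forall r, tnth (sval K) r == tnth [tuple of i :: sval J] (p r)]]
  is Some p then (-1) ^+ p else 0.

(* The coefficients f_{I,J} of the (s,t)-form f. *)
Definition diff_form (R : realType) (n s t : nat) :=
  multi_index n s -> multi_index n t -> Cn R n -> R[i].

Section forms.
Variables (R : realType) (a : nat -> {posnum R}) (n : nat).

Definition weight s t (I : multi_index n s) (J : multi_index n t) : R :=
  (\prod_(l < s) (a (tnth (sval I) l))%:num ^+ 2) *
  (\prod_(r < t) (a (tnth (sval J) r))%:num ^+ 2).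

Definition L2form s t (f : diff_form R n s t) : Prop :=
  forall I J, L2 a (f I J).

Definition inner s t (f g : diff_form R n s t) : R[i] :=
  \sum_(I : multi_index n s) \sum_(J : multi_index n t)
    (2 ^+ (s + t) * weight I J)%:C * cint a (fun z => f I J z * (g I J z)^*%C).

Definition L2norm s t (f : diff_form R n s t) : R :=
  Num.sqrt (complex.Re (inner f f)).

(* Unbounded operators are given by their graphs: dbar_graph f h means that f is
   in the domain and that h represents the value at f; h is determined up to a
   null set. *)
Definition dbar_graph s t (f : diff_form R n s t)
    (h : diff_form R n s t.+1) : Prop :=
  L2form f /\
  exists g : diff_form R n s t.+1,
    [/\ L2form g,
        forall I K phi, Cc_infty phi ->
          cint a (fun z => g I K z * (phi z)^*%C) =
          - cint a (fun z => \sum_(i < n) \sum_(J : multi_index n t)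
              eps R i J K * f I J z * (delta a i phi z)^*%C) &
        forall I K z, h I K z = (-1) ^+ s * g I K z].

(* Graph of the Hilbert-space adjoint A^*: adjoint_graph A f v means that f is in
   its domain and that v represents A^* f, unique up to a null set when A is
   densely defined. *)
Definition adjoint_graph s t s' t'
    (A : diff_form R n s t -> diff_form R n s' t' -> Prop)
    (f : diff_form R n s' t') (v : diff_form R n s t) : Prop :=
  [/\ L2form f, L2form v & forall u w, A u w -> inner w f = inner u v].

End forms.

(* Main.v *)
Require Import Defs.
From HB Require Import structures.
From mathcomp Require Import all_boot all_order all_algebra perm.
From mathcomp Require Import complex.
From mathcomp Require Import ring lra zify.
From mathcomp Require Import all_classical all_reals all_analysis.
From mathcomp Require Import measurable_realfun.

Set Implicit Arguments.
Unset Strict Implicit.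
Unset Printing Implicit Defensive.
Import Order.TTheory GRing.Theory Num.Theory.
Import numFieldNormedType.Exports.
Local Open Scope ring_scope.
Local Open Scope complex_scope.

(** Write D_i for the derivation d/d(conj z_i) and A_i = conj z_i - 2 a_i^2 d/dz_i, which is
    -2 a_i^2 delta_i. Gaussian integration by parts makes A_i the adjoint of 2 a_i^2 D_i, and
    D_j A_i - A_i D_j is the Kronecker symbol of i and j (dbar_creat).

    On forms with polynomial coefficients dbar and its adjoint are given by explicit formulas
    (dbar_form, dbar_adj). The signs eps satisfy the canonical anticommutation relations
    (eps_anticommute, eps_number); hence on (s,t+1)-forms the Laplacian, the sum of the two
    compositions of dbar with its adjoint, acts on each coefficient as L + t + 1, where
    L = sum_i A_i D_i >= 0 (laplacian_oscil). Its spectrum starts at t + 1 >= 1, so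
    <phi, psi> <= |psi|^2 whenever psi is the Laplacian of the polynomial form phi
    (laplacian_gap).

    A form f in both domains is treated by duality, without approximating it in the graph norm.
    With T and S the operators dbar on (s,t)- and on (s,t+1)-forms and T', S' their adjoints,
    <f, psi> = <T' f, T' phi> + <S f, S phi>, so that
      2 Re <f, psi> <= |T' f|^2 + |S f|^2 + |T' phi|^2 + |S phi|^2
                     = |T' f|^2 + |S f|^2 + <phi, psi> <= |T' f|^2 + |S f|^2 + |psi|^2,
    which says |f|^2 <= |T' f|^2 + |S f|^2 + |f - psi|^2. Since L + t + 1 maps the polynomials
    onto themselves (oscil_surj), psi is an arbitrary polynomial form, and polynomials are dense
    (L2_dense): the last term can be made as small as desired.

    Two facts of analysis carry the duality. The equations defining dbar and its adjoint are
    only given for compactly supported smooth functions; multiplying a polynomial by dilated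
    cut-offs extends them to polynomials (weak_pol). Density is proved through the bounded
    functions that multiply the closure of the polynomials into itself: they include
    exp(-c x^2) and x exp(-c x^2) for every real coordinate x, hence the indicators of
    half-spaces, hence those of all measurable sets (measurable_mult_set). *)

(** * Signs of multi-indices and their anticommutation relations *)

Section multi_indices.
Variables (n : nat).

(** Signs and sums over multi-indices are computed on the underlying sets, where adding an
    index is a plain union. *)
Definition iset t (J : multi_index n t) : {set 'I_n} := [set x in sval J].

Lemma ltord_trans : transitive (fun i j : 'I_n => (i < j)%N).
Proof. by move=> j i k; exact: ltn_trans. Qed.

Lemma ltord_irr : irreflexive (fun i j : 'I_n => (i < j)%N).
Proof. by move=> i; rewrite /= ltnn. Qed.

Lemma multi_index_uniq t (J : multi_index n t) : uniq (sval J).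
Proof. exact: sorted_uniq ltord_trans ltord_irr _ (svalP J). Qed.

Lemma iset_inj t : injective (@iset t).
Proof.
move=> J K JK; apply/val_inj/val_inj => /=.
apply: (irr_sorted_eq ltord_trans ltord_irr (svalP J) (svalP K)) => x.
by move/setP/(_ x): JK; rewrite !inE.
Qed.

Lemma card_iset t (J : multi_index n t) : #|iset J| = t.
Proof. by rewrite cardsE; move/card_uniqP: (multi_index_uniq J) => ->; rewrite size_tuple. Qed.

Lemma sorted_enum_set (A : {set 'I_n}) :
  sorted (fun i j : 'I_n => (i < j)%N) (enum A).
Proof.
rewrite {1}/enum_mem; apply: sorted_filter => //; first exact: ltord_trans.
rewrite -enumT -(@sorted_map _ _ val ltn) val_enum_ord; exact: iota_ltn_sorted.
Qed.

Lemma iset_surj t (A : {set 'I_n}) : #|A| = t ->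
  exists J : multi_index n t, iset J = A.
Proof.
move=> At; have sA : size (enum A) == t by rewrite -cardE At.
exists (exist (fun I : t.-tuple 'I_n => sorted _ I) (Tuple sA) (sorted_enum_set A)).
by apply/setP => x; rewrite !inE /= mem_enum.
Qed.

Lemma sum_multi_index t (V : nmodType) (F : {set 'I_n} -> V) :
  \sum_(J : multi_index n t) F (iset J) = \sum_(A : {set 'I_n} | #|A| == t) F A.
Proof.
transitivity (\sum_(A in @iset t @: [set: multi_index n t]) F A).
  rewrite big_imset /=; last by move=> x y _ _; exact: iset_inj.
  by apply: eq_bigl => J; rewrite inE.
apply: eq_bigl => A; apply/imsetP/eqP => [[J _ ->]|/iset_surj[J <-]].
  exact: card_iset.
by exists J.
Qed.

Lemma multi_index_lt t (K : multi_index n t) (r r' : 'I_t) :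
  (r < r')%N -> (tnth (sval K) r < tnth (sval K) r')%N.
Proof.
move=> rr'; have i := tnth (sval K) r; rewrite !(tnth_nth i).
have := svalP K; move/(sorted_ltn_nth ltord_trans) => /(_ i).
by apply => //; rewrite inE size_tuple.
Qed.

(** K arises from J by inserting i at its place m, so the permutation sorting (i, J) moves the
    front entry to position m and keeps the order of the others. *)
Lemma tnth_insert t (i : 'I_n) (J : multi_index n t) (K : multi_index n t.+1)
    (m : 'I_t.+1) :
  i \notin iset J -> iset K = i |: iset J -> tnth (sval K) m = i ->
  forall r, tnth (sval K) r =
    tnth [tuple of i :: sval J] (lift_perm m ord0 1%g r).
Proof.
move=> iJ KE Km.
have Kinj : injective (tnth (sval K)) by apply/tuple_uniqP; exact: multi_index_uniq.
have JE : sval J = [tuple tnth (sval K) (lift m k) | k < t].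
  apply/val_inj => /=; apply: (irr_sorted_eq ltord_trans ltord_irr (svalP J)).
    have : sorted (relpre val ltn) (enum 'I_t).
      by rewrite -sorted_map val_enum_ord; exact: iota_ltn_sorted.
    move=> Hs; rewrite sorted_map; apply: (sub_sorted _ Hs) => k k' kk' /=.
    apply: multi_index_lt; rewrite /= /bump; move: kk' => /=; lia.
  move=> x; apply/idP/mapP => [xJ|[k _ ->]].
    have : x \in iset K by rewrite KE !inE xJ orbT.
    rewrite inE => /tnthP[r xr].
    have rm : m != r by apply/eqP => mr; move: iJ; rewrite inE -Km mr -xr xJ.
    have [k rk] := unlift_some rm.
    by exists k; rewrite ?mem_enum// -rk.
  have : tnth (sval K) (lift m k) \in iset K by rewrite inE mem_tnth.
  rewrite KE !inE => /orP[/eqP|//].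
  by rewrite -Km => /Kinj/eqP; rewrite eq_sym (negbTE (neq_lift _ _)).
move=> r; case: (unliftP m r) => [k|] ->.
  by rewrite lift_perm_lift perm1 tnthS JE tnth_mktuple.
by rewrite lift_perm_id Km.
Qed.

(** The number of transpositions that bring i from the front of (i, A) to its place. *)
Definition below (i : 'I_n) (A : {set 'I_n}) := #|[set j in A | (j < i)%N]|.

Lemma below_tnth t (J : multi_index n t) (i : 'I_n) (K : multi_index n t.+1)
    (m : 'I_t.+1) :
  i \notin iset J -> iset K = i |: iset J -> tnth (sval K) m = i ->
  below i (iset J) = m.
Proof.
move=> iJ KE Km.
have Kinj : injective (tnth (sval K)) by apply/tuple_uniqP; exact: multi_index_uniq.
have mt : (m <= t.+1)%N by rewrite ltnW.
pose h (k : 'I_m) := tnth (sval K) (widen_ord mt k).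
have hinj : injective h by move=> k k' /Kinj /(congr1 val) /= /val_inj.
transitivity #|h @: [set: 'I_m]|; last by rewrite card_imset// cardsT card_ord.
apply: eq_card => j; rewrite inE; apply/andP/imsetP => [[jJ ji]|[k _ ->]].
  have : j \in iset K by rewrite KE !inE; move: jJ; rewrite inE => ->; rewrite orbT.
  rewrite inE => /tnthP[r jr].
  have rm : (r < m)%N.
    rewrite ltnNge; apply/negP; rewrite leq_eqVlt => /orP[/eqP/val_inj mr|mr].
      by move: ji; rewrite jr -Km mr ltnn.
    by have := multi_index_lt K mr; rewrite Km -jr ltnNge (ltnW ji).
  by exists (Ordinal rm) => //; rewrite jr /h; congr tnth; apply/val_inj.
have hk : (h k < i)%N by rewrite -Km; apply: multi_index_lt; exact: (ltn_ord k).
split => //; have : h k \in iset K by rewrite inE mem_tnth.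
by rewrite KE !inE => /orP[/eqP hi|//]; move: hk; rewrite hi ltnn.
Qed.

Section signs.
Variable R : realType.

Definition esgn (i : 'I_n) (A : {set 'I_n}) : R[i] := (-1) ^+ below i A.

(** The permutation in the definition is forced to be the one of tnth_insert, whose parity is
    the place of i in K, that is the number of entries of J below i. *)
Lemma epsE t (i : 'I_n) (J : multi_index n t) (K : multi_index n t.+1) :
  eps R i J K = if (i \notin iset J) && (iset K == i |: iset J)
                then esgn i (iset J) else 0.
Proof.
have Kinj : injective (tnth (sval K)) by apply/tuple_uniqP; exact: multi_index_uniq.
rewrite /eps; case: pickP => [p /forallP pK|np].
  have {}pK r : tnth (sval K) r = tnth [tuple of i :: sval J] (p r) by exact/eqP/pK.
  have iJinj : injective (tnth [tuple of i :: sval J]).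
    move=> x y xy; rewrite -[x](permKV p) -[y](permKV p); congr (p _).
    by apply: Kinj; rewrite !pK !permKV.
  have iJ : i \notin iset J.
    move/tuple_uniqP: iJinj; rewrite /= => /andP[+ _].
    by rewrite inE.
  have KE : iset K = i |: iset J.
    apply/setP => x; rewrite !inE; apply/idP/idP => [/tnthP[r ->]|].
      by rewrite pK -in_cons mem_tnth.
    rewrite -in_cons => xiJ.
    have /tnthP[r ->] : x \in [tuple of i :: sval J] by [].
    by rewrite -[r](permKV p) -pK mem_tnth.
  have Km : tnth (sval K) ((p^-1)%g ord0) = i by rewrite pK permKV.
  rewrite iJ KE eqxx /= /esgn (below_tnth iJ KE Km).
  have pE : p = lift_perm ((p^-1)%g ord0) ord0 1%g.
    apply/permP => r; apply: iJinj; rewrite -pK.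
    exact: (tnth_insert iJ KE Km).
  by rewrite {1}pE odd_lift_perm odd_perm1 /= !addbF signr_odd.
case: ifP => // /andP[iJ /eqP KE].
have /tnthP[m im] : i \in sval K.
  by have := finset.setU11 i (iset J); rewrite -KE inE.
have := np (lift_perm m ord0 1%g); move/negP: (negbT (np (lift_perm m ord0 1%g))).
by case; apply/forallP => r; apply/eqP; exact: tnth_insert.
Qed.

(** At most one J contributes: removing i from K has to give the same set as removing j from
    K'. *)
Lemma sum_eps_first t (i j : 'I_n) (K K' : multi_index n t.+1) :
  \sum_(J : multi_index n t) eps R i J K * eps R j J K' =
  if [&& i \in iset K, j \in iset K' & iset K :\ i == iset K' :\ j]
  then esgn i (iset K :\ i) * esgn j (iset K' :\ j) else 0.
Proof.
pose F (A : {set 'I_n}) : R[i] := if (i \notin A) && (iset K == i |: A) && ((j \notin A) && (iset K' == j |: A))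
  then esgn i A * esgn j A else 0.
transitivity (\sum_(J : multi_index n t) F (iset J)).
  apply: eq_bigr => J _; rewrite !epsE /F.
  by case: ifP => _; case: ifP => _ //=; rewrite ?mul0r ?mulr0.
rewrite sum_multi_index.
case: ifP => [/and3P[iK jK' /eqP KK']|nK].
  rewrite (bigD1 (iset K :\ i)) /=; last first.
    by have := finset.cardsD1 i (iset K); rewrite iK card_iset add1n => -[<-].
  rewrite {1}/F !finset.setD11 /= finset.setD1K// eqxx /= KK' finset.setD11 finset.setD1K// eqxx /=.
  rewrite big1 ?addr0// => A /andP[_ nA]; rewrite /F; case: ifP => //.
  move=> /andP[/andP[iA /eqP KA] _]; case/eqP: nA.
  by rewrite -KK' KA finset.setU1K.
apply: big1 => A _; rewrite /F; case: ifP => //.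
move=> /andP[/andP[iA /eqP KA] /andP[jA /eqP K'A]].
by move: nK; rewrite KA K'A !finset.setU11 !finset.setU1K// eqxx.
Qed.

(** At most one M contributes: adding j to K has to give the same set as adding i to K'. *)
Lemma sum_eps_second t (i j : 'I_n) (K K' : multi_index n t) :
  \sum_(M : multi_index n t.+1) eps R j K M * eps R i K' M =
  if [&& j \notin iset K, i \notin iset K' & j |: iset K == i |: iset K']
  then esgn j (iset K) * esgn i (iset K') else 0.
Proof.
pose F (A : {set 'I_n}) : R[i] := if (j \notin iset K) && (A == j |: iset K) && ((i \notin iset K') && (A == i |: iset K'))
  then esgn j (iset K) * esgn i (iset K') else 0.
transitivity (\sum_(M : multi_index n t.+1) F (iset M)).
  apply: eq_bigr => J _; rewrite !epsE /F.
  by case: ifP => _; case: ifP => _ //=; rewrite ?mul0r ?mulr0.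
rewrite sum_multi_index.
case: ifP => [/and3P[jK iK' /eqP KK']|nK].
  rewrite (bigD1 (j |: iset K)) /=; last by rewrite finset.cardsU1 jK card_iset.
  rewrite {1}/F jK iK' -KK' eqxx /= big1 ?addr0// => A /andP[_ nA].
  by rewrite /F (negbTE nA) andbF.
apply: big1 => A _; rewrite /F; case: ifP => //.
by move=> /andP[/andP[jK /eqP ->] /andP[iK' KK']]; move: nK; rewrite jK iK' KK'.
Qed.

Lemma below_U1 (i j : 'I_n) (A : {set 'I_n}) : j \notin A ->
  below i (j |: A) = ((j < i) + below i A)%N.
Proof.
move=> jA; rewrite /below; case: ltnP => ji.
  rewrite (_ : [set _ in _ | _] = j |: [set k in A | (k < i)%N]).
    by rewrite finset.cardsU1 inE (negbTE jA).
  apply/setP => k; rewrite !inE; case: eqVneq => [->|//]; by rewrite ji.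
apply: eq_card => k; rewrite !inE; case: eqVneq => [->|//].
by rewrite ltnNge ji !andbF.
Qed.

(** The canonical anticommutation relations of creation and annihilation of indices. For
    distinct i and j, each of the sums has at most one term, and exchanging the order in which
    i and j are moved flips one of the signs. For i = j and K = K', exactly one of the two sums
    is nonempty, according to whether i belongs to K. *)
Lemma eps_anticommute t (i j : 'I_n) (K K' : multi_index n t.+1) :
  \sum_(J : multi_index n t) eps R i J K * eps R j J K' +
  \sum_(M : multi_index n t.+2) eps R j K M * eps R i K' M =
  ((i == j) && (K == K'))%:R.
Proof.
rewrite sum_eps_first sum_eps_second -(inj_eq (@iset_inj t.+1)).
move: (iset K) (iset K') => A B.
have [<-|ij] := eqVneq i j.
  have [<-|AB] /= := eqVneq A B.
    rewrite !eqxx !andbT !andbb; case: (boolP (i \in A)) => iA /=;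
    by rewrite ?addr0 ?add0r -expr2 -exprM mulnC exprM sqrrN !expr1n.
  case: ifP => [/and3P[iA iB /eqP E]|_].
    by case/eqP: AB; rewrite -(finset.setD1K iA) E finset.setD1K.
  case: ifP => [/and3P[iA iB /eqP E]|_]; last by rewrite addr0.
  by case/eqP: AB; rewrite -(finset.setU1K iA) E finset.setU1K.
case: ifP => [/and3P[iA jB /eqP E]|nAB].
  have iB : i \notin B by rewrite -(finset.setD1K jB) -E !inE negb_or ij eqxx.
  have jA : j \notin A by rewrite -(finset.setD1K iA) E !inE negb_or eq_sym ij eqxx.
  have UE : j |: A = i |: B.
    by rewrite -[in LHS](finset.setD1K iA) -[in RHS](finset.setD1K jB) E finset.setUCA.
  rewrite iB jA UE eqxx /= /esgn.
  have -> : below j A = ((i < j) + below j (A :\ i))%N.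
    by rewrite -below_U1 ?finset.setD11// finset.setD1K.
  have -> : below i B = ((j < i) + below i (B :\ j))%N.
    by rewrite -below_U1 ?finset.setD11// finset.setD1K.
  rewrite E !exprD; move: ij; rewrite -(inj_eq val_inj) /= neq_ltn.
  case: ltngtP => //= _ _; ring.
rewrite add0r; case: ifP => // /and3P[jA iB /eqP E].
move: nAB.
have iA : i \in A by have := finset.setU11 i B; rewrite -E !inE (negbTE ij).
have jB : j \in B by have := finset.setU11 j A; rewrite E !inE eq_sym (negbTE ij).
rewrite iA jB /=; move/eqP; case.
apply/setP => x; move/setP/(_ x): E; rewrite !inE.
move=> E; have [xj|xj] := eqVneq x j; first by rewrite xj (negbTE jA) andbF.
have [xi|xi] := eqVneq x i; first by rewrite xi (negbTE iB) andbF.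
by move: E; rewrite (negbTE xj) (negbTE xi).
Qed.

(** Each element of K contributes the square of a sign. *)
Lemma eps_number t (K K' : multi_index n t.+1) :
  \sum_i \sum_(J : multi_index n t) eps R i J K * eps R i J K' =
  (t.+1 * (K == K'))%:R.
Proof.
under eq_bigr => i _ do rewrite sum_eps_first.
rewrite -(inj_eq (@iset_inj t.+1)).
have := card_iset K; move: (iset K) (iset K') => A B At.
have [<-|AB] := eqVneq A B; last first.
  rewrite muln0 big1// => i _; case: ifP => // /and3P[iA iB /eqP E].
  by case/eqP: AB; rewrite -(finset.setD1K iA) E finset.setD1K.
rewrite muln1 -At -sum1_card natr_sum [RHS]big_mkcond; apply: eq_bigr => i _.
rewrite eqxx andbT andbb; case: ifP => // iA.
by rewrite -expr2 -exprM mulnC exprM sqrrN !expr1n.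
Qed.

End signs.
End multi_indices.

Local Open Scope classical_set_scope.
Local Open Scope ring_scope.
Local Open Scope complex_scope.

(** * Integration by parts for the normal law *)

Section normal_law.
Variable R : realType.
Local Notation leb := (@lebesgue_measure R).

Lemma integral_normal_prob (s : R) (f : R -> \bar R) :
  s != 0 -> (normal_prob 0 s).-integrable setT f ->
  (\int[normal_prob 0 s]_x f x = \int[leb]_x (f x * (normal_pdf 0 s x)%:E))%E.
Proof.
move=> s0 intf; have mf := measurable_int _ intf.
have dom := normal_prob_dominates 0 s.
rewrite -(Radon_Nikodym_change_of_variables dom)//=.
apply: ae_eq_integral => //.
- exact: emeasurable_funM.
- apply: emeasurable_funM => //=; apply/measurable_EFinP.
  exact: measurable_normal_pdf.
- apply: ae_eqe_mul2l => /=.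
  rewrite Radon_NikodymE.
  case: cid => /= h [h1 h2 h3].
  apply: integral_ae_eq => //=.
  + by apply/measurable_EFinP; exact: measurable_normal_pdf.
  + by move=> E E01 mE; rewrite -h3.
Qed.

Lemma is_derive_normal_pdf (s x : R) : s != 0 ->
  is_derive x 1 (normal_pdf 0 s) (- (x / s ^+ 2) * normal_pdf 0 s x).
Proof.
move=> s0; rewrite normal_pdfE// /normal_fun.
have H : is_derive x (1 : R) (fun x : R => - (x - 0) ^+ 2 / (s ^+ 2 *+ 2)) (- (x / s ^+ 2)).
  apply: is_derive_eq.
  by rewrite subr0 !scaler0 /GRing.scale /=; field.
apply: is_derive_eq.
by rewrite /GRing.scale /=; ring.
Qed.

(** The integrand times the normal density is the derivative of F times the density, which
    vanishes at both ends of a large interval. *)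
Lemma stein_normal (s M C : R) (F F' : R -> R) : 0 < s -> 0 < M ->
  (forall x : R, is_derive x (1 : R) F (F' x)) -> continuous F' ->
  (forall x, M < `|x| -> F x = 0 /\ F' x = 0) ->
  (forall x, `|F x| <= C /\ `|F' x| <= C) ->
  (\int[normal_prob 0 s]_x (F' x - x / s ^+ 2 * F x)%:E = 0)%E.
Proof.
move=> s0 M0 dF cF' F0 FC.
have sn0 : s != 0 by rewrite gt_eqF.
pose h x := F' x - x / s ^+ 2 * F x.
have cF : continuous F.
  by move=> x; apply/differentiable_continuous/derivable1_diffP; have [] := dF x.
have ch : continuous h.
  move=> x; apply: cvgB; first exact: cF'.
  by apply: cvgM; [apply: cvgM; [exact: cvg_id|exact: cvg_cst]|exact: cF].
have mh : measurable_fun setT h by exact: continuous_measurable_fun.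
have hb x : `|h x| <= C + M / s ^+ 2 * C.
  have [xM|xM] := ltP M `|x|.
    have [F0x F0'x] := F0 _ xM; rewrite /h F0x F0'x mulr0 subr0 normr0.
    have C0 : 0 <= C by rewrite (le_trans _ (FC 0).1).
    by rewrite addr_ge0// mulr_ge0// divr_ge0 ?exprn_ge0// ltW.
  have [Fx F'x] := FC x.
  rewrite (le_trans (ler_normB _ _))// lerD// normrM ler_pM//.
  by rewrite normrM ler_pM// ger0_norm// invr_ge0 exprn_ge0// ltW.
have ih : (normal_prob 0 s).-integrable setT (EFin \o h).
  apply: (@le_integrable _ _ _ (normal_prob 0 s) setT measurableT (EFin \o h)
    (cst (C + M / s ^+ 2 * C)%:E)); first exact/measurable_EFinP.
    by move=> x _ /=; rewrite lee_fin (le_trans (hb x))// ler_norm.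
  exact: finite_measure_integrable_cst.
rewrite integral_normal_prob//.
(* An antiderivative of the integrand times the density. *)
pose G x := F x * normal_pdf 0 s x.
have dG (x : R) : is_derive x (1 : R) G (h x * normal_pdf 0 s x).
  have := dF x; have := is_derive_normal_pdf x sn0 => dn dFx.
  apply: is_derive_eq; rewrite /GRing.scale /= /h; ring.
have cG' : continuous (fun x => h x * normal_pdf 0 s x).
  by move=> x; apply: cvgM; [exact: ch|exact: continuous_normal_pdf].
have cG : continuous G.
  by move=> x; apply/differentiable_continuous/derivable1_diffP; have [] := dG x.
have -> : (\int[leb]_x ((EFin \o h) x * (normal_pdf 0 s x)%:E) =
  \int[leb]_(x in `[(- (M + 1))%R, (M + 1)%R]) (h x * normal_pdf 0 s x)%:E)%E.
  rewrite [RHS]integral_mkcond; apply: eq_integral => x _.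
  rewrite patchE; case: ifPn => //; rewrite notin_setE/= in_itv/= => /negP.
  rewrite -ler_norml -ltNge => xM.
  have [F0x F0'x] := F0 x ltac:(lra).
  by rewrite /h F0x F0'x mulr0 subr0 mul0e.
rewrite (@continuous_FTC2 _ _ G).
- have M1 : M < `|M + 1| by rewrite ger0_norm; lra.
  have [GM _] := F0 _ M1; have [GN _] := F0 (- (M + 1)) ltac:(by rewrite normrN).
  by rewrite -EFinB /G GM GN !mul0r subr0.
- lra.
- by apply: continuous_subspaceT.
- split.
  + by move=> x _; have [] := dG x.
  + by apply: cvg_at_right_filter; exact: cG.
  + by apply: cvg_at_left_filter; exact: cG.
- by move=> x _; rewrite derive1E; have [_ ->] := dG x.
Qed.

End normal_law.

(** * Measurable and continuous functions on C^n *)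

Section Cn_measurability.
Variables (R : realType) (n : nat).
Local Notation Cn := (Cn R n).

Lemma measurable_pair_coord (j : 'I_n) : measurable_fun setT (pair_coord j : Cn -> R * R).
Proof.
move=> _ Y mY; rewrite setTI; apply: sub_sigma_algebra => /=.
rewrite -bigcup_seq/=; exists j => /=; first by rewrite mem_index_enum.
by exists Y => //; rewrite setTI.
Qed.

Lemma I2_cases (l : 'I_2) : l = 0 \/ l = 1.
Proof. by case: l => -[|[|//]] i; [left|right]; apply/val_inj. Qed.

Lemma measurable_coord (j : 'I_n) (l : 'I_2) : measurable_fun setT (fun z : Cn => z j l).
Proof.
case: (I2_cases l) => ->.
  exact: (measurableT_comp measurable_fst (measurable_pair_coord j)).
exact: (measurableT_comp measurable_snd (measurable_pair_coord j)).
Qed.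

Lemma measurable_Cn d (T : measurableType d) (f : T -> Cn) :
  (forall j l, measurable_fun setT (fun x => f x j l)) -> measurable_fun setT f.
Proof.
move=> mf; suff H : g_sigma_preimage (fun j : 'I_n => pair_coord j \o f) `<=` measurable.
  move=> _ A mA; rewrite setTI; apply: H.
  by rewrite g_sigma_preimage_comp; exists A => //; rewrite setTI.
apply: smallest_sub; first exact: sigma_algebra_measurable.
rewrite -bigcup_seq => A [j _ [B mB <-]].
apply: (measurable_fun_pair (mf j 0) (mf j 1)) => //.
Qed.

(** Rounding the coordinates to multiples of 1 / (N + 1) factors a function through the
    countable type of integer matrices. Passing to the limit in N, continuous functions are
    measurable for the product sigma-algebra, without comparing it with the Borel one. *)
Definition grid N (M : 'M[int]_(n, 2)) : Cn := \matrix_(j, l) ((M j l)%:~R / N.+1%:R).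
Definition cell N (z : Cn) : 'M[int]_(n, 2) := \matrix_(j, l) Num.floor (N.+1%:R * z j l).

Lemma measurable_cell N M : measurable [set z | cell N z = M].
Proof.
have -> : [set z | cell N z = M] =
   \bigcap_(j in [set: 'I_n]) \bigcap_(l in [set: 'I_2])
   [set z : Cn | (M j l)%:~R <= N.+1%:R * z j l < (M j l)%:~R + 1].
  apply/seteqP; split=> z /=.
    move=> <- j _ l _ /=; rewrite mxE.
    exact: (mem_rg1_floor (N.+1%:R * z j l)).
  move=> h; apply/matrixP => j l; rewrite mxE; apply: floor_def.
  by have := h j I l I; rewrite /= intrD.
apply: fin_bigcap_measurable => // j _; apply: fin_bigcap_measurable => // l _.
have mg : measurable_fun setT (fun z : Cn => N.+1%:R * z j l).
  by apply: measurable_funM => //; exact: measurable_coord.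
have := mg measurableT `[(M j l)%:~R, ((M j l)%:~R + 1)%R[%classic (measurable_itv _).
by rewrite setTI; congr measurable; apply/seteqP; split=> z; rewrite /= in_itv.
Qed.

Lemma measurable_fun_cell N (g : 'M[int]_(n, 2) -> R) :
  measurable_fun setT (g \o cell N).
Proof.
move=> _ Y mY; rewrite setTI.
have -> : (g \o cell N) @^-1` Y =
   \bigcup_k [set z | exists M, [/\ unpickle k = Some M, Y (g M) & cell N z = M]].
  apply/seteqP; split=> z /=.
    by move=> Yz; exists (pickle (cell N z)) => //=; exists (cell N z); rewrite pickleK.
  by move=> [k _ [M [_ + ->]]].
apply: bigcupT_measurable => k.
case: (unpickle k) => [M|]; last first.
  rewrite (_ : [set _ | _] = set0) ?measurable0//; apply/seteqP; split=> z //=.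
  by case=> ? [].
have [YM|YM] := pselect (Y (g M)).
  rewrite (_ : [set _ | _] = [set z | cell N z = M]); first exact: measurable_cell.
  apply/seteqP; split=> z /=; first by move=> [? [[<-]]].
  by move=> zM; exists M.
rewrite (_ : [set _ | _] = set0) ?measurable0//; apply/seteqP; split=> z //=.
by case=> ? [[<-]].
Qed.

Lemma cvg_grid (z : Cn) : grid N (cell N z) @[N --> \oo] --> z.
Proof.
apply/cvgrPdist_le => e e0; near=> N.
rewrite [X in X <= _]mx_normrE; apply/bigmax_leP; split=> [|[j l] _ /=].
  exact: ltW.
rewrite !mxE.
have /andP[h1 h2] := mem_rg1_floor (N.+1%:R * z j l).
have N0 : 0 < N.+1%:R :> R by [].
have Ne : N.+1%:R^-1 < e.
  near: N; exact: (near_infty_natSinv_lt (PosNum e0)).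
rewrite ler_norml; apply/andP; split.
  rewrite (le_trans _ (_ : 0 <= _))//; first by rewrite lerNl oppr0 ltW.
  by rewrite subr_ge0 ler_pdivrMr// [leRHS]mulrC.
rewrite (le_trans _ (ltW Ne))// lerBlDl -[X in _ + X]div1r -mulrDl ler_pdivlMr//.
by rewrite mulrC ltW.
Unshelve. all: by end_near. Qed.

Lemma continuous_measurable_Cn (f : Cn -> R) : continuous f -> measurable_fun setT f.
Proof.
move=> cf; apply: (@measurable_fun_cvg _ _ _ _ (fun N => (f \o grid N) \o cell N)).
  by move=> N; exact: measurable_fun_cell.
move=> z _; apply: (continuous_cvg _ (cf z)); exact: cvg_grid.
Qed.

End Cn_measurability.

(** * The Gaussian measure one coordinate at a time *)

Section gaussian_measure.
Variables (R : realType) (a : nat -> {posnum R}) (n : nat).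
Local Notation Cn := (Cn R n).
Local Notation mu := (gaussCn a n).

(** The density on the plane is a product, so Tonelli separates the two coordinates. *)
Lemma gauss1X (s : {posnum R}) (A B : set R) : measurable A -> measurable B ->
  (gauss1 s (A `*` B) = normal_prob 0 s%:num A * normal_prob 0 s%:num B)%E.
Proof.
move=> mA mB; rewrite [LHS]/= /gauss1 integral_mkcond fubini_tonelli1//=; last 2 first.
- apply/(measurable_restrictT _ _).1; first exact: measurableX.
  by apply: measurable_funTS; apply/measurable_EFinP; exact: measurable_gauss_pdf.
- by move=> z; apply: erestrict_ge0 => w _; rewrite lee_fin gauss_pdf_ge0.
rewrite /fubini_F /normal_prob.
rewrite (_ : (fun _ => _) = fun x : R => ((((fun x => (normal_pdf 0 s%:num x)%:E) \_ A) x *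
   \int[lebesgue_measure]_(y in B) (normal_pdf 0 s%:num y)%:E))%E); last first.
  apply/funext => x; rewrite [in RHS]integral_mkcond -ge0_integralZl//; last 3 first.
  - apply/(measurable_restrictT _ _).1 => //.
    by apply: measurable_funTS; apply/measurable_EFinP; exact: measurable_normal_pdf.
  - by move=> y _; apply: erestrict_ge0 => w _; rewrite lee_fin normal_pdf_ge0.
  - by apply: erestrict_ge0 => w _; rewrite lee_fin normal_pdf_ge0.
  apply: eq_integral => y _; rewrite !patchE.
  have -> : ((x, y) \in A `*` B) = (x \in A) && (y \in B).
    by apply/idP/andP; rewrite !inE.
  case: (x \in A); case: (y \in B) => //=; rewrite ?mul0e ?mule0//.
  by rewrite gauss_pdf_normal EFinM.
rewrite ge0_integralZr//.
- by rewrite -integral_mkcond.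
- apply/(measurable_restrictT _ _).1 => //.
  by apply: measurable_funTS; apply/measurable_EFinP; exact: measurable_normal_pdf.
- by move=> y _; apply: erestrict_ge0 => w _; rewrite lee_fin normal_pdf_ge0.
- by apply: integral_ge0 => y _; rewrite lee_fin normal_pdf_ge0.
Qed.

Definition rect (B : nat -> nat -> set R) : set Cn :=
  [set z : Cn | forall (j : 'I_n) (l : 'I_2), B j l (z j l)].

Lemma measurable_rect B : (forall j l, measurable (B j l)) -> measurable (rect B).
Proof.
move=> mB; have -> : rect B = \bigcap_(j in [set: 'I_n]) \bigcap_(l in [set: 'I_2])
   (fun z : Cn => z j l) @^-1` B j l.
  by apply/seteqP; split=> z h j *; [move=> l _; exact: h|apply: h].
apply: fin_bigcap_measurable => // j _; apply: fin_bigcap_measurable => // l _.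
by rewrite -[X in measurable X]setTI; apply: measurable_coord.
Qed.

Lemma gaussCn_rect B : (forall j l, measurable (B j l)) ->
  mu (rect B) = (\prod_(j < n) (normal_prob 0 (a j)%:num (B j 0%N) *
                               normal_prob 0 (a j)%:num (B j 1%N)))%E.
Proof.
move=> mB; rewrite (_ : mu _ =
  iprod (fun i => gauss1 (a i)) n (@Cn_of_tuple R n @^-1` rect B))//.
have -> : @Cn_of_tuple R n @^-1` rect B =
    [set u | forall j : 'I_n, (B j 0%N `*` B j 1%N) (tnth u j)].
  apply/seteqP; split=> u /= h j.
    have h0 := h j 0; have h1 := h j 1; move: h0 h1.
    by rewrite /= /Cn_of_tuple !mxE /=.
  move=> l; case: (I2_cases l) => ->; rewrite /Cn_of_tuple !mxE /=; apply h.
have mBX j : measurable (B j 0%N `*` B j 1%N) by exact: measurableX.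
rewrite (iprodE (fun i => gauss1 (a i)) n mBX).
by apply: eq_bigr => j _; exact: gauss1X.
Qed.

Definition rects : set (set Cn) := [set rect B | B in [set B | forall j l, measurable (B j l)]].

Lemma rects_setI : setI_closed rects.
Proof.
move=> _ _ [B mB <-] [B' mB' <-]; exists (fun j l => B j l `&` B' j l).
  by move=> j l; exact: measurableI.
apply/seteqP; split=> z /=; first by move=> h; split=> j l; have [] := h j l.
by move=> [h h'] j l; split; [exact: h|exact: h'].
Qed.

Lemma measurable_rects : measurable = <<s rects >> :> set (set Cn).
Proof.
apply/seteqP; split; last first.
  apply: smallest_sub; first exact: sigma_algebra_measurable.
  by move=> _ [B mB <-]; exact: measurable_rect.
suff : measurable_fun setT (idfun : g_sigma_algebraType rects -> Cn).
  by move=> h A mA; have := h measurableT A mA; rewrite setTI preimage_id.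
apply: measurable_Cn => j l _ Y mY; rewrite setTI; apply: sub_sigma_algebra.
exists (fun j' l' => if (j' == j :> nat) && (l' == l :> nat) then Y else setT).
  by move=> j' l'; case: ifP.
apply/seteqP; split=> z /=; first by move=> /(_ j l); rewrite !eqxx.
by move=> Yz j' l'; case: ifP => // /andP[/eqP/val_inj-> /eqP/val_inj->].
Qed.

(** Rectangles are stable under intersection and generate the sigma-algebra. *)
Lemma gaussCn_unique (nu : {measure set Cn -> \bar R}) :
  (forall B, (forall j l, measurable (B j l)) -> mu (rect B) = nu (rect B)) ->
  forall A, measurable A -> mu A = nu A.
Proof.
move=> h A mA; apply: (measure_unique rects (fun _ => setT)) => //.
- exact: measurable_rects.
- exact: rects_setI.
- move=> _; exists (fun _ _ => setT) => //.
  by apply/seteqP; split=> z.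
- by rewrite bigcup_const.
- by move=> _ [B mB <-]; exact: h.
- by move=> k; rewrite [X in (X < _)%E]probability_setT ltry.
Qed.

Definition set_coord (i : 'I_n) (k : 'I_2) (p : R * Cn) : Cn :=
  \matrix_(j, l) if (j == i) && (l == k) then p.1 else p.2 j l.

Lemma measurable_set_coord i k : measurable_fun setT (set_coord i k).
Proof.
apply: measurable_Cn => j l; rewrite /set_coord.
under eq_fun do rewrite mxE.
have [_|_] := boolP ((j == i) && (l == k)); first exact: measurable_fst.
exact: (measurableT_comp (measurable_coord j l) measurable_snd).
Qed.

HB.instance Definition _ i k := isMeasurableFun.Build _ _ _ _ (set_coord i k) (measurable_set_coord i k).

(** The 2n real coordinates are independent, so drawing one of them afresh from its own law
    leaves the measure unchanged. It turns an integral over C^n into an iterated one whose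
    inner variable is whichever real coordinate is needed. *)
Lemma resample (i : 'I_n) (k : 'I_2) A : measurable A ->
  mu A = pushforward (normal_prob 0 (a i)%:num \x mu)%E (set_coord i k) A.
Proof.
move=> mA.
apply: (gaussCn_unique (nu := pushforward (normal_prob 0 (a i)%:num \x mu)%E (set_coord i k))) => //.
  exact: measurable_set_coord.
move=> mset_coord B mB.
rewrite /= /pushforward.
pose B' j l := if (j == i :> nat) && (l == k :> nat) then setT else B j l.
have mB' j l : measurable (B' j l) by rewrite /B'; case: ifP.
have -> : set_coord i k @^-1` rect B = B i k `*` rect B'.
  apply/seteqP; split=> -[x z] /=.
    move=> h; split; first by have := h i k; rewrite mxE !eqxx.
    move=> j l; have := h j l; rewrite mxE /B'.
    rewrite -(inj_eq val_inj j) -(inj_eq val_inj l).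
    by case: ifP.
  move=> [h1 h2] j l; have := h2 j l; rewrite mxE /B'.
  rewrite -(inj_eq val_inj j) -(inj_eq val_inj l).
  by case: ifP => // /andP[/eqP/val_inj-> /eqP/val_inj->].
have HP : (normal_prob 0 (a i)%:num \x mu)%E (B i k `*` rect B') =
    (normal_prob 0 (a i)%:num (B i k) * mu (rect B'))%E.
  by apply: product_measure1E; [exact: mB|exact: measurable_rect].
rewrite [RHS]HP [LHS](gaussCn_rect mB) (gaussCn_rect mB') (bigD1 i)//= [in RHS](bigD1 i)//=.
rewrite [in RHS](eq_bigr (fun j : 'I_n => (normal_prob 0 (a j)%:num (B j 0%N) *
                               normal_prob 0 (a j)%:num (B j 1%N))%E)); last first.
  by move=> j ji; rewrite /B' !(inj_eq val_inj) (negbTE ji).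
have pT : normal_prob 0 (a i)%:num setT = 1%E by exact: probability_setT.
rewrite /B' !eqxx /= muleA; congr (_ * _)%E.
by case: (I2_cases k) => -> /=; rewrite pT ?mule1 ?mul1e// muleC.
Qed.

Lemma integral_resample (i : 'I_n) (k : 'I_2) (f : Cn -> R) : mu.-integrable setT (EFin \o f) ->
  (\int[mu]_z (f z)%:E =
   \int[mu]_z \int[normal_prob 0 (a i)%:num]_x (f (set_coord i k (x, z)))%:E)%E.
Proof.
move=> intf.
have mf := measurable_int _ intf.
pose nu := pushforward (normal_prob 0 (a i)%:num \x mu)%E (set_coord i k).
have intf' : (normal_prob 0 (a i)%:num \x mu)%E.-integrable setT ((EFin \o f) \o set_coord i k).
  have /integrableP[_ h] := intf.
  apply/integrableP; split; first exact: (measurableT_comp mf (measurable_set_coord i k)).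
  have E : (\int[mu]_x `|(EFin \o f) x| = \int[nu]_x `|(EFin \o f) x|)%E.
    apply: eq_measure_integral; first exact: measurable_set_coord.
    by move=> mset_coord A mA _; exact: resample.
  move: h; rewrite E ge0_integral_pushforward//= ?preimage_setT//.
    exact: measurable_set_coord.
  apply/measurable_EFinP; apply: measurableT_comp => //.
  exact/measurable_EFinP.
transitivity (\int[nu]_z (f z)%:E)%E.
  apply: eq_measure_integral; first exact: measurable_set_coord.
  by move=> mset_coord A mA _; exact: resample.
rewrite integral_pushforward//= ?preimage_setT//; last exact: measurable_set_coord.
by rewrite -integral21_prod_meas1.
Qed.

Lemma ge0_integral_resample (i : 'I_n) (k : 'I_2) (f : Cn -> \bar R) :
  measurable_fun setT f -> (forall z, (0 <= f z)%E) ->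
  (\int[mu]_z f z =
   \int[mu]_z \int[normal_prob 0 (a i)%:num]_x (f (set_coord i k (x, z))))%E.
Proof.
move=> mf f0.
pose nu := pushforward (normal_prob 0 (a i)%:num \x mu)%E (set_coord i k).
transitivity (\int[nu]_z f z)%E.
  apply: eq_measure_integral; first exact: measurable_set_coord.
  by move=> mset_coord A mA _; exact: resample.
rewrite ge0_integral_pushforward//= ?preimage_setT//; last exact: measurable_set_coord.
rewrite fubini_tonelli2//.
exact: (measurableT_comp mf (measurable_set_coord i k)).
Qed.

Lemma set_coord_shift (i : 'I_n) (k : 'I_2) (x h : R) (z : Cn) :
  set_coord i k (h + x, z) = h *: evec R (i, k) + set_coord i k (x, z).
Proof.
apply/matrixP => j l; rewrite !mxE /=.
by case: ifP => _; rewrite ?mulr1 ?mulr0 ?add0r.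
Qed.

Lemma is_derive_set_coord (i : 'I_n) (k : 'I_2) (f : Cn -> R) (d x : R) (z : Cn) :
  is_derive (set_coord i k (x, z)) (evec R (i, k)) f d ->
  is_derive x (1 : R) (fun x => f (set_coord i k (x, z))) d.
Proof.
move=> [df fd].
have E : (fun h : R => h^-1 *: (((fun x => f (set_coord i k (x, z))) \o shift x) (h *: (1 : R)) -
      f (set_coord i k (x, z)))) =
   (fun h : R => h^-1 *: ((f \o shift (set_coord i k (x, z))) (h *: evec R (i, k)) - f (set_coord i k (x, z)))).
  by apply/funext => h /=; rewrite -set_coord_shift /GRing.scale /= mulr1.
apply: DeriveDef; first by rewrite /derivable E.
by rewrite -fd /derive E.
Qed.

Lemma continuous_set_coord (i : 'I_n) (k : 'I_2) (z : Cn) :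
  continuous (fun x : R => set_coord i k (x, z)).
Proof.
move=> x; rewrite (_ : (fun x => _) = fun x : R => x *: evec R (i, k) + set_coord i k (0, z)).
  apply: cvgD; last exact: cvg_cst.
  by apply: cvgZl; exact: cvg_id.
by apply/funext => y; rewrite -set_coord_shift addr0.
Qed.

(** Resampling the coordinate (i, k) reduces the claim to the identity for the normal law on
    each line in that direction; the bounds make the integrand integrable beforehand. *)
Lemma gaussian_ibp (i : 'I_n) (k : 'I_2) (f g : Cn -> R) (M C : R) : 0 < M ->
  continuous f -> continuous g ->
  (forall z : Cn, is_derive z (evec R (i, k)) f (g z)) ->
  (forall z, `|f z| <= C /\ `|g z| <= C) ->
  (forall z : Cn, M < `|z i k| -> f z = 0 /\ g z = 0) ->
  (\int[mu]_z (g z - z i k / (a i)%:num ^+ 2 * f z)%:E = 0)%E.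
Proof.
move=> M0 cf cg dfg fC f0.
have a0 : 0 <= (a i)%:num ^+ 2 by [].
have C0 : 0 <= C by rewrite (le_trans _ (fC 0).1).
have mh : measurable_fun setT (fun z : Cn => g z - z i k / (a i)%:num ^+ 2 * f z).
  apply: measurable_funB; first exact: continuous_measurable_Cn.
  apply: measurable_funM; last exact: continuous_measurable_Cn.
  by apply: measurable_funM => //; exact: measurable_coord.
rewrite (integral_resample i k); last first.
  apply: (@le_integrable _ _ _ mu setT measurableT _
    (cst (C + M / (a i)%:num ^+ 2 * C)%:E)); first exact/measurable_EFinP.
    move=> z _ /=; rewrite lee_fin (le_trans _ (ler_norm _))//.
    have [zM|zM] := ltP M `|z i k|.
      have [-> ->] := f0 _ zM; rewrite mulr0 subr0 normr0.
      by rewrite addr_ge0// mulr_ge0// divr_ge0// ltW.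
    have [fz gz] := fC z.
    rewrite (le_trans (ler_normB _ _))// lerD// normrM ler_pM//.
    by rewrite normrM ler_pM// ger0_norm// invr_ge0.
  exact: finite_measure_integrable_cst.
apply: integral0_eq => z _.
have E (x : R) : set_coord i k (x, z) i k = x by rewrite mxE !eqxx.
under eq_integral do rewrite E.
apply: (@stein_normal _ _ M C (fun x => f (set_coord i k (x, z))) (fun x => g (set_coord i k (x, z)))) => //.
- by move=> x; apply: is_derive_set_coord.
- by move=> x; apply: (continuous_comp (@continuous_set_coord i k z x) (cg _)).
- by move=> x xM; apply: f0; rewrite E.
Qed.

End gaussian_measure.

(** * Exponential moments of the Gaussian measure *)

Section gaussian_moments.
Variable R : realType.

(** The weight times the normal density of deviation s is a multiple of the normal density of
    deviation sqrt 2 times s. *)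
Lemma normal_exp_moment (s : {posnum R}) :
  (\int[normal_prob 0 s%:num]_x (expR (x ^+ 2 / (4 * s%:num ^+ 2)))%:E < +oo)%E.
Proof.
have S0 : 0 < s%:num by []; move: (s%:num) S0 => S S0.
have Sn0 : S != 0 by rewrite gt_eqF.
pose w (x : R) := expR (x ^+ 2 / (4 * S ^+ 2)).
have mw : measurable_fun setT w.
  apply: measurableT_comp; first exact: measurable_expR.
  by apply: measurable_funM => //; exact: measurable_funX.
(* exp(x^2 / (4 S^2)) halves the exponent - x^2 / (2 S^2) of the density. *)
pose S2 := Num.sqrt 2 * S.
have S20 : S2 != 0 by rewrite mulf_neq0 // gt_eqF// sqrtr_gt0.
have wpdf x : w x * normal_pdf 0 S x = Num.sqrt 2 * normal_pdf 0 S2 x.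
  rewrite !normal_pdfE// /normal_peak /normal_fun /w !subr0 mulrCA -expRD.
  have E2 : Num.sqrt 2 ^+ 2 = 2 :> R by rewrite sqr_sqrtr.
  have -> : S2 ^+ 2 = 2 * S ^+ 2 by rewrite /S2 exprMn E2.
  rewrite [RHS]mulrA; congr (_ * expR _); last by field.
  have -> : 2 * S ^+ 2 * pi *+ 2 = 2 * (S ^+ 2 * pi *+ 2) :> R by ring.
  rewrite [in RHS]sqrtrM// invfM mulrA divff ?mul1r//.
pose wN (N : nat) (x : R) := Num.min (w x) N%:R.
have mwN N : measurable_fun setT (wN N) by exact: measurable_minr.
have wN0 N x : 0 <= wN N x by rewrite le_min expR_ge0 ler0n.
have iwN N : (\int[normal_prob 0 S]_x (wN N x)%:E <= (Num.sqrt 2)%:E)%E.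
  rewrite integral_normal_prob//; last first.
    apply: (@le_integrable _ _ _ (normal_prob 0 S) setT measurableT (EFin \o wN N)
      (cst (N%:R)%:E)); first by apply/measurable_EFinP; exact: mwN.
      by move=> x _ /=; rewrite lee_fin !ger0_norm// ge_min lexx orbT.
    exact: finite_measure_integrable_cst.
  rewrite -[leRHS]mule1 -(integral_normal_pdf 0 S2) -ge0_integralZl//; last 2 first.
  - by apply/measurable_EFinP; exact: measurable_normal_pdf.
  - by move=> x _; rewrite lee_fin normal_pdf_ge0.
  apply: ge0_le_integral => //.
  - by move=> x _; rewrite mule_ge0// lee_fin// normal_pdf_ge0.
  - by apply: emeasurable_funM; apply/measurable_EFinP;
      [exact: mwN|exact: measurable_normal_pdf].
  - by apply: emeasurable_funM; apply/measurable_EFinP => //;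
      exact: measurable_normal_pdf.
  - move=> x _; rewrite -EFinM lee_fin -wpdf ler_wpM2r ?normal_pdf_ge0//.
    by rewrite ge_min lexx.
apply: (@le_lt_trans _ _ (Num.sqrt 2)%:E); last exact: ltry.
have wl x : (fun N => (wN N x)%:E) @ \oo --> (w x)%:E.
  apply: cvg_near_cst; near=> N; congr EFin; apply/min_idPl.
  near: N; exact: nbhs_infty_ger.
rewrite (_ : (\int[_]_x _)%E = lim ((\int[normal_prob 0 S]_x (wN N x)%:E)%E @[N --> \oo])).
  apply: lime_le; last by apply: nearW.
  apply: ereal_nondecreasing_is_cvgn => m N mN; apply: ge0_le_integral => //.
  - by move=> x _; rewrite lee_fin.
  - by apply/measurable_EFinP; exact: mwN.
  - by apply/measurable_EFinP; exact: mwN.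
  - by move=> x _; rewrite lee_fin /wN le_min ge_min lexx /= ge_min ler_nat mN orbT.
rewrite -monotone_convergence//.
- by apply: eq_integral => x _; apply/esym/cvg_lim => //; exact: wl.
- by move=> N; by apply/measurable_EFinP; exact: mwN.
- by move=> N x _; rewrite lee_fin.
- by move=> x _ m N mN; rewrite lee_fin /wN le_min ge_min lexx /= ge_min ler_nat mN orbT.
Unshelve. all: by end_near.
Qed.

Variables (a : nat -> {posnum R}) (n : nat).
Local Notation mu := (gaussCn a n).

Definition Qsum (S : seq ('I_n * 'I_2)) (z : Cn R n) : R :=
  \sum_(p <- S) z p.1 p.2 ^+ 2 / (4 * (a p.1)%:num ^+ 2).

Lemma measurable_Qsum S : measurable_fun setT (Qsum S).
Proof.
apply: measurable_sum => p; apply: measurable_funM => //.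
by apply: measurable_funX; exact: measurable_coord.
Qed.

Lemma Qsum_exp_moment S : uniq S -> (\int[mu]_z (expR (Qsum S z))%:E < +oo)%E.
Proof.
have mE S' : measurable_fun setT (fun z => (expR (Qsum S' z))%:E).
  apply/measurable_EFinP; apply: measurableT_comp; first exact: measurable_expR.
  exact: measurable_Qsum.
elim: S => [_|[i k] S ih /= /andP[ikS uS]].
  rewrite (eq_integral (cst 1%E)); last by move=> z _; rewrite /Qsum big_nil expR0.
  by rewrite integral_cst// mul1e (@le_lt_trans _ _ 1%E) ?probability_le1 ?ltry.
rewrite (@ge0_integral_resample _ a n i k)//.
pose w (x : R) := expR (x ^+ 2 / (4 * (a i)%:num ^+ 2)).
have mw : measurable_fun setT w.
  apply: measurableT_comp; first exact: measurable_expR.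
  by apply: measurable_funM => //; exact: measurable_funX.
have E x z : expR (Qsum ((i, k) :: S) (set_coord i k (x, z))) = w x * expR (Qsum S z).
  rewrite /Qsum big_cons /= expRD mxE !eqxx; congr (_ * expR _).
  apply: eq_big_seq => -[j l] jlS; rewrite mxE /=.
  case: ifP => // /andP[/eqP ji /eqP lk]; move: ikS; by rewrite -ji -lk jlS.
under eq_integral => z _.
  under eq_integral => x _ do rewrite E EFinM.
  rewrite ge0_integralZr//; last 2 first.
  - exact/measurable_EFinP.
  - by move=> x _; rewrite lee_fin expR_ge0.
  over.
have w0 : (0 <= \int[normal_prob 0 (a i)%:num]_x (w x)%:E)%E.
  by apply: integral_ge0 => x _; rewrite lee_fin expR_ge0.
rewrite ge0_integralZl//.
rewrite lte_mul_pinfty// ?ge0_fin_numE//; first exact: normal_exp_moment.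
exact: ih.
Qed.

(** Half of the quadratic form in the exponent of the Gaussian density: its exponential is
    still integrable, and dominates every polynomial. *)
Definition Qexp : Cn R n -> R := Qsum (index_enum _).

Lemma QexpE z : Qexp z = \sum_p z p.1 p.2 ^+ 2 / (4 * (a p.1)%:num ^+ 2).
Proof. by []. Qed.

Lemma Qexp_ge0 z : 0 <= Qexp z.
Proof.
by apply: sumr_ge0 => p _; rewrite mulr_ge0 ?sqr_ge0// invr_ge0 mulr_ge0.
Qed.

Lemma gaussCn_exp_moment : (\int[mu]_z (expR (Qexp z))%:E < +oo)%E.
Proof. by apply: Qsum_exp_moment; exact: index_enum_uniq. Qed.

End gaussian_moments.

(** * Smooth functions and cut-offs *)

Section flat_functions.
Variable R : realType.

(** The functions P(1/x) exp(-1/x) extended by 0 for x <= 0. Differentiation maps this family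
    to itself, which is how exp(-1/x) is seen to be smooth at 0. *)
Definition flat (P : {poly R}) (x : R) : R :=
  if 0 < x then P.[x^-1] * expR (- x^-1) else 0.

Definition dflat (P : {poly R}) : {poly R} := (P - P^`()) * 'X^2.

Lemma poly_expR_bound (Q : {poly R}) m :
  exists C, forall y, 0 <= y -> `|Q.[y]| * y ^+ m * expR (- y) <= C.
Proof.
elim/poly_ind: Q m => [|Q c ih] m.
  by exists 0 => y _; rewrite horner0 normr0 !mul0r.
have [C hC] := ih m.+1.
have [D hD] : exists D, forall y : R, 0 <= y -> y ^+ m * expR (- y) <= D.
  case: m {ih C hC} => [|m].
    by exists 1 => y y0; rewrite expr0 mul1r -expR0 ler_expR oppr_le0.
  exists m.+1`!%:R => y y0; rewrite expRN ler_pdivrMr ?expR_gt0//.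
  rewrite mulrC -ler_pdivrMr ?ltr0n ?fact_gt0//.
  by rewrite (le_trans _ (expR_ge1Dxn m y0))// lerDr.
exists (C + `|c| * D) => y y0; rewrite hornerMXaddC.
apply: (@le_trans _ _ ((`|Q.[y]| * y + `|c|) * y ^+ m * expR (- y))).
  rewrite ler_wpM2r ?expR_ge0// ler_wpM2r ?exprn_ge0//.
  by rewrite (le_trans (ler_normD _ _))// normrM (ger0_norm y0).
rewrite mulrDl mulrDl lerD//; last by rewrite -mulrA ler_wpM2l//; exact: hD.
by rewrite -[_ * y * _]mulrA -exprS; exact: hC.
Qed.

Lemma flat_bound P : exists2 C, 0 <= C & forall x, `|flat P x| <= C.
Proof.
have [C hC] := poly_expR_bound P 0.
have C0 : 0 <= C.
  by have := hC 0 (lexx _); apply: le_trans; rewrite !mulr_ge0 ?expR_ge0.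
exists C => // x; rewrite /flat; case: ifP => [x0|_]; last by rewrite normr0.
rewrite normrM (ger0_norm (expR_ge0 _)).
by have := hC x^-1; rewrite expr0 mulr1; apply; rewrite invr_ge0 ltW.
Qed.

Lemma flat_quad P : exists2 C, 0 <= C & forall x, `|flat P x| <= C * x ^+ 2.
Proof.
have [C C0 hC] := flat_bound (P * 'X^2).
exists C => // x; have := hC x; rewrite /flat; case: ifP => [x0|_ _].
  rewrite hornerM hornerXn mulrAC normrM exprVn.
  rewrite (ger0_norm (_ : 0 <= x ^- 2)) ?invr_ge0 ?sqr_ge0//.
  by rewrite ler_pdivrMr ?exprn_gt0.
by rewrite normr0 mulr_ge0// sqr_ge0.
Qed.

(** At 0 the difference quotient tends to 0 by the quadratic bound flat_quad. *)
Lemma is_derive_flat P (x : R) : is_derive x (1 : R) (flat P) (flat (dflat P) x).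
Proof.
have [x0|x0|x0] := ltgtP x 0.
- apply: (@near_eq_is_derive _ _ _ (cst 0)).
    near=> y; rewrite /flat /= ltNge ltW//.
    by near: y; exact: lt_nbhsl.
  by apply: is_derive_eq; rewrite /flat ltNge ltW.
- have -> : flat (dflat P) x = (P - P^`()).[x^-1] * x^-1 ^+ 2 * expR (- x^-1).
    by rewrite /flat x0 hornerM hornerXn.
  apply: (@near_eq_is_derive _ _ _ (fun y : R => P.[y^-1] * expR (- y^-1))).
    near=> y; rewrite /flat ifT//.
    by near: y; exact: lt_nbhsr.
  have xn0 : x != 0 by rewrite gt_eqF.
  have dV : is_derive x (1 : R) (fun y : R => y^-1) (- x ^- 2).
    by have := @is_deriveV R id x 1 1 xn0 (is_derive_id x 1); rewrite /GRing.scale /= mulr1.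
  have dP : is_derive x (1 : R) (fun y : R => P.[y^-1]) (P^`().[x^-1] * - x ^- 2).
    have dp : is_derive x^-1 (1 : R) (fun y => P.[y]) P^`().[x^-1] by exact: is_derive_poly.
    exact: (@is_derive1_comp _ (fun y => P.[y]) (fun y : R => y^-1) _ _ _ dp dV).
  have dE : is_derive x (1 : R) (fun y : R => expR (- y^-1)) (expR (- x^-1) * - - x ^- 2).
    have dN : is_derive x (1 : R) (fun y : R => - y^-1) (- - x ^- 2) by exact: is_deriveN.
    exact: (@is_derive1_comp _ expR (fun y : R => - y^-1) _ _ _ (is_derive_expR _) dN).
  apply: is_derive_eq; rewrite hornerD hornerN /GRing.scale /= exprVn; ring.
- have [C C0 hC] := flat_quad P.
  have f0 : flat P 0 = 0 by rewrite /flat ltxx.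
  have df0 : flat (dflat P) 0 = 0 by rewrite /flat ltxx.
  rewrite x0 df0.
  have L : (fun h : R => h^-1 *: ((flat P \o shift (0 : R)) (h *: (1 : R)) - flat P 0)) @ 0^' --> (0 : R).
    have C1 : 0 < C + 1 by rewrite ltr_wpDl.
    apply/cvgr0Pnorm_le => e e0; near=> h.
    have h0 : h != 0 by near: h; exact: nbhs_dnbhs_neq.
    rewrite /= addr0 f0 subr0 /GRing.scale /= mulr1 normrM normfV.
    rewrite mulrC ler_pdivrMr ?normr_gt0// (le_trans (hC h))//.
    rewrite -[h ^+ 2]ger0_norm ?sqr_ge0// normrX expr2 mulrA ler_wpM2r//.
    rewrite (le_trans (_ : _ <= (C + 1) * `|h|))//.
      by rewrite ler_wpM2r// lerDl.
    rewrite mulrC -ler_pdivlMr// ltW//; near: h.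
    by apply: dnbhs0_lt; rewrite divr_gt0.
  apply: DeriveDef; first by apply/cvg_ex; exists 0.
  exact: cvg_lim.
Unshelve. all: by end_near.
Qed.

End flat_functions.

(** Exhibiting the whole sequence of derivatives avoids iterating a derivation that is total. *)
Definition smooth1 (R : realType) (G : R -> R) : Prop :=
  exists2 s : nat -> R -> R, s 0%N = G &
    forall m (x : R), is_derive x (1 : R) (s m) (s m.+1 x).

Section smooth_functions.
Variables (R : realType) (n : nat).
Local Notation Cn := (Cn R n).
Local Notation evec := (@evec R n).

Lemma is_derive_line (f : Cn -> R) (G : R -> R) (k : 'I_n * 'I_2) (z : Cn) (x d : R) :
  (forall h : R, f (h *: evec k + z) = G (h + x)) -> is_derive x (1 : R) G d ->
  is_derive z (evec k) f d.
Proof.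
move=> fG [dG Gd].
have E : (fun h : R => h^-1 *: ((f \o shift z) (h *: evec k) - f z)) =
   (fun h : R => h^-1 *: ((G \o shift x) (h *: (1 : R)) - G x)).
  apply/funext => h /=; rewrite fG; have := fG 0; rewrite scale0r !add0r => ->.
  by rewrite /GRing.scale /= mulr1.
apply: DeriveDef; first by rewrite /derivable E.
by rewrite -Gd /derive E.
Qed.

Lemma is_derive_coord (G : R -> R) (k p : 'I_n * 'I_2) (z : Cn) (d : R) :
  is_derive (z p.1 p.2) (1 : R) G d ->
  is_derive z (evec k) (fun z => G (z p.1 p.2)) (if p == k then d else 0).
Proof.
move=> dG; have E h : (h *: evec k + z) p.1 p.2 = h * (p == k)%:R + z p.1 p.2.
  by rewrite !mxE -pair_eqE.
have [pk|pk] := boolP (p == k).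
  by apply: is_derive_line dG => h; rewrite E pk mulr1.
apply: (@is_derive_line _ (cst (G (z p.1 p.2))) _ _ 0 0) => h.
by rewrite E (negbTE pk) mulr0 add0r.
Qed.

(** An algebra of functions closed under partial derivatives by construction, so that its
    members are smooth by induction. *)
Inductive smooth_alg : (Cn -> R) -> Prop :=
| smooth_alg_cst c : smooth_alg (fun=> c)
| smooth_alg_coord G p : smooth1 G -> smooth_alg (fun z => G (z p.1 p.2))
| smooth_alg_add f g : smooth_alg f -> smooth_alg g -> smooth_alg (fun z => f z + g z)
| smooth_alg_mul f g : smooth_alg f -> smooth_alg g -> smooth_alg (fun z => f z * g z).

Lemma smooth_alg_derive f k : smooth_alg f -> exists2 g, smooth_alg g & forall z, is_derive z (evec k) f (g z).
Proof.
elim=> [c|G p [s <- ds]|{}f g sf [f' sf' df'] sg [g' sg' dg']|{}f g sf [f' sf' df'] sg [g' sg' dg']].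
- by exists (fun=> 0); [exact: smooth_alg_cst|move=> z; exact: is_derive_cst].
- exists (fun z => if p == k then s 1%N (z p.1 p.2) else 0).
    case: (p == k); last exact: smooth_alg_cst.
    by apply: smooth_alg_coord; exists (fun m => s m.+1).
  by move=> z; apply: is_derive_coord; exact: ds.
- exists (fun z => f' z + g' z); first exact: smooth_alg_add.
  by move=> z; apply: is_deriveD.
- exists (fun z => f' z * g z + f z * g' z).
    by apply: smooth_alg_add; apply: smooth_alg_mul.
  move=> z; have df := df' z; have dg := dg' z.
  apply: is_derive_eq; rewrite /GRing.scale /=; ring.
Qed.

Lemma smooth_alg_continuous f : smooth_alg f -> continuous f.
Proof.
elim=> [c|G p [s <- ds]|{}f g sf cf sg cg|{}f g sf cf sg cg] z.
- exact: cst_continuous.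
- apply: continuous_comp; first exact: coord_continuous.
  by apply/differentiable_continuous/derivable1_diffP; have [] := ds 0%N (z p.1 p.2).
- exact: cvgD (cf z) (cg z).
- exact: cvgM (cf z) (cg z).
Qed.

Lemma smooth_alg_smooth f : smooth_alg f -> smooth f.
Proof.
move=> sf l; have {sf} : smooth_alg (iter_partial l f).
  elim: l => //= k l ih; have [g sg dg] := smooth_alg_derive k ih.
  rewrite (_ : (fun z => _) = g)//; apply/funext => z.
  by have [_ ->] := dg z.
move=> sf; split; first exact: smooth_alg_continuous.
by move=> k z; have [g _ /(_ z)[]] := smooth_alg_derive k sf.
Qed.

Lemma smooth1_id : smooth1 (@id R).
Proof.
exists (fun m => if m == 0%N then id else if m == 1%N then cst 1 else cst 0) => //.
by move=> [|[|m]] x /=; [exact: is_derive_id|exact: is_derive_cst|exact: is_derive_cst].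
Qed.

Lemma smooth1_flat P (c d : R) : smooth1 (fun x => flat P (c * x + d)).
Proof.
exists (fun m x => c ^+ m * flat (iter m (@dflat R) P) (c * x + d)).
  by apply/funext => x /=; rewrite mul1r.
move=> m x; rewrite iterS.
have da : is_derive x (1 : R) (fun x : R => c * x + d) c.
  by apply: is_derive_eq; rewrite /GRing.scale /= mulr1 addr0.
have dc := @is_derive1_comp _ (flat (iter m (@dflat R) P)) (fun x : R => c * x + d) _ _ _ (is_derive_flat _ (c * x + d)) da.
apply: is_derive_eq; rewrite /GRing.scale /= exprS; ring.
Qed.

Lemma smooth_alg_prod (S : seq ('I_n * 'I_2)) (F : 'I_n * 'I_2 -> Cn -> R) :
  (forall p, smooth_alg (F p)) -> smooth_alg (fun z => \prod_(p <- S) F p z).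
Proof.
move=> sF; elim: S => [|p S ih].
  by under eq_fun do rewrite big_nil; exact: smooth_alg_cst.
by under eq_fun do rewrite big_cons; exact: smooth_alg_mul.
Qed.

(** The constant makes the value at 0 equal to 1, hence the dilated cut-offs converge to 1. *)
Definition bump1 (x : R) : R := expR 1 ^+ 2 * (flat 1 (1 - x) * flat 1 (1 + x)).
Definition dbump1 (x : R) : R := expR 1 ^+ 2 *
  (flat 1 (1 - x) * flat (dflat 1) (1 + x) - flat (dflat 1) (1 - x) * flat 1 (1 + x)).

Lemma bump10 : bump1 0 = 1.
Proof.
rewrite /bump1 subr0 addr0 /flat ltr01 hornerC invr1 mul1r -expr2 -exprMn.
by rewrite -expRD subrr expR0 expr1n.
Qed.

Lemma bump1_supp x : bump1 x != 0 -> `|x| <= 1.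
Proof.
rewrite leNgt; apply: contra => x1; rewrite /bump1 /flat.
have [x0|x0] := leP 0 x.
  by rewrite (ger0_norm x0) in x1; rewrite subr_gt0 ltNge ltW//= mul0r mulr0.
rewrite (ltr0_norm x0) in x1; rewrite (_ : 0 < 1 + x = false) ?mulr0//.
by apply/negbTE; rewrite -leNgt; lra.
Qed.

Lemma is_derive_bump1 (x : R) : is_derive x (1 : R) bump1 (dbump1 x).
Proof.
have d1 : is_derive x (1 : R) (fun x : R => 1 - x) (-1).
  by have := is_deriveB (is_derive_cst (1 : R) x (1 : R)) (is_derive_id x (1 : R)); rewrite sub0r.
have d2 : is_derive x (1 : R) (fun x : R => 1 + x) 1.
  by have := is_deriveD (is_derive_cst (1 : R) x (1 : R)) (is_derive_id x (1 : R)); rewrite add0r.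
have D1 := @is_derive1_comp _ (flat 1) (fun x : R => 1 - x) _ _ _ (is_derive_flat 1 (1 - x)) d1.
have D2 := @is_derive1_comp _ (flat 1) (fun x : R => 1 + x) _ _ _ (is_derive_flat 1 (1 + x)) d2.
apply: is_derive_eq; rewrite /GRing.scale /= /dbump1; ring.
Qed.

Lemma bump1_bound : exists2 C, 0 <= C & forall x, `|bump1 x| <= C /\ `|dbump1 x| <= C.
Proof.
have [C C0 hC] := flat_bound (1 : {poly R}); have [D D0 hD] := flat_bound (dflat (1 : {poly R})).
rewrite /bump1 /dbump1; have : 0 <= expR 1 ^+ 2 :> R by rewrite sqr_ge0.
move: (expR 1 ^+ 2) => e e0.
exists (e * (C * C + (C * D + D * C))).
  by rewrite !(mulr_ge0, addr_ge0).
move=> x; rewrite !normrM (ger0_norm e0).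
split; rewrite ler_wpM2l//.
  by rewrite ler_wpDr ?addr_ge0 ?mulr_ge0// ler_pM.
rewrite ler_wpDl ?mulr_ge0// (le_trans (ler_normB _ _))// !normrM.
by rewrite lerD// ler_pM.
Qed.

Lemma continuous_bump1 : continuous bump1.
Proof.
by move=> x; apply/differentiable_continuous/derivable1_diffP; have [] := is_derive_bump1 x.
Qed.

Definition cutoff (N : nat) (z : Cn) : R :=
  \prod_(p : 'I_n * 'I_2) bump1 (z p.1 p.2 / N.+1%:R).

Lemma smooth_alg_cutoff N : smooth_alg (cutoff N).
Proof.
apply: smooth_alg_prod => p; apply: smooth_alg_mul; first exact: smooth_alg_cst.
apply: smooth_alg_mul.
  have := smooth_alg_coord p (smooth1_flat 1 (- N.+1%:R^-1) 1).
  by under eq_fun do rewrite mulNr addrC mulrC.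
have := smooth_alg_coord p (smooth1_flat 1 (N.+1%:R^-1) 1).
by under eq_fun do rewrite addrC mulrC.
Qed.

Lemma cutoff_supp N z : cutoff N z != 0 -> forall j l, `|z j l| <= N.+1%:R.
Proof.
move=> /prodf_neq0 h j l; have := bump1_supp (h (j, l) isT).
by rewrite /= normrM normfV (ger0_norm (ler0n _ _)) ler_pdivrMr// mul1r.
Qed.

Lemma cvg_cutoff z : cutoff N z @[N --> \oo] --> (1 : R).
Proof.
rewrite /cutoff; elim: (index_enum _) => [|p S ih].
  by under eq_fun do rewrite big_nil; exact: cvg_cst.
under eq_fun do rewrite big_cons.
have h0 : (fun N : nat => z p.1 p.2 / N.+1%:R) @ \oo --> (0 : R).
  rewrite -(mulr0 (z p.1 p.2)); apply: cvgM; first exact: cvg_cst.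
  exact: cvg_harmonic.
have hb : (fun N : nat => bump1 (z p.1 p.2 / N.+1%:R)) @ \oo --> bump1 0.
  exact: (cvg_comp _ _ h0 (@continuous_bump1 0)).
have := cvgM hb ih; rewrite bump10 mulr1; exact.
Qed.

(** Dilating by N + 1 divides the first derivatives by N + 1. *)
Lemma cutoff_bound : exists2 C, 0 <= C & forall N z, `|cutoff N z| <= C /\
  forall k, exists2 d, is_derive z (evec k) (cutoff N) d & `|d| <= C / N.+1%:R.
Proof.
have [B B0 hB] := bump1_bound.
have B1 : 1 <= B by have := (hB 0).1; rewrite bump10 normr1.
exists (B ^+ #|{: 'I_n * 'I_2}|); first exact: exprn_ge0.
move=> N z; split.
  rewrite /cutoff normr_prod -prodr_const; apply: ler_prod => p _.
  by rewrite normr_ge0/= (hB _).1.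
move=> k; exists (dbump1 (z k.1 k.2 / N.+1%:R) / N.+1%:R *
   \prod_(p | p != k) bump1 (z p.1 p.2 / N.+1%:R)).
  apply: (@is_derive_line _ (fun x => bump1 (x / N.+1%:R) *
    \prod_(p | p != k) bump1 (z p.1 p.2 / N.+1%:R)) _ _ (z k.1 k.2)).
    move=> h; rewrite /cutoff (bigD1 k)//= !mxE !eqxx mulr1; congr (_ * _).
    apply: eq_bigr => p pk; rewrite !mxE.
    by move: pk; rewrite -pair_eqE /pair_eq /= => /negbTE ->; rewrite mulr0 add0r.
  have da : is_derive (z k.1 k.2) (1 : R) (fun x : R => x / N.+1%:R) N.+1%:R^-1.
    by apply: is_derive_eq; rewrite /GRing.scale /=; ring.
  have db := @is_derive1_comp _ bump1 (fun x : R => x / N.+1%:R) _ _ _ (is_derive_bump1 (z k.1 k.2 / N.+1%:R)) da.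
  apply: is_derive_eq; rewrite /GRing.scale /=; ring.
rewrite normrM normrM normfV (ger0_norm (ler0n _ _)) mulrAC ler_pM2r ?invr_gt0//.
rewrite -[leRHS]prodr_const [leRHS](bigD1 k)//= ler_pM//; first exact: (hB _).2.
rewrite normr_prod; apply: ler_prod => p _.
by rewrite normr_ge0/= (hB _).1.
Qed.

End smooth_functions.

(** * Wirtinger calculus and polynomials *)

Section ring_identities.
Variable T : comPzRingType.
Implicit Types h i a b c d : T.
(** Algebraic identities behind the product rules and the integrations by parts below. *)
Lemma rid_addD h i a b c d :
  h * ((a + b) + i * (c + d)) = h * (a + i * c) + h * (b + i * d).
Proof. ring. Qed.
Lemma rid_addM h i a b c d f g :
  h * ((a * g + f * b) + i * (c * g + f * d)) =
  h * (a + i * c) * g + f * (h * (b + i * d)).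
Proof. ring. Qed.
Lemma rid_subD h i a b c d :
  h * ((a + b) - i * (c + d)) = h * (a - i * c) + h * (b - i * d).
Proof. ring. Qed.
Lemma rid_subM h i a b c d f g :
  h * ((a * g + f * b) - i * (c * g + f * d)) =
  h * (a - i * c) * g + f * (h * (b - i * d)).
Proof. ring. Qed.
Lemma rid_oscil (F : fieldType) (d c x s1 s2 : F) : d + c != 0 ->
  (d + c)^-1 * (d * x - s2 + (s2 - c * s1)) + c * ((d + c)^-1 * (x + s1)) = x.
Proof. by move=> dc; field. Qed.
Lemma rid_ibp (h i x y p q u : T) :
  h * (p + i * q) - h * (x + i * y) * u = h * ((p - x * u) + i * (q - y * u)).
Proof. ring. Qed.
Lemma rid_delta (c dc p pz u : T) :
  dc * p + c * pz - u * (c * p) = c * (pz - u * p) + dc * p.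
Proof. ring. Qed.
End ring_identities.

Section complex_calculus.
Variables (R : realType) (n : nat).
Local Notation Cn := (Cn R n).
Local Notation C := R[i].
Local Notation evec := (@evec R n).
Implicit Types f g : Cn -> C.

Lemma cReD (x y : C) : complex.Re (x + y) = complex.Re x + complex.Re y.
Proof. by case: x y => [? ?] [? ?]. Qed.
Lemma cImD (x y : C) : complex.Im (x + y) = complex.Im x + complex.Im y.
Proof. by case: x y => [? ?] [? ?]. Qed.
Lemma cReM (x y : C) : complex.Re (x * y) =
  complex.Re x * complex.Re y - complex.Im x * complex.Im y.
Proof. by case: x y => [? ?] [? ?]. Qed.
Lemma cImM (x y : C) : complex.Im (x * y) =
  complex.Re x * complex.Im y + complex.Im x * complex.Re y.
Proof. by case: x y => [? ?] [? ?]. Qed.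

Lemma cReJ (x : C) : complex.Re x^*%C = complex.Re x.
Proof. by case: x. Qed.
Lemma cImJ (x : C) : complex.Im x^*%C = - complex.Im x.
Proof. by case: x. Qed.

Lemma complex_ext (x y : C) :
  complex.Re x = complex.Re y -> complex.Im x = complex.Im y -> x = y.
Proof. by case: x y => [? ?] [? ?] /= -> ->. Qed.

Lemma cJM (x y : C) : (x * y)^*%C = x^*%C * y^*%C.
Proof. by apply: complex_ext; rewrite ?cImJ ?cReJ ?cReM ?cImM ?cReJ ?cImJ; ring. Qed.
Lemma cJD (x y : C) : (x + y)^*%C = x^*%C + y^*%C.
Proof. by apply: complex_ext; rewrite ?cImJ ?cReJ ?cReD ?cImD ?cReJ ?cImJ ?opprD. Qed.
Lemma cJN (x : C) : (- x)^*%C = - x^*%C.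
Proof. by case: x. Qed.
Lemma cJJ (x : C) : (x^*)^*%C = x.
Proof. by case: x => x y /=; rewrite opprK. Qed.
Lemma cJR (r : R) : (r%:C)^*%C = r%:C :> C.
Proof. by rewrite /= oppr0. Qed.
Lemma invCR (r : R) : (r%:C)^-1 = (r^-1)%:C :> C.
Proof. by rewrite fmorphV. Qed.
Lemma halfC : 2^-1 = (2^-1)%:C :> C.
Proof. by rewrite -invCR rmorph_nat. Qed.

(** The operator partial is total; this relation also asserts that the derivative exists. *)
Definition is_partial (k : 'I_n * 'I_2) f g := forall z,
  is_derive z (evec k) (fun w => complex.Re (f w)) (complex.Re (g z)) /\
  is_derive z (evec k) (fun w => complex.Im (f w)) (complex.Im (g z)).

Definition cdiff f := forall k, is_partial k f (partial k f).

Lemma partial_val k f g : is_partial k f g -> partial k f = g.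
Proof.
move=> h; apply/funext => z; have [[_ h1] [_ h2]] := h z.
by rewrite /partial h1 h2; case: (g z).
Qed.

Lemma is_partial_cdiff f : (forall k, exists g, is_partial k f g) -> cdiff f.
Proof. by move=> h k; have [g fg] := h k; rewrite (partial_val fg). Qed.

Lemma is_partial_cst k (c : C) : is_partial k (fun=> c) (fun=> 0).
Proof. by move=> z; split; exact: is_derive_cst. Qed.

Lemma is_partialD k f g f' g' : is_partial k f f' -> is_partial k g g' ->
  is_partial k (fun z => f z + g z) (fun z => f' z + g' z).
Proof.
move=> hf hg z; have [f1 f2] := hf z; have [g1 g2] := hg z.
split.
  under eq_fun do rewrite cReD; rewrite cReD; exact: is_deriveD.
under eq_fun do rewrite cImD; rewrite cImD; exact: is_deriveD.
Qed.

Lemma is_partialM k f g f' g' : is_partial k f f' -> is_partial k g g' ->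
  is_partial k (fun z => f z * g z) (fun z => f' z * g z + f z * g' z).
Proof.
move=> hf hg z; have [f1 f2] := hf z; have [g1 g2] := hg z.
split.
  under eq_fun do rewrite cReM; apply: is_derive_eq.
  rewrite cReD !cReM /GRing.scale /=; ring.
under eq_fun do rewrite cImM; apply: is_derive_eq.
rewrite cImD !cImM /GRing.scale /=; ring.
Qed.

Lemma is_partial_conj k f f' : is_partial k f f' ->
  is_partial k (fun z => (f z)^*%C) (fun z => (f' z)^*%C).
Proof.
move=> hf z; have [f1 f2] := hf z; split.
  by under eq_fun => w do rewrite cReJ; rewrite cReJ.
under eq_fun => w do rewrite cImJ; rewrite cImJ; exact: is_deriveN.
Qed.

Lemma is_partial_zcoord k (j : 'I_n) :
  is_partial k (fun z => zcoord z j)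
    (fun=> if k == (j, 0) then 1 else if k == (j, 1) then 'i%C else 0).
Proof.
move=> z; have d0 l : is_derive z (evec k) (fun w : Cn => w j l) (if (j, l) == k then 1 else 0).
  exact: (@is_derive_coord R n id k (j, l) z 1 (is_derive_id _ _)).
split; [have := d0 0|have := d0 1]; rewrite eq_sym /=.
  by case: ifP => // _; case: ifP.
case: (eqVneq k (j, 1)) => [-> |_]; first by rewrite xpair_eqE /= andbF.
by case: ifP.
Qed.

Definition dbar (j : 'I_n) f : Cn -> C := fun z =>
  2^-1 * (partial (j, 0) f z + 'i%C * partial (j, 1) f z).

Section leibniz.
Variables (j : 'I_n) (f g : Cn -> C).
Hypotheses (df : cdiff f) (dg : cdiff g).

Lemma partialD k : partial k (fun z => f z + g z) = fun z => partial k f z + partial k g z.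
Proof. exact: partial_val (is_partialD (df k) (dg k)). Qed.
Lemma partialM k : partial k (fun z => f z * g z) =
  fun z => partial k f z * g z + f z * partial k g z.
Proof. exact: partial_val (is_partialM (df k) (dg k)). Qed.
Lemma cdiffD : cdiff (fun z => f z + g z).
Proof. by apply: is_partial_cdiff => k; eexists; exact: is_partialD (df k) (dg k). Qed.
Lemma cdiffM : cdiff (fun z => f z * g z).
Proof. by apply: is_partial_cdiff => k; eexists; exact: is_partialM (df k) (dg k). Qed.

Lemma dbarD : dbar j (fun z => f z + g z) = fun z => dbar j f z + dbar j g z.
Proof. by rewrite /dbar !partialD; apply/funext => z; exact: rid_addD. Qed.
Lemma dbarM : dbar j (fun z => f z * g z) = fun z => dbar j f z * g z + f z * dbar j g z.
Proof. by rewrite /dbar !partialM; apply/funext => z; exact: rid_addM. Qed.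
Lemma partial_zD : partial_z j (fun z => f z + g z) = fun z => partial_z j f z + partial_z j g z.
Proof. by rewrite /partial_z !partialD; apply/funext => z; exact: rid_subD. Qed.
Lemma partial_zM : partial_z j (fun z => f z * g z) =
  fun z => partial_z j f z * g z + f z * partial_z j g z.
Proof. by rewrite /partial_z !partialM; apply/funext => z; exact: rid_subM. Qed.
End leibniz.

Lemma cdiff_cst (c : C) : cdiff (fun=> c).
Proof. by apply: is_partial_cdiff => k; eexists; exact: is_partial_cst. Qed.
Lemma partial_cst k c : partial k (fun _ : Cn => c) = (fun=> 0).
Proof. exact: partial_val (is_partial_cst _ _). Qed.
Lemma dbar_cst j c : dbar j (fun _ : Cn => c) = (fun=> 0).
Proof. by rewrite /dbar !partial_cst; apply/funext => z; rewrite mulr0 addr0 mulr0. Qed.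
Lemma partial_z_cst j c : partial_z j (fun _ : Cn => c) = (fun=> 0).
Proof. by rewrite /partial_z !partial_cst; apply/funext => z; rewrite mulr0 subr0 mulr0. Qed.

Lemma cdiffZ (c : C) f : cdiff f -> cdiff (fun z => c * f z).
Proof. by move=> df; apply: cdiffM => //; exact: cdiff_cst. Qed.
Lemma dbarZ j (c : C) f : cdiff f -> dbar j (fun z => c * f z) = fun z => c * dbar j f z.
Proof.
move=> df; rewrite (dbarM j (cdiff_cst c) df).
by rewrite dbar_cst; apply/funext => z; rewrite mul0r add0r.
Qed.
Lemma partial_zZ j (c : C) f : cdiff f -> partial_z j (fun z => c * f z) = fun z => c * partial_z j f z.
Proof.
move=> df; rewrite (partial_zM j (cdiff_cst c) df).
by rewrite partial_z_cst; apply/funext => z; rewrite mul0r add0r.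
Qed.

Definition zconj (z : Cn) (j : 'I_n) : C := (zcoord z j)^*%C.

Lemma cdiff_zcoord j : cdiff (fun z => zcoord z j).
Proof. by apply: is_partial_cdiff => k; eexists; exact: is_partial_zcoord. Qed.
Lemma cdiff_zconj j : cdiff (fun z => zconj z j).
Proof. by apply: is_partial_cdiff => k; eexists; apply: is_partial_conj; exact: is_partial_zcoord. Qed.

Lemma Cii : 'i%C * 'i%C = -1 :> C.
Proof. by rewrite -expr2 sqr_i. Qed.

Lemma conj_i : ('i%C)^*%C = - 'i%C :> C.
Proof. by apply: complex_ext => /=; rewrite ?oppr0. Qed.

Lemma two_neq0 : 2 != 0 :> C.
Proof. by rewrite pnatr_eq0. Qed.

Lemma dbar_zcoord j i : dbar j (fun z : Cn => zcoord z i) = (fun=> 0).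
Proof.
rewrite /dbar !(partial_val (is_partial_zcoord _ _)); apply/funext => z.
rewrite !xpair_eqE /= !andbT !andbF; case: (j == i); last by rewrite mulr0 addr0 mulr0.
by rewrite Cii addrN mulr0.
Qed.
Lemma partial_z_zcoord j i : partial_z j (fun z : Cn => zcoord z i) = (fun=> (i == j)%:R).
Proof.
rewrite /partial_z !(partial_val (is_partial_zcoord _ _)); apply/funext => z.
rewrite !xpair_eqE /= !andbT !andbF eq_sym; case: (i == j); last by rewrite mulr0 subr0 mulr0.
by rewrite Cii opprK mulVf// two_neq0.
Qed.
Lemma dbar_zconj j i : dbar j (fun z : Cn => zconj z i) = (fun=> (i == j)%:R).
Proof.
rewrite /dbar !(partial_val (is_partial_conj (is_partial_zcoord _ _))); apply/funext => z.
rewrite !xpair_eqE /= !andbT !andbF eq_sym; case: (i == j); last by rewrite !conjc0 mulr0 addr0 mulr0.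
by rewrite conjc1 conj_i mulrN Cii opprK mulVf// two_neq0.
Qed.
Lemma partial_z_zconj j i : partial_z j (fun z : Cn => zconj z i) = (fun=> 0).
Proof.
rewrite /partial_z !(partial_val (is_partial_conj (is_partial_zcoord _ _))); apply/funext => z.
rewrite !xpair_eqE /= !andbT !andbF eq_sym; case: (i == j); last by rewrite !conjc0 mulr0 subr0 mulr0.
by rewrite conjc1 conj_i mulrN Cii opprK addrN mulr0.
Qed.

(** Polynomials in the z_i, generated so that derivatives are computed by induction. *)
Inductive hol : (Cn -> C) -> Prop :=
| hol_cst c : hol (fun=> c)
| hol_zcoord i h : hol h -> hol (fun z => zcoord z i * h z)
| hol_add h h' : hol h -> hol h' -> hol (fun z => h z + h' z).

(** Polynomials in the conj z_i, homogeneous of degree d. The degree is recorded because it is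
    the leading eigenvalue of the oscillator, see oscil_mono. *)
Inductive ahol : nat -> (Cn -> C) -> Prop :=
| ahol_cst c : ahol 0 (fun=> c)
| ahol_zero d : ahol d (fun=> 0)
| ahol_zconj d i g : ahol d g -> ahol d.+1 (fun z => zconj z i * g z)
| ahol_add d g g' : ahol d g -> ahol d g' -> ahol d (fun z => g z + g' z).

(** All polynomials in the z_i and conj z_i, equivalently in the real coordinates. *)
Inductive pol : (Cn -> C) -> Prop :=
| pol_mono d h g : hol h -> ahol d g -> pol (fun z => h z * g z)
| pol_add p q : pol p -> pol q -> pol (fun z => p z + q z).

Lemma hol_calc h : hol h ->
  [/\ cdiff h, forall j, dbar j h = (fun=> 0) & forall j, hol (partial_z j h)].
Proof.
elim=> [c|i {}h hh [dh bh zh]|{}h h' hh [dh bh zh] hh' [dh' bh' zh']].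
- split; first exact: cdiff_cst.
    by move=> j; rewrite dbar_cst.
  by move=> j; rewrite partial_z_cst; exact: hol_cst.
- have dz := cdiff_zcoord i; split; first exact: cdiffM.
    move=> j; rewrite (dbarM j dz dh) dbar_zcoord bh; apply/funext => z.
    by rewrite mul0r mulr0 addr0.
  move=> j; rewrite (partial_zM j dz dh) partial_z_zcoord.
  apply: hol_add; last exact: hol_zcoord.
  case: (i == j); first by under eq_fun do rewrite mul1r.
  by under eq_fun do rewrite mul0r; exact: hol_cst.
- split; first exact: cdiffD.
    by move=> j; rewrite (dbarD j dh dh') bh bh'; apply/funext => z; rewrite addr0.
  by move=> j; rewrite (partial_zD j dh dh'); exact: hol_add.
Qed.

Lemma holM h h' : hol h -> hol h' -> hol (fun z => h z * h' z).
Proof.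
move=> hh hh'; elim: hh => [c|i {}h hh ih|{}h h1 hh ih hh1 ih1].
- elim: hh' => [c'|i {}h' hh' ih'|{}h' h1 hh' ih' hh1 ih1].
  + exact: hol_cst.
  + by under eq_fun do rewrite mulrCA; exact: hol_zcoord.
  + by under eq_fun do rewrite mulrDr; exact: hol_add.
- by under eq_fun do rewrite -mulrA; exact: hol_zcoord.
- by under eq_fun do rewrite mulrDl; exact: hol_add.
Qed.

Lemma aholZ d g c : ahol d g -> ahol d (fun z => c * g z).
Proof.
elim=> [c'|d'|{}d i {}g ag ih|{}d {}g g' ag ih ag' ih'].
- exact: ahol_cst.
- by under eq_fun do rewrite mulr0; exact: ahol_zero.
- by under eq_fun do rewrite mulrCA; exact: ahol_zconj.
- by under eq_fun do rewrite mulrDr; exact: ahol_add.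
Qed.

Lemma ahol_cdiff d g : ahol d g -> cdiff g.
Proof.
elim=> [c'|d'|{}d i {}g ag ih|{}d {}g g' ag ih ag' ih'].
- exact: cdiff_cst.
- exact: cdiff_cst.
- by apply: cdiffM => //; exact: cdiff_zconj.
- exact: cdiffD.
Qed.

Lemma ahol_partial_z d g j : ahol d g -> partial_z j g = (fun=> 0).
Proof.
elim=> [c'|d'|{}d i {}g ag ih|{}d {}g g' ag ih ag' ih'].
- exact: partial_z_cst.
- exact: partial_z_cst.
- rewrite (partial_zM j (cdiff_zconj i) (ahol_cdiff ag)) partial_z_zconj ih.
  by apply/funext => z; rewrite mul0r mulr0 addr0.
- rewrite (partial_zD j (ahol_cdiff ag) (ahol_cdiff ag')) ih ih'.
  by apply/funext => z; rewrite addr0.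
Qed.

Lemma ahol_dbar d g j : ahol d g ->
  if d is d'.+1 then ahol d' (dbar j g) else dbar j g = (fun=> 0).
Proof.
elim=> [c'|[|d']|{}d i {}g ag ih|{}d {}g g' ag ih ag' ih'].
- exact: dbar_cst.
- exact: dbar_cst.
- by rewrite dbar_cst; exact: ahol_zero.
- rewrite (dbarM j (cdiff_zconj i) (ahol_cdiff ag)) dbar_zconj.
  apply: ahol_add; first exact: aholZ.
  case: d ag ih => [|d] ag ih; last exact: ahol_zconj.
  by rewrite ih; under eq_fun do rewrite mulr0; exact: ahol_zero.
- rewrite (dbarD j (ahol_cdiff ag) (ahol_cdiff ag')).
  case: d ag ag' ih ih' => [|d] ag ag' ih ih'; last exact: ahol_add.
  by rewrite ih ih'; apply/funext => z; rewrite addr0.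
Qed.

(** Euler identity for homogeneous polynomials. *)
Lemma ahol_euler d g : ahol d g ->
  forall z, \sum_i zconj z i * dbar i g z = d%:R * g z.
Proof.
elim=> [c'|d'|{}d i {}g ag ih|{}d {}g g' ag ih ag' ih'] z.
- by rewrite mul0r big1// => i _; rewrite dbar_cst mulr0.
- by rewrite mulr0 big1// => i _; rewrite dbar_cst mulr0.
- under eq_bigr => j _.
    rewrite (dbarM j (cdiff_zconj i) (ahol_cdiff ag)) dbar_zconj mulrDr mulrCA.
    rewrite [X in _ + X]mulrCA; over.
  rewrite big_split /= -mulr_sumr ih (bigD1 i)//= eqxx mul1r.
  rewrite big1 ?addr0; last by move=> j ji; rewrite eq_sym (negbTE ji) mul0r.
  by rewrite -natr1 mulrDl mul1r addrC mulrCA.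
- under eq_bigr => j _ do rewrite (dbarD j (ahol_cdiff ag) (ahol_cdiff ag')) mulrDr.
  by rewrite big_split /= ih ih' mulrDr.
Qed.

Lemma aholM d d' g g' : ahol d g -> ahol d' g' -> ahol (d + d') (fun z => g z * g' z).
Proof.
move=> ag ag'; elim: ag => [c|e|{}d i {}g ag ih|{}d {}g g1 ag ih ag1 ih1].
- exact: aholZ.
- by under eq_fun do rewrite mul0r; exact: ahol_zero.
- by under eq_fun do rewrite -mulrA; exact: ahol_zconj.
- by under eq_fun do rewrite mulrDl; exact: ahol_add.
Qed.

Lemma mono_dbar d h g j : hol h -> ahol d g ->
  dbar j (fun z => h z * g z) = fun z => h z * dbar j g z.
Proof.
move=> hh ag; have [dh bh _] := hol_calc hh.
rewrite (dbarM j dh (ahol_cdiff ag)) bh; apply/funext => z.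
by rewrite mul0r add0r.
Qed.

Lemma mono_partial_z d h g j : hol h -> ahol d g ->
  partial_z j (fun z => h z * g z) = fun z => partial_z j h z * g z.
Proof.
move=> hh ag; have [dh bh _] := hol_calc hh.
rewrite (partial_zM j dh (ahol_cdiff ag)) (ahol_partial_z j ag); apply/funext => z.
by rewrite mulr0 addr0.
Qed.

Lemma pol_cdiff p : pol p -> cdiff p.
Proof.
elim=> [d h g hh ag|{}p q _ dp _ dq]; last exact: cdiffD.
have [dh _ _] := hol_calc hh; exact: cdiffM dh (ahol_cdiff ag).
Qed.

Lemma pol_cst (c : C) : pol (fun=> c).
Proof.
have := pol_mono (hol_cst c) (ahol_cst 1).
by under eq_fun do rewrite mulr1.
Qed.

Lemma pol_dbar p j : pol p -> pol (dbar j p).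
Proof.
elim=> [d h g hh ag|{}p q pp re_inner pq iq].
  rewrite (mono_dbar j hh ag); case: d ag => [|d] ag.
    rewrite (ahol_dbar j ag); under eq_fun do rewrite mulr0; exact: pol_cst.
  exact: pol_mono hh (ahol_dbar j ag).
by rewrite (dbarD j (pol_cdiff pp) (pol_cdiff pq)); exact: pol_add.
Qed.

Lemma pol_partial_z p j : pol p -> pol (partial_z j p).
Proof.
elim=> [d h g hh ag|{}p q pp re_inner pq iq].
  rewrite (mono_partial_z j hh ag); have [_ _ zh] := hol_calc hh.
  exact: pol_mono (zh j) ag.
by rewrite (partial_zD j (pol_cdiff pp) (pol_cdiff pq)); exact: pol_add.
Qed.

Lemma dbar_partial_z p i j : pol p ->
  dbar i (partial_z j p) = partial_z j (dbar i p).
Proof.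
elim=> [d h g hh ag|{}p q pp re_inner pq iq].
  have [_ _ zh] := hol_calc hh.
  rewrite (mono_partial_z j hh ag) (mono_dbar i (zh j) ag) (mono_dbar i hh ag).
  case: d ag => [|d] ag; last by rewrite (mono_partial_z j hh (ahol_dbar i ag)).
  rewrite (ahol_dbar i ag); under [in RHS]eq_fun do rewrite mulr0.
  by rewrite partial_z_cst; apply/funext => z; rewrite mulr0.
have dp := pol_cdiff (pol_partial_z j pp); have dq := pol_cdiff (pol_partial_z j pq).
have ep := pol_cdiff (pol_dbar i pp); have eq := pol_cdiff (pol_dbar i pq).
rewrite (partial_zD j (pol_cdiff pp) (pol_cdiff pq)) (dbarD i dp dq).
by rewrite (dbarD i (pol_cdiff pp) (pol_cdiff pq)) (partial_zD j ep eq) re_inner iq.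
Qed.

Lemma polM p q : pol p -> pol q -> pol (fun z => p z * q z).
Proof.
elim=> [d h g hh ag|p1 p2 _ ih1 _ ih2] pq; last first.
  by under eq_fun do rewrite mulrDl; apply: pol_add; [exact: ih1|exact: ih2].
elim: pq => [d' h' g' hh' ag'|q1 q2 _ ih1 _ ih2].
  by under eq_fun do rewrite mulrACA; exact: pol_mono (holM hh hh') (aholM ag ag').
by under eq_fun do rewrite mulrDr; exact: pol_add.
Qed.

Lemma polZ c p : pol p -> pol (fun z => c * p z).
Proof. exact: polM (pol_cst c). Qed.

Lemma pol_sum (I : Type) (r : seq I) (P : pred I) (F : I -> Cn -> C) :
  (forall i, pol (F i)) -> pol (fun z => \sum_(i <- r | P i) F i z).
Proof.
move=> pF; elim: r => [|i r ih]; first by under eq_fun do rewrite big_nil; exact: pol_cst.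
under eq_fun do rewrite big_cons.
by case: (P i) => //; exact: pol_add.
Qed.

Lemma pol_zcoord j : pol (fun z => zcoord z j).
Proof.
have := pol_mono (hol_zcoord j (hol_cst 1)) (ahol_cst 1).
by under eq_fun do rewrite !mulr1.
Qed.

Lemma pol_zconj j : pol (fun z => zconj z j).
Proof.
have := pol_mono (hol_cst 1) (ahol_zconj j (ahol_cst 1)).
by under eq_fun do rewrite mulr1 mul1r.
Qed.

(** * Creation operators and the oscillator *)

Section oscillator.
Variable a : nat -> {posnum R}.

(** The adjoint of 2 a_i^2 dbar_i for the Gaussian measure, and a multiple of delta_i. *)
Definition creat (i : 'I_n) f : Cn -> C := fun z =>
  zconj z i * f z - (2 * (a i)%:num ^+ 2)%:C * partial_z i f z.

Lemma two_asq_neq0 i : (2 * (a i)%:num ^+ 2)%:C != 0 :> C.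
Proof.
rewrite (_ : 0 = 0%:C)// (inj_eq (@complexI _)) mulf_neq0// ?pnatr_eq0//.
Qed.

Lemma creat_delta i f z : creat i f z = - (2 * (a i)%:num ^+ 2)%:C * delta a i f z.
Proof.
rewrite /creat /delta; have := two_asq_neq0 i; set w := (_)%:C => w0.
by rewrite mulNr mulrBr opprB [_ / w * _]mulrAC [w * (_ / w)]mulrCA divff ?mulr1.
Qed.

Lemma pol_creat i p : pol p -> pol (creat i p).
Proof.
move=> pp; rewrite /creat; under eq_fun do rewrite -mulNr.
apply: pol_add; first exact: polM (pol_zconj i) pp.
exact: polZ (pol_partial_z i pp).
Qed.

(** The canonical commutation relations: the derivations commute, so only the multiplication by
    conj z_i contributes. *)
Lemma dbar_creat i j p : pol p -> dbar j (creat i p) =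
  fun z => creat i (dbar j p) z + (i == j)%:R * p z.
Proof.
move=> pp; have dp := pol_cdiff pp; have zp := pol_cdiff (pol_partial_z i pp).
rewrite /creat; under [in LHS]eq_fun do rewrite -mulNr.
rewrite (dbarD j (cdiffM (cdiff_zconj i) dp) (cdiffZ _ zp)).
rewrite (dbarM j (cdiff_zconj i) dp) (dbarZ j _ zp) dbar_zconj dbar_partial_z//.
by apply/funext => z; rewrite mulNr -addrA addrC.
Qed.

(** The number operator of n independent oscillators: each A_i D_i counts the quanta of one. *)
Definition oscil f : Cn -> C := fun z => \sum_i creat i (dbar i f) z.

Lemma pol_oscil p : pol p -> pol (oscil p).
Proof. by move=> pp; apply: pol_sum => i; exact: pol_creat (pol_dbar i pp). Qed.

Lemma creatD i f g : cdiff f -> cdiff g ->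
  creat i (fun z => f z + g z) = fun z => creat i f z + creat i g z.
Proof.
move=> df dg; rewrite /creat (partial_zD i df dg); apply/funext => z.
by rewrite !mulrDr opprD addrACA.
Qed.

Lemma creatZ i c f : cdiff f -> creat i (fun z => c * f z) = fun z => c * creat i f z.
Proof.
move=> df; rewrite /creat (partial_zZ i c df); apply/funext => z.
by rewrite mulrBr !(mulrCA c).
Qed.

Lemma oscilD p q : pol p -> pol q ->
  oscil (fun z => p z + q z) = fun z => oscil p z + oscil q z.
Proof.
move=> pp pq; apply/funext => z; rewrite /oscil -big_split; apply: eq_bigr => i _ /=.
rewrite (dbarD i (pol_cdiff pp) (pol_cdiff pq)) creatD//; apply: pol_cdiff; exact: pol_dbar.
Qed.

Lemma oscilZ c p : pol p -> oscil (fun z => c * p z) = fun z => c * oscil p z.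
Proof.
move=> pp; apply/funext => z; rewrite /oscil mulr_sumr; apply: eq_bigr => i _ /=.
rewrite (dbarZ i c (pol_cdiff pp)) creatZ//; apply: pol_cdiff; exact: pol_dbar.
Qed.

Lemma oscil_sum (q : 'I_n -> Cn -> C) (r : seq 'I_n) : (forall i, pol (q i)) ->
  oscil (fun z => \sum_(i <- r) q i z) = fun z => \sum_(i <- r) oscil (q i) z.
Proof.
move=> pq; elim: r => [|i r ih].
  under eq_fun do rewrite big_nil.
  apply/funext => z; rewrite big_nil /oscil big1// => i _.
  by rewrite dbar_cst /creat partial_z_cst !mulr0 subr0.
under eq_fun do rewrite big_cons.
rewrite (oscilD (pq i) (pol_sum r xpredT pq)) ih.
by apply/funext => z; rewrite big_cons.
Qed.

(** The multiplications by conj z_i combine with the dbar_i into the Euler operator, which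
    multiplies g by its degree; the other terms lower the degree of g. *)
Lemma oscil_mono d h g z : hol h -> ahol d g ->
  oscil (fun z => h z * g z) z = d%:R * (h z * g z) -
   \sum_(i < n) (2 * (a i)%:num ^+ 2)%:C * (partial_z i h z * dbar i g z).
Proof.
move=> hh ag; rewrite /oscil /creat sumrB; congr (_ - _).
  under eq_bigr => i _ do rewrite (mono_dbar i hh ag) mulrCA.
  by rewrite -mulr_sumr (ahol_euler ag) mulrCA.
apply: eq_bigr => i _; rewrite (mono_dbar i hh ag); congr (_ * _).
case: d ag => [|d] ag; last by rewrite (mono_partial_z i hh (ahol_dbar i ag)).
rewrite (ahol_dbar i ag) mulr0; under eq_fun do rewrite mulr0.
by rewrite partial_z_cst.
Qed.

(** By induction on d: up to terms of lower antiholomorphic degree, oscil + c + 1 is the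
    multiplication by d + c + 1, which is invertible. *)
Lemma oscil_mono_surj (c d : nat) h g : hol h -> ahol d g ->
  exists2 q, pol q & forall z, oscil q z + c.+1%:R * q z = h z * g z.
Proof.
elim/ltn_ind: d h g => d ih h g hh ag.
have [_ _ zh] := hol_calc hh.
have /(_ _)/cid2 H i : exists2 q, pol q &
    forall z, oscil q z + c.+1%:R * q z = partial_z i h z * dbar i g z.
  case: d ag ih => [|d] ag ih; last exact: ih (ltnSn d) _ _ (zh i) (ahol_dbar i ag).
  exists (fun=> 0); first exact: pol_cst.
  move=> z; rewrite (ahol_dbar i ag) !mulr0 addr0 /oscil big1// => j _.
  by rewrite dbar_cst /creat partial_z_cst !mulr0 subr0.
pose q i := s2val (H i).
have pq i : pol (q i) := s2valP (H i).
have Lq i z : oscil (q i) z + c.+1%:R * q i z = partial_z i h z * dbar i g z := s2valP' (H i) z.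
pose w (i : 'I_n) : C := (2 * (a i)%:num ^+ 2)%:C.
pose m : C := (d + c.+1)%:R.
have m0 : m != 0 by rewrite pnatr_eq0 addnS.
have phg := pol_mono hh ag.
have pwq i : pol (fun z => w i * q i z) by exact: polZ.
have ps := pol_sum (index_enum 'I_n) xpredT pwq.
(* The q i solve the same equation for the terms of degree d - 1 that oscil_mono leaves over. *)
exists (fun z => m^-1 * (h z * g z + \sum_i w i * q i z)).
  exact: polZ (pol_add phg ps).
move=> z; rewrite (oscilZ m^-1 (pol_add phg ps)) (oscilD phg ps) (oscil_sum _ pwq).
rewrite (oscil_mono z hh ag).
have -> : \sum_(i <- index_enum 'I_n) oscil (fun z0 => w i * q i z0) z =
    \sum_i w i * (partial_z i h z * dbar i g z) - c.+1%:R * \sum_i w i * q i z.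
  rewrite mulr_sumr -sumrB; apply: eq_bigr => i _.
  by rewrite oscilZ// -Lq mulrDr mulrCA addrK.
rewrite /m natrD in m0 *; exact: rid_oscil.
Qed.

Lemma oscil_surj (c : nat) p : pol p ->
  exists2 q, pol q & forall z, oscil q z + c.+1%:R * q z = p z.
Proof.
elim=> [d h g hh ag|p1 p2 _ [q1 pq1 h1] _ [q2 pq2 h2]]; first exact: oscil_mono_surj hh ag.
exists (fun z => q1 z + q2 z); first exact: pol_add.
by move=> z; rewrite oscilD// -h1 -h2 mulrDr; exact: addrACA.
Qed.

End oscillator.

Definition csmooth_alg f := smooth_alg (fun z => complex.Re (f z)) /\ smooth_alg (fun z => complex.Im (f z)).

Lemma csmooth_alg_cst (c : C) : csmooth_alg (fun=> c).
Proof. by split; exact: smooth_alg_cst. Qed.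

Lemma csmooth_alg_add f g : csmooth_alg f -> csmooth_alg g -> csmooth_alg (fun z => f z + g z).
Proof.
move=> [f1 f2] [g1 g2]; split.
  by under eq_fun do rewrite cReD; exact: smooth_alg_add.
by under eq_fun do rewrite cImD; exact: smooth_alg_add.
Qed.

Lemma csmooth_alg_mul f g : csmooth_alg f -> csmooth_alg g -> csmooth_alg (fun z => f z * g z).
Proof.
move=> [f1 f2] [g1 g2]; split.
  under eq_fun do rewrite cReM -mulN1r.
  by apply: smooth_alg_add; [|apply: smooth_alg_mul; [exact: smooth_alg_cst|]]; exact: smooth_alg_mul.
by under eq_fun do rewrite cImM; apply: smooth_alg_add; exact: smooth_alg_mul.
Qed.

Lemma csmooth_alg_zcoord j : csmooth_alg (fun z => zcoord z j).
Proof.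
split; first exact: (@smooth_alg_coord R n id (j, 0) (smooth1_id R)).
exact: (@smooth_alg_coord R n id (j, 1) (smooth1_id R)).
Qed.

Lemma csmooth_alg_zconj j : csmooth_alg (fun z => zconj z j).
Proof.
split; first exact: (@smooth_alg_coord R n id (j, 0) (smooth1_id R)).
rewrite /=; under eq_fun do rewrite -mulN1r; apply: smooth_alg_mul; first exact: smooth_alg_cst.
exact: (@smooth_alg_coord R n id (j, 1) (smooth1_id R)).
Qed.

Lemma csmooth_alg_hol h : hol h -> csmooth_alg h.
Proof.
elim=> [c|i {}h hh ih|{}h h' hh ih hh' ih'].
- exact: csmooth_alg_cst.
- by apply: csmooth_alg_mul => //; exact: csmooth_alg_zcoord.
- exact: csmooth_alg_add.
Qed.

Lemma csmooth_alg_ahol d g : ahol d g -> csmooth_alg g.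
Proof.
elim=> [c'|d'|{}d i {}g ag ih|{}d {}g g' ag ih ag' ih'].
- exact: csmooth_alg_cst.
- exact: csmooth_alg_cst.
- by apply: csmooth_alg_mul => //; exact: csmooth_alg_zconj.
- exact: csmooth_alg_add.
Qed.

Lemma csmooth_alg_pol p : pol p -> csmooth_alg p.
Proof.
elim=> [d h g hh ag|{}p q _ cp _ cq]; last exact: csmooth_alg_add.
exact: csmooth_alg_mul (csmooth_alg_hol hh) (csmooth_alg_ahol ag).
Qed.

Lemma csmooth_alg_cdiff f : csmooth_alg f -> cdiff f.
Proof.
move=> [f1 f2]; apply: is_partial_cdiff => k.
have [g1 _ h1] := smooth_alg_derive k f1; have [g2 _ h2] := smooth_alg_derive k f2.
by exists (fun z => g1 z +i* g2 z) => z; split.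
Qed.

End complex_calculus.

(** * Complex integrals and square integrable functions *)

Section square_modulus.
Variable R : realType.
Implicit Types x y : R[i].

Definition sqc x : R := complex.Re x ^+ 2 + complex.Im x ^+ 2.

Lemma sqc_ge0 x : 0 <= sqc x.
Proof. by rewrite addr_ge0 ?sqr_ge0. Qed.

Lemma sqcM x y : sqc (x * y) = sqc x * sqc y.
Proof. rewrite /sqc cReM cImM; ring. Qed.

Lemma sqcJ x : sqc x^*%C = sqc x.
Proof. by rewrite /sqc cReJ cImJ sqrrN. Qed.

Lemma sqcD x y : sqc (x + y) <= 2 * sqc x + 2 * sqc y.
Proof.
rewrite /sqc cReD cImD.
have := sqr_ge0 (complex.Re x - complex.Re y); have := sqr_ge0 (complex.Im x - complex.Im y).
nra.
Qed.

Lemma sqcB x y : sqc (x - y) <= 2 * sqc x + 2 * sqc y.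
Proof.
case: x y => [x x'] [y y']; rewrite /sqc /=.
have := sqr_ge0 (x + y); have := sqr_ge0 (x' + y'); nra.
Qed.

Lemma sqcR (r : R) : sqc r%:C = r ^+ 2.
Proof. by rewrite /sqc /= expr0n addr0. Qed.

Lemma sqc0 : sqc 0 = 0.
Proof. by rewrite /sqc /= expr0n addr0. Qed.

Lemma Re_mulJ x y : `|complex.Re (x * y^*%C)| <= sqc x + sqc y.
Proof.
case: x y => [x x'] [y y']; rewrite ler_norml /sqc /=.
have := sqr_ge0 (x + y); have := sqr_ge0 (x' + y').
have := sqr_ge0 (x - y); have := sqr_ge0 (x' - y').
have := sqr_ge0 x; have := sqr_ge0 y; have := sqr_ge0 x'; have := sqr_ge0 y'.
by move=> *; apply/andP; split; nra.
Qed.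

Lemma Im_mulJ x y : `|complex.Im (x * y^*%C)| <= sqc x + sqc y.
Proof.
case: x y => [x x'] [y y']; rewrite ler_norml /sqc /=.
have := sqr_ge0 (x + y'); have := sqr_ge0 (x' + y).
have := sqr_ge0 (x - y'); have := sqr_ge0 (x' - y).
have := sqr_ge0 x; have := sqr_ge0 y; have := sqr_ge0 x'; have := sqr_ge0 y'.
by move=> *; apply/andP; split; nra.
Qed.

Lemma mulcJ x : x * x^*%C = (sqc x)%:C.
Proof. by apply: complex_ext; rewrite ?cReM ?cImM cReJ cImJ /sqc /=; ring. Qed.

Lemma cReN x : complex.Re (- x) = - complex.Re x.
Proof. by case: x. Qed.
Lemma cImN x : complex.Im (- x) = - complex.Im x.
Proof. by case: x. Qed.

End square_modulus.

Section complex_integral.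
Variables (R : realType) (a : nat -> {posnum R}) (n : nat).
Local Notation Cn := (Cn R n).
Local Notation C := R[i].
Local Notation mu := (gaussCn a n).
Local Notation L2 := (@L2 R a n).
Local Notation cint := (@cint R a n).
Implicit Types f g : Cn -> C.

Definition rintegrable (f : Cn -> R) := mu.-integrable setT (EFin \o f).
Definition cintegrable f := rintegrable (fun z => complex.Re (f z)) /\ rintegrable (fun z => complex.Im (f z)).

Lemma rint_le (f g : Cn -> R) : measurable_fun setT f -> (forall z, `|f z| <= g z) ->
  rintegrable g -> rintegrable f.
Proof.
move=> mf fg ig; apply: (@le_integrable _ _ _ mu setT measurableT _ (EFin \o g)) => //.
  exact/measurable_EFinP.
by move=> z _ /=; rewrite lee_fin (le_trans (fg z))// ler_norm.
Qed.

Lemma rintD (f g : Cn -> R) : rintegrable f -> rintegrable g -> rintegrable (fun z => f z + g z).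
Proof. by move=> hf hg; exact: (integrableD measurableT hf hg). Qed.

Lemma rintZ (k : R) (f : Cn -> R) : rintegrable f -> rintegrable (fun z => k * f z).
Proof. by move=> hf; exact: (integrableZl measurableT k hf). Qed.

Lemma rint0 : rintegrable (fun=> 0).
Proof. exact: finite_measure_integrable_cst. Qed.

Lemma rint_sum (I : Type) (r : seq I) (F : I -> Cn -> R) : (forall i, rintegrable (F i)) ->
  rintegrable (fun z => \sum_(i <- r) F i z).
Proof.
move=> hF; elim: r => [|i r ih].
  by under eq_fun do rewrite big_nil; exact: rint0.
by under eq_fun do rewrite big_cons; exact: rintD.
Qed.

Lemma cintegrableD f g : cintegrable f -> cintegrable g -> cintegrable (fun z => f z + g z).
Proof.
move=> [f1 f2] [g1 g2]; split; [under eq_fun do rewrite cReD|under eq_fun do rewrite cImD]; exact: rintD.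
Qed.

Lemma cintegrableZ (c : C) f : cintegrable f -> cintegrable (fun z => c * f z).
Proof.
move=> [f1 f2]; split; [under eq_fun do rewrite cReM -mulNr|under eq_fun do rewrite cImM];
  by apply: rintD; exact: rintZ.
Qed.

Lemma cintegrable0 : cintegrable (fun=> 0).
Proof. by split; exact: rint0. Qed.

Lemma cintegrable_sum (I : Type) (r : seq I) (F : I -> Cn -> C) : (forall i, cintegrable (F i)) ->
  cintegrable (fun z => \sum_(i <- r) F i z).
Proof.
move=> hF; elim: r => [|i r ih].
  by under eq_fun do rewrite big_nil; exact: cintegrable0.
by under eq_fun do rewrite big_cons; exact: cintegrableD.
Qed.

Lemma cintD f g : cintegrable f -> cintegrable g ->
  cint (fun z => f z + g z) = cint f + cint g.
Proof.
move=> [f1 f2] [g1 g2]; apply: complex_ext => /=.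
  by under eq_Rintegral do rewrite cReD; rewrite RintegralD.
by under eq_Rintegral do rewrite cImD; rewrite RintegralD.
Qed.

Lemma cintZ (c : C) f : cintegrable f -> cint (fun z => c * f z) = c * cint f.
Proof.
move=> [f1 f2]; apply: complex_ext.
  rewrite [LHS]/= cReM; under eq_Rintegral do rewrite cReM.
  by rewrite RintegralB ?RintegralZl//; exact: rintZ.
rewrite [LHS]/= cImM; under eq_Rintegral do rewrite cImM.
by rewrite RintegralD ?RintegralZl//; exact: rintZ.
Qed.

Lemma cint0 : cint (fun=> 0) = 0.
Proof. by apply: complex_ext; rewrite /= Rintegral_cst// mul0r. Qed.

Lemma cintJ f : cintegrable f -> cint (fun z => (f z)^*%C) = (cint f)^*%C.
Proof.
move=> [f1 f2]; apply: complex_ext => /=; first by apply: eq_Rintegral => z _; rewrite cReJ.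
under eq_Rintegral do rewrite cImJ -mulN1r.
by rewrite RintegralZl// mulN1r.
Qed.

Lemma cint_sum (I : Type) (r : seq I) (F : I -> Cn -> C) : (forall i, cintegrable (F i)) ->
  cint (fun z => \sum_(i <- r) F i z) = \sum_(i <- r) cint (F i).
Proof.
move=> hF; elim: r => [|i r ih].
  by under eq_fun do rewrite big_nil; rewrite cint0 big_nil.
under eq_fun do rewrite big_cons.
by rewrite cintD ?ih ?big_cons//; exact: cintegrable_sum.
Qed.

Lemma cmeasurable_sqc f : cmeasurable f -> measurable_fun setT (fun z => sqc (f z)).
Proof.
by move=> [f1 f2]; apply: measurable_funD; exact: measurable_funX.
Qed.

Lemma L2_sqc f : L2 f -> rintegrable (fun z => sqc (f z)).
Proof.
move=> [mf lf]; apply/integrableP; split.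
  by apply/measurable_EFinP; exact: cmeasurable_sqc.
by under eq_integral do rewrite /= ger0_norm ?sqc_ge0//.
Qed.

Lemma sqc_L2 f : cmeasurable f -> rintegrable (fun z => sqc (f z)) -> L2 f.
Proof.
move=> mf /integrableP[_ h]; split=> //; apply: le_lt_trans h.
by under [leRHS]eq_integral do rewrite /= ger0_norm ?sqc_ge0//.
Qed.

Lemma cmeasurableD f g : cmeasurable f -> cmeasurable g -> cmeasurable (fun z => f z + g z).
Proof.
move=> [f1 f2] [g1 g2]; split; [under eq_fun do rewrite cReD|under eq_fun do rewrite cImD]; exact: measurable_funD.
Qed.

Lemma cmeasurableM f g : cmeasurable f -> cmeasurable g -> cmeasurable (fun z => f z * g z).
Proof.
move=> [f1 f2] [g1 g2]; split; [under eq_fun do rewrite cReM|under eq_fun do rewrite cImM].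
  by apply: measurable_funB; exact: measurable_funM.
by apply: measurable_funD; exact: measurable_funM.
Qed.

Lemma cmeasurableJ f : cmeasurable f -> cmeasurable (fun z => (f z)^*%C).
Proof.
move=> [f1 f2]; split; [under eq_fun do rewrite cReJ|under eq_fun do rewrite cImJ] => //.
exact: measurableT_comp.
Qed.

Lemma cmeasurable_cst (c : C) : cmeasurable (fun _ : Cn => c).
Proof. by split; exact: measurable_cst. Qed.

Lemma cmeasurable_sum (I : Type) (r : seq I) (F : I -> Cn -> C) :
  (forall i, cmeasurable (F i)) -> cmeasurable (fun z => \sum_(i <- r) F i z).
Proof.
move=> hF; elim: r => [|i r ih].
  by under eq_fun do rewrite big_nil; exact: cmeasurable_cst.
by under eq_fun do rewrite big_cons; exact: cmeasurableD.
Qed.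

Lemma L2_le f (v : Cn -> R) : cmeasurable f -> (forall z, sqc (f z) <= v z) -> rintegrable v -> L2 f.
Proof.
move=> mf fv iv; apply: sqc_L2 => //; apply: rint_le iv; first exact: cmeasurable_sqc.
by move=> z; rewrite ger0_norm ?sqc_ge0.
Qed.

Lemma L2D f g : L2 f -> L2 g -> L2 (fun z => f z + g z).
Proof.
move=> hf hg; apply: (@L2_le _ (fun z => 2 * sqc (f z) + 2 * sqc (g z))).
- by apply: cmeasurableD; [case: hf|case: hg].
- by move=> z; exact: sqcD.
- by apply: rintD; apply: rintZ; exact: L2_sqc.
Qed.

Lemma L2Z (c : C) f : L2 f -> L2 (fun z => c * f z).
Proof.
move=> hf; apply: (@L2_le _ (fun z => sqc c * sqc (f z))).
- by apply: cmeasurableM; [exact: cmeasurable_cst|case: hf].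
- by move=> z; rewrite sqcM.
- by apply: rintZ; exact: L2_sqc.
Qed.

Lemma L2_cst (c : C) : L2 (fun=> c).
Proof.
apply: sqc_L2; first exact: cmeasurable_cst.
exact: finite_measure_integrable_cst.
Qed.

Lemma L2_sum (I : Type) (r : seq I) (F : I -> Cn -> C) :
  (forall i, L2 (F i)) -> L2 (fun z => \sum_(i <- r) F i z).
Proof.
move=> hF; elim: r => [|i r ih].
  by under eq_fun do rewrite big_nil; exact: L2_cst.
by under eq_fun do rewrite big_cons; exact: L2D.
Qed.

Lemma L2_mulJ f g : L2 f -> L2 g -> cintegrable (fun z => f z * (g z)^*%C).
Proof.
move=> hf hg; have [m1 m2] : cmeasurable (fun z => f z * (g z)^*%C).
  by apply: cmeasurableM; [case: hf|apply: cmeasurableJ; case: hg].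
have ib : rintegrable (fun z => sqc (f z) + sqc (g z)) by apply: rintD; exact: L2_sqc.
split; apply: rint_le ib => // z; [exact: Re_mulJ|exact: Im_mulJ].
Qed.

Lemma Rdct (u_ : nat -> Cn -> R) (u v : Cn -> R) :
  (forall N, measurable_fun setT (u_ N)) -> rintegrable v ->
  (forall N z, `|u_ N z| <= v z) -> (forall z, u_ ^~ z @ \oo --> u z) ->
  rintegrable u /\ (\int[mu]_z u_ N z)%R @[N --> \oo] --> (\int[mu]_z u z)%R.
Proof.
move=> mu_ iv uv cu.
have mu0 : measurable_fun setT u by apply: (@measurable_fun_cvg _ _ _ _ u_) => // z _; exact: cu.
have [] := @dominated_convergence _ _ _ mu setT measurableT
  (fun N z => (u_ N z)%:E) (EFin \o u) (EFin \o v).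
- by move=> N; apply/measurable_EFinP.
- exact/measurable_EFinP.
- by apply: aeW => z _; apply: cvg_EFin; [exact: nearW|exact: cu].
- exact: iv.
- by apply: aeW => z N _; rewrite lee_fin.
move=> iu _ cI; split => //.
by apply: fine_cvg; rewrite fineK//; exact: integrable_fin_num.
Qed.

Lemma cint_limit0 (u_ : nat -> Cn -> C) (u : Cn -> C) (v : Cn -> R) :
  (forall N, cmeasurable (u_ N)) -> rintegrable v ->
  (forall N z, `|complex.Re (u_ N z)| <= v z /\ `|complex.Im (u_ N z)| <= v z) ->
  (forall z, (fun N => complex.Re (u_ N z)) @ \oo --> complex.Re (u z)) ->
  (forall z, (fun N => complex.Im (u_ N z)) @ \oo --> complex.Im (u z)) ->
  (forall N, cint (u_ N) = 0) -> cint u = 0.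
Proof.
move=> mu_ iv uv cr ci u0.
have [_ hr] := Rdct (fun N => (mu_ N).1) iv (fun N z => (uv N z).1) cr.
have [_ hi] := Rdct (fun N => (mu_ N).2) iv (fun N z => (uv N z).2) ci.
apply: complex_ext => /=.
  apply/esym/(cvg_unique _ _ hr) => //; rewrite (_ : (fun N => _) = cst 0); first exact: cvg_cst.
  by apply/funext => N; have := congr1 (@complex.Re R) (u0 N).
apply/esym/(cvg_unique _ _ hi) => //; rewrite (_ : (fun N => _) = cst 0); first exact: cvg_cst.
by apply/funext => N; have := congr1 (@complex.Im R) (u0 N).
Qed.

End complex_integral.

(** * Square integrability of polynomials *)

Section slow_growth.
Variables (R : realType) (a : nat -> {posnum R}) (n : nat).
Local Notation Cn := (Cn R n).
Local Notation C := R[i].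
Local Notation mu := (gaussCn a n).
Local Notation Q := (@Qexp R a n).
Implicit Types f g : Cn -> C.

(** Growth below exp(e Q) for every e > 0. Asking for all e makes the class stable under
    products. *)
Definition slow f := forall e : R, 0 < e ->
  exists2 K, 0 <= K & forall z, sqc (f z) <= K * expR (e * Q z).

Lemma slow_cst c : slow (fun=> c).
Proof.
move=> e e0; exists (sqc c); first exact: sqc_ge0.
move=> z; rewrite ler_peMr ?sqc_ge0// -expR0 ler_expR.
by rewrite mulr_ge0 ?Qexp_ge0// ltW.
Qed.

Lemma slowD f g : slow f -> slow g -> slow (fun z => f z + g z).
Proof.
move=> sf sg e e0; have [K K0 hK] := sf e e0; have [L L0 hL] := sg e e0.
exists (2 * K + 2 * L); first by rewrite addr_ge0// mulr_ge0.
move=> z; apply: (le_trans (sqcD _ _)); set E := expR _.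
rewrite (_ : _ * E = 2 * (K * E) + 2 * (L * E)); last by ring.
by rewrite lerD// ler_wpM2l.
Qed.

Lemma slowM f g : slow f -> slow g -> slow (fun z => f z * g z).
Proof.
move=> sf sg e e0; have e20 : 0 < e / 2 by rewrite divr_gt0.
have [K K0 hK] := sf _ e20; have [L L0 hL] := sg _ e20.
exists (K * L); first exact: mulr_ge0.
move=> z; rewrite sqcM (_ : e * Q z = e / 2 * Q z + e / 2 * Q z); last by field.
rewrite expRD mulrACA; apply: ler_pM => //; exact: sqc_ge0.
Qed.

Lemma Qexp_coord (j : 'I_n) (z : Cn) : sqc (zcoord z j) <= 4 * (a j)%:num ^+ 2 * Q z.
Proof.
have a0 : 0 < 4 * (a j)%:num ^+ 2 by rewrite mulr_gt0.
rewrite -ler_pdivrMl// QexpE (bigD1 (j, 0))//= (bigD1 (j, 1)) /=; last first.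
  by rewrite xpair_eqE andbF.
rewrite /sqc /zcoord /xcoord /ycoord /= [leLHS]mulrC [leLHS]mulrDl addrA lerDl.
by apply: sumr_ge0 => p _; rewrite mulr_ge0 ?sqr_ge0// invr_ge0 mulr_ge0.
Qed.

Lemma slow_zcoord j : slow (fun z => zcoord z j).
Proof.
move=> e e0; have a0 : 0 <= 4 * (a j)%:num ^+ 2 by rewrite mulr_ge0.
exists (4 * (a j)%:num ^+ 2 / e); first by rewrite divr_ge0// ltW.
move=> z; rewrite (le_trans (Qexp_coord j z))// -[leRHS]mulrA ler_wpM2l//.
rewrite mulrC ler_pdivlMr// mulrC (le_trans _ (expR_ge1Dx _))//.
by rewrite lerDr.
Qed.

Lemma slow_zconj j : slow (fun z => zconj z j).
Proof.
move=> e e0; have [K K0 hK] := slow_zcoord j e0; exists K => // z.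
by rewrite /zconj sqcJ.
Qed.

Lemma slow_pol p : pol p -> slow p.
Proof.
elim=> [d h g hh ag|{}p q _ sp _ sq]; last exact: slowD.
apply: slowM.
  elim: hh => [c|i {}h _ ih|{}h h' _ ih _ ih'].
  - exact: slow_cst.
  - by apply: slowM => //; exact: slow_zcoord.
  - exact: slowD.
elim: ag => [c'|d'|{}d i {}g ag ih|{}d {}g g' ag ih ag' ih'].
- exact: slow_cst.
- exact: slow_cst.
- by apply: slowM => //; exact: slow_zconj.
- exact: slowD.
Qed.

Lemma rint_expQ : rintegrable a (fun z => expR (Q z)).
Proof.
apply/integrableP; split.
  apply/measurable_EFinP; apply: measurableT_comp; first exact: measurable_expR.
  exact: measurable_Qsum.
under eq_integral do rewrite /= ger0_norm ?expR_ge0//.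
exact: gaussCn_exp_moment.
Qed.

Lemma cmeasurable_csmooth_alg f : csmooth_alg f -> cmeasurable f.
Proof. by move=> [f1 f2]; split; apply: continuous_measurable_Cn; exact: smooth_alg_continuous. Qed.

Lemma L2_pol (p : Cn -> C) : pol p -> L2 a p.
Proof.
move=> pp; have [K K0 hK] := slow_pol pp (@ltr01 R).
(* The bound of slow with e = 1. *)
apply: (@L2_le _ _ _ _ (fun z => K * expR (Q z))).
- by apply: cmeasurable_csmooth_alg; exact: csmooth_alg_pol.
- by move=> z; rewrite -[Q z]mul1r.
- by apply: rintZ; exact: rint_expQ.
Qed.

End slow_growth.

(** * Compactly supported functions *)

Section compact_support.
Variables (R : realType) (n : nat).
Local Notation Cn := (Cn R n).
Local Notation C := R[i].
Local Notation evec := (@evec R n).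
Implicit Types f g : Cn -> C.

Definition cube (M : R) : set Cn := [set z : Cn | forall j l, `|z j l| <= M].

Lemma continuous_vec_mx : continuous (vec_mx : 'rV[R]_(n * 2) -> Cn).
Proof.
move=> v s /= /nbhs_ballP[e e0 es]; apply/nbhs_ballP; exists e => //= w [_ vw].
apply: es; split=> // j l; rewrite !mxE; exact: vw.
Qed.

Lemma compact_cube M : compact (cube M).
Proof.
have -> : cube M = vec_mx @` [set v : 'rV[R]_(n * 2) | forall i, `[(- M), M]%classic (v ord0 i)].
  apply/seteqP; split=> [z hz|_ [v hv <-]].
    exists (mxvec z); last by rewrite mxvecK.
    move=> i; rewrite /= in_itv/= -ler_norml.
    by case/mxvec_indexP: i => j l; rewrite mxvecE.
  move=> j l; rewrite mxE; have := hv (mxvec_index j l).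
  by rewrite /= in_itv/= -ler_norml.
apply: continuous_compact.
  by apply: continuous_subspaceT; exact: continuous_vec_mx.
by apply: (@rV_compact _ _ (fun=> `[(- M), M]%classic)) => _; exact: segment_compact.
Qed.

Lemma closed_cube (M : R) : closed (cube M).
Proof. by apply: compact_closed; [exact: norm_hausdorff|exact: compact_cube]. Qed.

Lemma cubeC_near M (z : Cn) : ~ cube M z -> \forall w \near z, ~ cube M w.
Proof.
move=> hz; have := @closed_cube M; rewrite -openC openE => /(_ z hz).
by rewrite /interior.
Qed.

Lemma bounded_cube_supp M (f : Cn -> R) : continuous f ->
  (forall z, ~ cube M z -> f z = 0) -> exists2 K, 0 <= K & forall z, `|f z| <= K.
Proof.
move=> cf f0.
have : compact (f @` cube M).
  by apply: continuous_compact; [exact: continuous_subspaceT|exact: compact_cube].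
move=> /compact_bounded[K [Kr hK]].
exists (`|K| + 1); first by rewrite addr_ge0.
move=> z; have [cz|cz] := pselect (cube M z); last by rewrite f0// normr0 addr_ge0.
by apply: hK; [rewrite ltr_pwDr// ler_norm|exists z].
Qed.

(** Continuously differentiable functions, the regularity that integration by parts uses. *)
Definition cC1 f := [/\ cdiff f,
  continuous (fun z => complex.Re (f z)) /\ continuous (fun z => complex.Im (f z)) &
  forall k, continuous (fun z => complex.Re (partial k f z)) /\
            continuous (fun z => complex.Im (partial k f z))].

Lemma rcontN (f : Cn -> R) : continuous f -> continuous (fun z => - f z).
Proof. by move=> cf z; exact: cvgN (cf z). Qed.
Lemma rcontD (f g : Cn -> R) : continuous f -> continuous g -> continuous (fun z => f z + g z).
Proof. by move=> cf cg z; exact: cvgD (cf z) (cg z). Qed.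
Lemma rcontM (f g : Cn -> R) : continuous f -> continuous g -> continuous (fun z => f z * g z).
Proof. by move=> cf cg z; exact: cvgM (cf z) (cg z). Qed.

Lemma cC1J f : cC1 f -> cC1 (fun z => (f z)^*%C).
Proof.
move=> [df [c1 c2] dc]; have H k := partial_val (is_partial_conj (df k)).
split.
- by apply: is_partial_cdiff => k; eexists; exact: is_partial_conj (df k).
- split; first by under eq_fun do rewrite cReJ.
  by under eq_fun do rewrite cImJ; exact: rcontN.
- move=> k; rewrite H; have [d1 d2] := dc k; split; first by under eq_fun do rewrite cReJ.
  by under eq_fun do rewrite cImJ; exact: rcontN.
Qed.

Lemma ccontD f g :
  continuous (fun z => complex.Re (f z)) /\ continuous (fun z => complex.Im (f z)) ->
  continuous (fun z => complex.Re (g z)) /\ continuous (fun z => complex.Im (g z)) ->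
  continuous (fun z => complex.Re (f z + g z)) /\ continuous (fun z => complex.Im (f z + g z)).
Proof.
move=> [f1 f2] [g1 g2]; split; [under eq_fun do rewrite cReD|under eq_fun do rewrite cImD];
  exact: rcontD.
Qed.

Lemma ccontM f g :
  continuous (fun z => complex.Re (f z)) /\ continuous (fun z => complex.Im (f z)) ->
  continuous (fun z => complex.Re (g z)) /\ continuous (fun z => complex.Im (g z)) ->
  continuous (fun z => complex.Re (f z * g z)) /\ continuous (fun z => complex.Im (f z * g z)).
Proof.
move=> [f1 f2] [g1 g2]; split; [under eq_fun do rewrite cReM|under eq_fun do rewrite cImM].
  by apply: rcontD; [|apply: rcontN]; exact: rcontM.
by apply: rcontD; exact: rcontM.
Qed.

Lemma cC1M f g : cC1 f -> cC1 g -> cC1 (fun z => f z * g z).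
Proof.
move=> [df cf dcf] [dg cg dcg]; split; [exact: cdiffM|exact: ccontM|].
by move=> k; rewrite (partialM df dg); apply: ccontD; exact: ccontM.
Qed.

Lemma csmooth_alg_cC1 f : csmooth_alg f -> cC1 f.
Proof.
move=> sf; have [f1 f2] := sf; split.
- exact: csmooth_alg_cdiff.
- by split; exact: smooth_alg_continuous.
- move=> k; have [g1 s1 h1] := smooth_alg_derive k f1; have [g2 s2 h2] := smooth_alg_derive k f2.
  rewrite (@partial_val _ _ _ _ (fun z => g1 z +i* g2 z)); last by move=> z; split.
  by split; exact: smooth_alg_continuous.
Qed.

Lemma Cc_cC1 f : Cc_infty f -> cC1 f.
Proof.
move=> [s1 s2 _]; have [c1 d1] := s1 [::]; have [c2 d2] := s2 [::].
split.
- by move=> k z; split; apply: DeriveDef.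
- by split.
- by move=> k; split; [have [] := s1 [:: k]|have [] := s2 [:: k]].
Qed.

Lemma Cc_supp f : Cc_infty f -> exists2 M, 0 < M & forall z, ~ cube M z -> f z = 0.
Proof.
move=> [_ _ /compact_bounded[K [Kr hK]]].
exists (`|K| + 1); first by rewrite ltr_pwDr.
move=> z hz; apply: contrapT => /eqP fz; apply: hz => j l.
have zK : `|z| <= `|K| + 1.
  by apply: hK; [rewrite ltr_pwDr// ler_norm|exact: subset_closure].
apply: le_trans zK; rewrite [leRHS]mx_normrE.
by apply/bigmax_geP; right => /=; exists (j, l).
Qed.

Lemma partial_supp f M k : cC1 f -> (forall z, ~ cube M z -> f z = 0) ->
  forall z, ~ cube M z -> partial k f z = 0.
Proof.
move=> [df _ _] f0 z hz.
have nz : \forall w \near z, f w = 0.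
  by near=> w; apply: f0; near: w; exact: cubeC_near.
have [[_ h1] [_ h2]] := df k z; apply: complex_ext; rewrite -?h1 -?h2.
- have [_ ->//] : is_derive z (evec k) (fun w => complex.Re (f w)) 0.
  by apply: (@near_eq_is_derive _ _ _ (cst 0)); near=> w => /=; rewrite (near nz w).
- have [_ ->//] : is_derive z (evec k) (fun w => complex.Im (f w)) 0.
  by apply: (@near_eq_is_derive _ _ _ (cst 0)); near=> w => /=; rewrite (near nz w).
Unshelve. all: by end_near.
Qed.

Lemma Cc_cutoff N (p : Cn -> C) : csmooth_alg p -> Cc_infty (fun z => (cutoff N z)%:C * p z).
Proof.
move=> sp; have sc : csmooth_alg (fun z : Cn => (cutoff N z)%:C).
  by split; [exact: smooth_alg_cutoff|exact: smooth_alg_cst].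
have [s1 s2] := csmooth_alg_mul sc sp.
split; [exact: smooth_alg_smooth|exact: smooth_alg_smooth|].
apply: (subclosed_compact _ (@compact_cube N.+1%:R)); first exact: closed_closure.
rewrite closureE; apply: smallest_sub; first exact: closed_cube.
move=> z /=; rewrite mulf_eq0 negb_or => /andP[cz _].
apply: cutoff_supp; apply: contra cz => /eqP ->.
by [].
Qed.

End compact_support.

(** * From compactly supported test functions to polynomials *)

Section weak_equations.
Variables (R : realType) (a : nat -> {posnum R}) (n : nat).
Local Notation Cn := (Cn R n).
Local Notation C := R[i].
Local Notation mu := (gaussCn a n).
Local Notation cint := (@cint R a n).
Local Notation cintegrable := (@cintegrable R a n).
Local Notation evec := (@evec R n).
Local Notation w i := ((2 * (a i)%:num ^+ 2)%:C : C).
Implicit Types f g : Cn -> C.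

Lemma cintegrable_supp f M :
  continuous (fun z => complex.Re (f z)) /\ continuous (fun z => complex.Im (f z)) ->
  (forall z, ~ cube M z -> f z = 0) -> cintegrable f.
Proof.
move=> [c1 c2] f0.
have H (h : Cn -> R) : continuous h -> (forall z, ~ cube M z -> h z = 0) -> rintegrable a h.
  move=> ch h0; have [K _ hK] := bounded_cube_supp ch h0.
  apply: (@rint_le _ _ _ h (cst K)) => //; first exact: continuous_measurable_Cn.
  exact: finite_measure_integrable_cst.
by split; apply: H => // z hz; rewrite f0.
Qed.

Lemma ccont_coord (i : 'I_n) (l : 'I_2) (r : R) :
  continuous (fun z : Cn => complex.Re (z i l / r)%:C) /\
  continuous (fun z : Cn => complex.Im (z i l / r)%:C).
Proof.
split; last by move=> z; exact: cst_continuous.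
by apply: rcontM; [exact: coord_continuous|move=> z; exact: cst_continuous].
Qed.

Lemma cint_ibp (i : 'I_n) (l : 'I_2) f M : 0 < M -> cC1 f ->
  (forall z, ~ cube M z -> f z = 0) ->
  let G z := partial (i, l) f z - (z i l / (a i)%:num ^+ 2)%:C * f z in
  cintegrable G /\ cint G = 0.
Proof.
move=> M0 Cf f0 G; have [df cf dcf] := Cf; have p0 := partial_supp (i, l) Cf f0.
have cG : continuous (fun z => complex.Re (G z)) /\ continuous (fun z => complex.Im (G z)).
  rewrite /G; under eq_fun do rewrite -mulN1r; under [X in _ /\ continuous X]eq_fun do rewrite -mulN1r.
  apply: ccontD; first exact: dcf.
  apply: ccontM; first by split => z; exact: cst_continuous.
  apply: ccontM => //; exact: ccont_coord.
have G0 z : ~ cube M z -> G z = 0 by move=> hz; rewrite /G p0// f0// mulr0 subr0.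
split; first exact: cintegrable_supp cG G0.
have outside (z : Cn) : M < `|z i l| -> ~ cube M z.
  by move=> zM /(_ i l); rewrite leNgt zM.
have [K1 K10 hK1] := bounded_cube_supp cf.1 (fun z hz => congr1 (@complex.Re R) (f0 z hz)).
have [K2 K20 hK2] := bounded_cube_supp cf.2 (fun z hz => congr1 (@complex.Im R) (f0 z hz)).
have [L1 L10 hL1] := bounded_cube_supp (dcf (i, l)).1 (fun z hz => congr1 (@complex.Re R) (p0 z hz)).
have [L2 L20 hL2] := bounded_cube_supp (dcf (i, l)).2 (fun z hz => congr1 (@complex.Im R) (p0 z hz)).
apply: complex_ext => /=; rewrite /Rintegral.
- rewrite (eq_integral (fun z => (complex.Re (partial (i, l) f z) -
      z i l / (a i)%:num ^+ 2 * complex.Re (f z))%:E)); last first.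
    by move=> z _; rewrite /G; case: (partial _ _ _) (f z) => [? ?] [? ?] /=; rewrite mul0r subr0.
  rewrite [X in fine X](_ : _ = 0%E)//.
  apply: (@gaussian_ibp R a n i l (fun z => complex.Re (f z))
    (fun z => complex.Re (partial (i, l) f z)) M (K1 + L1) M0 cf.1 (dcf (i, l)).1).
  + by move=> z; case: (df (i, l) z).
  + by move=> z; rewrite (le_trans (hK1 z)) ?lerDl// (le_trans (hL1 z)) ?lerDr.
  + by move=> z /outside hz; rewrite f0// p0.
- rewrite (eq_integral (fun z => (complex.Im (partial (i, l) f z) -
      z i l / (a i)%:num ^+ 2 * complex.Im (f z))%:E)); last first.
    by move=> z _; rewrite /G; case: (partial _ _ _) (f z) => [? ?] [? ?] /=; rewrite mul0r addr0.
  rewrite [X in fine X](_ : _ = 0%E)//.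
  apply: (@gaussian_ibp R a n i l (fun z => complex.Im (f z))
    (fun z => complex.Im (partial (i, l) f z)) M (K2 + L2) M0 cf.2 (dcf (i, l)).2).
  + by move=> z; case: (df (i, l) z).
  + by move=> z; rewrite (le_trans (hK2 z)) ?lerDl// (le_trans (hL2 z)) ?lerDr.
  + by move=> z /outside hz; rewrite f0// p0.
Qed.

(** The real identities in the directions x_i and y_i combine into one for dbar_i. *)
Lemma cint_dbar_ibp (i : 'I_n) f M : 0 < M -> cC1 f ->
  (forall z, ~ cube M z -> f z = 0) ->
  cint (fun z => dbar i f z - zcoord z i / w i * f z) = 0.
Proof.
move=> M0 Cf f0.
have [i0 e0] := cint_ibp i 0 M0 Cf f0; have [i1 e1] := cint_ibp i 1 M0 Cf f0.
rewrite (_ : (fun z => _) = fun z =>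
    2^-1 * ((partial (i, 0) f z - (z i 0 / (a i)%:num ^+ 2)%:C * f z) +
            'i%C * (partial (i, 1) f z - (z i 1 / (a i)%:num ^+ 2)%:C * f z))).
  have iG1 := cintegrableZ 'i%C i1; have iG := cintegrableD i0 iG1.
  by rewrite (cintZ _ iG) (cintD i0 iG1) (cintZ _ i1) e0 e1 mulr0 addr0 mulr0.
apply/funext => z; rewrite /dbar.
have -> : zcoord z i / w i = 2^-1 * ((z i 0 / (a i)%:num ^+ 2)%:C + 'i%C * (z i 1 / (a i)%:num ^+ 2)%:C).
  have a0 : (a i)%:num ^+ 2 != 0 :> R by rewrite expf_neq0.
  rewrite invCR halfC.
  by apply: complex_ext => /=; rewrite /xcoord /ycoord; field.
move: (2^-1 : C) ('i%C) (_%:C) (_%:C) (partial (i, 0) f z) (partial (i, 1) f z) (f z).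
by move=> h i' x y p q u; rewrite rid_ibp.
Qed.

Lemma dbarJ (i : 'I_n) f : cdiff f -> dbar i (fun z => (f z)^*%C) = fun z => (partial_z i f z)^*%C.
Proof.
move=> df; rewrite /dbar /partial_z !(partial_val (is_partial_conj (df _))).
apply/funext => z.
by rewrite cJM cJD cJN cJM conj_i mulNr opprK halfC cJR.
Qed.

Lemma deltaJ (i : 'I_n) f z : (delta a i f z)^*%C =
  (partial_z i f z)^*%C - zcoord z i / w i * (f z)^*%C.
Proof.
rewrite /delta cJD cJN; congr (_ - _); rewrite cJM; congr (_ * _).
by rewrite cJM cJJ invCR cJR.
Qed.

(** The identity cint_dbar_ibp for the product of u with the conjugate of phi, by the product
    rule. *)
Lemma pol_ibp (i : 'I_n) (u phi : Cn -> C) : pol u -> Cc_infty phi ->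
  cint (fun z => dbar i u z * (phi z)^*%C + u z * (delta a i phi z)^*%C) = 0.
Proof.
move=> pu cphi; have [M M0 hM] := Cc_supp cphi.
have Cphi := Cc_cC1 cphi; have [dphi _ _] := Cphi.
have CF := cC1M (csmooth_alg_cC1 (csmooth_alg_pol pu)) (cC1J Cphi).
have F0 z : ~ cube M z -> u z * (phi z)^*%C = 0.
  by move=> hz; rewrite hM// conjc0 mulr0.
rewrite -(cint_dbar_ibp i M0 CF F0); congr Defs.cint; apply/funext => z.
have [dJ _ _] := cC1J Cphi.
rewrite (dbarM i (pol_cdiff pu) dJ) (dbarJ i dphi) deltaJ.
by rewrite mulrBr addrA [u z * (_ * _)]mulrCA.
Qed.

Lemma cmeasurable_cC1 f : cC1 f -> cmeasurable f /\ forall k, cmeasurable (partial k f).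
Proof.
move=> [_ [c1 c2] dc]; split; first by split; exact: continuous_measurable_Cn.
by move=> k; have [d1 d2] := dc k; split; exact: continuous_measurable_Cn.
Qed.

Lemma cmeasurable_partial_z i f : cC1 f -> cmeasurable (partial_z i f).
Proof.
move=> /cmeasurable_cC1[_ m]; rewrite /partial_z.
apply: cmeasurableM; first exact: cmeasurable_cst.
under eq_fun do rewrite -mulNr.
apply: cmeasurableD => //; apply: cmeasurableM => //; exact: cmeasurable_cst.
Qed.

Lemma cmeasurable_delta i f : cC1 f -> cmeasurable (delta a i f).
Proof.
move=> Cf; rewrite /delta; under eq_fun do rewrite -mulNr.
apply: cmeasurableD; first exact: cmeasurable_partial_z.
apply: cmeasurableM; last by have [] := cmeasurable_cC1 Cf.
under eq_fun do rewrite -mulrN.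
apply: cmeasurableM; last exact: cmeasurable_cst.
exact: cmeasurable_csmooth_alg (csmooth_alg_zconj R i).
Qed.

Lemma delta_pol i (p : Cn -> C) : pol p -> pol (delta a i p).
Proof.
move=> pp; rewrite /delta; under eq_fun do rewrite -mulNr -mulrN -mulrA mulrCA.
apply: pol_add; first exact: pol_partial_z.
by apply: polZ; apply: polM => //; exact: (pol_zconj R i).
Qed.

Lemma cC1_cutoff N : cC1 (fun z : Cn => (cutoff N z)%:C).
Proof. by apply: csmooth_alg_cC1; split; [exact: smooth_alg_cutoff|exact: smooth_alg_cst]. Qed.

Lemma delta_cutoff i N p : pol p ->
  delta a i (fun z : Cn => (cutoff N z)%:C * p z) =
  fun z => (cutoff N z)%:C * delta a i p z + partial_z i (fun z : Cn => (cutoff N z)%:C) z * p z.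
Proof.
move=> pp; have [dc _ _] := cC1_cutoff N.
apply/funext => z; rewrite /delta (partial_zM i dc (pol_cdiff pp)).
exact: rid_delta.
Qed.

Lemma sqc_partial_z_cutoff : exists2 K, 0 <= K & forall N (z : Cn),
  sqc ((cutoff N z)%:C) <= K /\ forall i : 'I_n,
  let d := partial_z i (fun z : Cn => (cutoff N z)%:C) z in
  [/\ sqc d <= K / N.+1%:R, `|complex.Re d| <= K / N.+1%:R &
      `|complex.Im d| <= K / N.+1%:R].
Proof.
have [K K0 hK] := cutoff_bound R n.
(* K^2 bounds the squares and K the real and imaginary parts. *)
exists (K ^+ 2 + K); first by rewrite addr_ge0 ?sqr_ge0.
move=> N z; have [h1 h2] := hK N z; split.
  rewrite ler_wpDr//.
  by rewrite sqcR -real_normK ?num_real// ler_pXn2r// nnegrE.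
move=> i; have Dk k : exists2 d, partial k (fun z : Cn => (cutoff N z)%:C) z = d%:C & `|d| <= K / N.+1%:R.
  have [d dd hd] := h2 k; exists d => //.
  by rewrite /partial /=; have [_ ->] := dd; rewrite derive_cst.
have [d0 e0 b0] := Dk (i, 0); have [d1 e1 b1] := Dk (i, 1).
have N1 : 0 < N.+1%:R^-1 :> R by rewrite invr_gt0.
have sqnorm : N.+1%:R^-1 <= 1 :> R by rewrite invf_le1// ler1n.
have sq (d : R) : `|d| <= K / N.+1%:R -> d ^+ 2 <= K ^+ 2 / N.+1%:R.
  move=> hd; rewrite -real_normK ?num_real//.
  apply: (@le_trans _ _ ((K / N.+1%:R) ^+ 2)).
    by rewrite ler_pXn2r// nnegrE ?normr_ge0// divr_ge0.
  rewrite exprMn ler_wpM2l ?sqr_ge0// expr2 ler_piMr// ltW//.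
have KN : K / N.+1%:R <= (K ^+ 2 + K) / N.+1%:R.
  by rewrite ler_wpM2r ?invr_ge0// lerDr sqr_ge0.
have KN2 : K ^+ 2 / N.+1%:R <= (K ^+ 2 + K) / N.+1%:R.
  by rewrite ler_wpM2r ?invr_ge0// lerDl.
have -> : partial_z i (fun z : Cn => (cutoff N z)%:C) z = (2^-1 * d0) +i* (- (2^-1 * d1)).
  by rewrite /partial_z e0 e1 halfC; apply: complex_ext => /=; ring.
have h (d : R) : `|d| <= K / N.+1%:R -> `|2^-1 * d| <= (K ^+ 2 + K) / N.+1%:R.
  move=> hd; apply: le_trans KN; rewrite normrM ger0_norm ?invr_ge0//.
  by apply: le_trans hd; rewrite ler_piMl// invf_le1// ler1n.
split; [|exact: h|by rewrite /= normrN; exact: h].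
apply: le_trans KN2; rewrite /sqc /= sqrrN !exprMn.
rewrite (_ : 2^-1 ^+ 2 = 1 / 4 :> R); last by field.
move: (sq _ b0) (sq _ b1) (sqr_ge0 d0) (sqr_ge0 d1).
by move: (d0 ^+ 2) (d1 ^+ 2) (K ^+ 2 / _) => u v X; lra.
Qed.

(** Convergence of complex sequences, taken componentwise as the integral is. *)
Definition ccvg (u : nat -> C) (l : C) : Prop :=
  (fun N => complex.Re (u N)) @ \oo --> complex.Re l /\
  (fun N => complex.Im (u N)) @ \oo --> complex.Im l.

Lemma ccvg_cst c : ccvg (fun=> c) c.
Proof. by split; exact: cvg_cst. Qed.

Lemma ccvgD u v x y : ccvg u x -> ccvg v y -> ccvg (fun N => u N + v N) (x + y).
Proof.
move=> [u1 u2] [v1 v2]; split.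
  by under eq_fun do rewrite cReD; rewrite cReD; exact: cvgD u1 v1.
by under eq_fun do rewrite cImD; rewrite cImD; exact: cvgD u2 v2.
Qed.

Lemma ccvgM u v x y : ccvg u x -> ccvg v y -> ccvg (fun N => u N * v N) (x * y).
Proof.
move=> [u1 u2] [v1 v2]; split.
  by under eq_fun do rewrite cReM; rewrite cReM; exact: cvgB (cvgM u1 v1) (cvgM u2 v2).
by under eq_fun do rewrite cImM; rewrite cImM; exact: cvgD (cvgM u1 v2) (cvgM u2 v1).
Qed.

Lemma ccvgJ u x : ccvg u x -> ccvg (fun N => (u N)^*%C) (x^*%C).
Proof.
move=> [u1 u2]; split; first by under eq_fun do rewrite cReJ; rewrite cReJ.
by under eq_fun do rewrite cImJ; rewrite cImJ; exact: cvgN u2.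
Qed.

Lemma ccvg_sum (I : Type) (r : seq I) (u : nat -> I -> C) (x : I -> C) :
  (forall i, ccvg (u ^~ i) (x i)) -> ccvg (fun N => \sum_(i <- r) u N i) (\sum_(i <- r) x i).
Proof.
move=> h; elim: r => [|i r ih].
  by under eq_fun do rewrite big_nil; rewrite big_nil; exact: ccvg_cst.
by under eq_fun do rewrite big_cons; rewrite big_cons; exact: ccvgD.
Qed.

(** A polynomial p is the limit of the test functions (cutoff N) p. Differentiating the
    cut-off produces an extra term of order |p| / (N + 1), and dominated convergence applies
    since p and all delta_i p are square integrable. *)
Lemma weak_pol (g : Cn -> C) (f : 'I_n -> Cn -> C) :
  L2 a g -> (forall i, L2 a (f i)) ->
  (forall phi, Cc_infty phi -> cint (fun z => g z * (phi z)^*%C +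
      \sum_i f i z * (delta a i phi z)^*%C) = 0) ->
  forall p, pol p -> cint (fun z => g z * (p z)^*%C +
      \sum_i f i z * (delta a i p z)^*%C) = 0.
Proof.
move=> Lg Lf weak p pp.
have [K K0 hK] := sqc_partial_z_cutoff.
pose ch N (z : Cn) : C := (cutoff N z)%:C.
pose dch N i (z : Cn) : C := partial_z i (ch N) z.
pose ph N := fun z : Cn => ch N z * p z.
have sp := csmooth_alg_pol pp.
have Cph N : cC1 (ph N) by apply: Cc_cC1; exact: Cc_cutoff.
have dph N i z : delta a i (ph N) z = ch N z * delta a i p z + dch N i z * p z.
  by rewrite /ph delta_cutoff.
(* A common bound for the integrands of the truncated equations, from |x conj(y)| <= |x|^2 + |y|^2. *)
pose v z := (sqc (g z) + K * sqc (p z)) +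
   \sum_i (sqc (f i z) + (2 * K * sqc (delta a i p z) + 2 * K * sqc (p z))).
have re_inner : rintegrable a (fun z => sqc (p z)) by apply: L2_sqc; exact: L2_pol.
have iv : rintegrable a v.
  apply: rintD; first by apply: rintD; [exact: L2_sqc|exact: rintZ].
  apply: rint_sum => i; apply: rintD; first exact: L2_sqc.
  apply: rintD; last exact: rintZ.
  by apply: rintZ; apply: L2_sqc; apply: L2_pol; exact: delta_pol.
have bp N z : sqc (ph N z) <= K * sqc (p z).
  by rewrite sqcM ler_wpM2r ?sqc_ge0//; have [] := hK N z.
have bd N i z : sqc (delta a i (ph N) z) <= 2 * K * sqc (delta a i p z) + 2 * K * sqc (p z).
  rewrite dph; apply: (le_trans (sqcD _ _)).
  rewrite (sqcM (ch N z)) (sqcM (dch N i z)) -!mulrA.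
  have [h1 /(_ i)[h2 _ _]] := hK N z.
  apply: lerD; rewrite ler_wpM2l//; apply: ler_wpM2r; rewrite ?sqc_ge0//.
  by rewrite (le_trans h2)// ler_piMr// invf_le1// ler1n.
pose U N z := g z * (ph N z)^*%C + \sum_i f i z * (delta a i (ph N) z)^*%C.
pose u0 z := g z * (p z)^*%C + \sum_i f i z * (delta a i p z)^*%C.
have c1 z : ccvg (ch ^~ z) 1.
  by split; [exact: cvg_cutoff|exact: cvg_cst].
have hN : (fun N : nat => K / N.+1%:R) @ \oo --> (0 : R).
  by rewrite -(mulr0 K); apply: cvgM; [exact: cvg_cst|exact: cvg_harmonic].
have hNN : (fun N : nat => - (K / N.+1%:R)) @ \oo --> (0 : R).
  by rewrite -oppr0; exact: cvgN hN.
have c0 i z : ccvg (fun N => dch N i z) 0.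
  split; apply: (squeeze_cvgr _ hNN hN); apply: nearW => N;
    by rewrite -ler_norml; have [_ /(_ i)[]] := hK N z.
have cU z : ccvg (U ^~ z) (u0 z).
  rewrite /u0 -[p z]mul1r; apply: ccvgD.
    by apply: ccvgM; [exact: ccvg_cst|apply: ccvgJ; apply: ccvgM => //; exact: ccvg_cst].
  apply: ccvg_sum => i; apply: ccvgM; first exact: ccvg_cst.
  apply: ccvgJ; rewrite (_ : (fun N => _) = fun N => ch N z * delta a i p z + dch N i z * p z); last first.
    by apply/funext => N; rewrite dph.
  rewrite [X in ccvg _ X](_ : _ = 1 * delta a i p z + 0 * p z); last by rewrite mul1r mul0r addr0.
  apply: ccvgD; apply: ccvgM => //; exact: ccvg_cst.
apply: (@cint_limit0 _ _ _ U u0 v) => //.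
- move=> N; apply: cmeasurableD.
    apply: cmeasurableM; first by case: Lg.
    by apply: cmeasurableJ; have [] := cmeasurable_cC1 (Cph N).
  apply: cmeasurable_sum => i; apply: cmeasurableM; first by case: (Lf i).
  by apply: cmeasurableJ; exact: cmeasurable_delta.
- move=> N z; split; rewrite /U /v.
    rewrite cReD (le_trans (ler_normD _ _))// lerD//.
      by rewrite (le_trans (Re_mulJ _ _))// lerD2l.
    rewrite (big_morph _ (@cReD R) (erefl _)) (le_trans (ler_norm_sum _ _ _))//.
    by apply: ler_sum => i _; rewrite (le_trans (Re_mulJ _ _))// lerD2l.
  rewrite cImD (le_trans (ler_normD _ _))// lerD//.
    by rewrite (le_trans (Im_mulJ _ _))// lerD2l.
  rewrite (big_morph _ (@cImD R) (erefl _)) (le_trans (ler_norm_sum _ _ _))//.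
  by apply: ler_sum => i _; rewrite (le_trans (Im_mulJ _ _))// lerD2l.
- by move=> z; have [] := cU z.
- by move=> z; have [] := cU z.
- by move=> N; apply: weak; exact: Cc_cutoff.
Qed.

End weak_equations.

(** * Density of polynomials *)

Section density.
Variables (R : realType) (a : nat -> {posnum R}) (n : nat).
Local Notation Cn := (Cn R n).
Local Notation C := R[i].
Local Notation mu := (gaussCn a n).
Local Notation L2 := (@L2 R a n).
Local Notation Q := (@Qexp R a n).
Implicit Types (f : Cn -> C) (g h : Cn -> R).

Definition sqnorm f : R := (\int[mu]_z sqc (f z))%R.

Lemma sqnorm_ge0 f : 0 <= sqnorm f.
Proof. by apply: Rintegral_ge0 => z _; exact: sqc_ge0. Qed.

Lemma sqnorm_le f g : L2 f -> (forall z, sqc (f z) <= g z) -> rintegrable a g -> sqnorm f <= (\int[mu]_z g z)%R.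
Proof.
by move=> Lf fg ig; apply: le_Rintegral => //; exact: L2_sqc.
Qed.

Lemma L2B f1 f2 : L2 f1 -> L2 f2 -> L2 (fun z => f1 z - f2 z).
Proof.
move=> h1 h2; under eq_fun do rewrite -mulN1r.
by apply: L2D => //; exact: L2Z.
Qed.

Lemma sqnormD_le f0 f1 f2 : L2 f0 -> L2 f1 -> L2 f2 -> (forall z, f0 z = f1 z + f2 z) ->
  sqnorm f0 <= 2 * sqnorm f1 + 2 * sqnorm f2.
Proof.
move=> h0 h1 h2 e; have i1 := L2_sqc h1; have i2 := L2_sqc h2.
rewrite /sqnorm -!RintegralZl// -RintegralD//; [|exact: rintZ|exact: rintZ].
by apply: sqnorm_le => //; [move=> z; rewrite e; exact: sqcD|apply: rintD; exact: rintZ].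
Qed.

Lemma sqnormZ c f : L2 f -> sqnorm (fun z => c * f z) = sqc c * sqnorm f.
Proof.
move=> hf; rewrite /sqnorm; under eq_Rintegral do rewrite sqcM.
by rewrite RintegralZl//; exact: L2_sqc.
Qed.

Lemma sqnorm0 : sqnorm (fun=> 0) = 0.
Proof. by rewrite /sqnorm; under eq_Rintegral do rewrite sqc0; rewrite Rintegral_cst// mul0r. Qed.

Definition pol_adherent f : Prop :=
  L2 f /\ forall e : R, 0 < e -> exists2 p, pol p & sqnorm (fun z => f z - p z) < e.
Local Notation V := pol_adherent.

Lemma adh_pol (p : Cn -> C) : pol p -> V p.
Proof.
move=> pp; split; first exact: L2_pol.
move=> e e0; exists p => //; under [X in sqnorm X]eq_fun do rewrite subrr.
by rewrite sqnorm0.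
Qed.

Lemma adhD f1 f2 : V f1 -> V f2 -> V (fun z => f1 z + f2 z).
Proof.
move=> [L1 h1] [Lf2 h2]; split; first exact: L2D.
move=> e e0; have e4 : 0 < e / 4 by rewrite divr_gt0.
have [p pp hp] := h1 _ e4; have [q pq hq] := h2 _ e4.
exists (fun z => p z + q z); first exact: pol_add.
have Lp := L2_pol a pp; have Lq := L2_pol a pq.
have := @sqnormD_le (fun z => f1 z + f2 z - (p z + q z)) (fun z => f1 z - p z) (fun z => f2 z - q z).
move=> /(_ _ _ _ _)/le_lt_trans; apply; try exact: L2B.
- by apply: L2B; exact: L2D.
- by move=> z; rewrite opprD addrACA.
- lra.
Qed.

Lemma adhZ c f : V f -> V (fun z => c * f z).
Proof.
move=> [Lf hf]; split; first exact: L2Z.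
move=> e e0; have c1 : 0 < sqc c + 1 by rewrite ltr_wpDl ?sqc_ge0.
have [p pp hp] := hf (e / (sqc c + 1)) (divr_gt0 e0 c1).
exists (fun z => c * p z); first exact: polZ.
under [X in sqnorm X]eq_fun do rewrite -mulrBr.
rewrite sqnormZ; last by apply: L2B => //; exact: L2_pol.
have h0 := sqnorm_ge0 (fun z => f z - p z).
rewrite ltr_pdivlMr// in hp; apply: le_lt_trans hp.
by rewrite mulrC ler_wpM2l// lerDl.
Qed.

Lemma adh_lim f : L2 f ->
  (forall e : R, 0 < e -> exists2 f', V f' & sqnorm (fun z => f z - f' z) < e) -> V f.
Proof.
move=> Lf hf; split=> // e e0; have e4 : 0 < e / 4 by rewrite divr_gt0.
have [f' [L' h'] hN] := hf _ e4; have [p pp hp] := h' _ e4.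
exists p => //; have Lp := L2_pol a pp.
have := @sqnormD_le (fun z => f z - p z) (fun z => f z - f' z) (fun z => f' z - p z).
move=> /(_ _ _ _ _)/le_lt_trans; apply; try exact: L2B.
- by move=> z; rewrite addrA subrK.
- lra.
Qed.

Lemma ccvg_sqc (u : nat -> C) l : ccvg u l -> (fun N => sqc (u N)) @ \oo --> sqc l.
Proof.
by move=> [u1 u2]; rewrite /sqc; apply: cvgD; rewrite expr2;
  (under eq_fun do rewrite expr2); exact: cvgM.
Qed.

Lemma cmeasurable_lim (u : nat -> Cn -> C) f : (forall N, cmeasurable (u N)) ->
  (forall z, ccvg (u ^~ z) (f z)) -> cmeasurable f.
Proof.
move=> mu_ cu; split.
  apply: (@measurable_fun_cvg _ _ _ _ (fun N z => complex.Re (u N z))).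
    by move=> N; case: (mu_ N).
  by move=> z _; case: (cu z).
apply: (@measurable_fun_cvg _ _ _ _ (fun N z => complex.Im (u N z))).
  by move=> N; case: (mu_ N).
by move=> z _; case: (cu z).
Qed.

(** Dominated convergence holds in L^2: the square of the distance to the limit is dominated
    by 4 v. *)
Lemma adh_dct (u : nat -> Cn -> C) f v : (forall N, V (u N)) -> rintegrable a v ->
  (forall N z, sqc (u N z) <= v z) -> (forall z, ccvg (u ^~ z) (f z)) -> V f.
Proof.
move=> Vu iv uv cu.
have mf : cmeasurable f by apply: cmeasurable_lim cu => N; case: (Vu N) => -[].
have fv z : sqc (f z) <= v z.
  apply: (cvgr_to_le (ccvg_sqc (cu z))); exact: nearW.
have Lf : L2 f by exact: L2_le iv.
apply: adh_lim => // e e0.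
have mB N : measurable_fun setT (fun z => sqc (f z - u N z)).
  by apply: cmeasurable_sqc; case: (L2B Lf (Vu N).1).
have bB N z : `|sqc (f z - u N z)| <= 4 * v z.
  rewrite ger0_norm ?sqc_ge0// (le_trans (sqcB _ _))//.
  by move: (fv z) (uv N z); lra.
have cB z : (fun N => sqc (f z - u N z)) @ \oo --> (0 : R).
  rewrite -(sqc0 R) -(subrr (f z)); apply: ccvg_sqc; split.
    under eq_fun do rewrite cReD cReN; rewrite cReD cReN.
    by apply: cvgB; [exact: cvg_cst|case: (cu z)].
  under eq_fun do rewrite cImD cImN; rewrite cImD cImN.
  by apply: cvgB; [exact: cvg_cst|case: (cu z)].
have [_] := Rdct mB (rintZ 4 iv) bB cB.
rewrite Rintegral_cst// mul0r => /cvgr_lt/(_ e e0)[N _ hN].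
by exists (u N) => //; exact: (hN N (leqnn N)).
Qed.

(** Bounded functions whose multiplication preserves the closure of the polynomials. They form
    an algebra, stable under bounded pointwise limits, so that membership of a few explicit
    functions spreads to all measurable sets. *)
Definition multiplier g : Prop := [/\ measurable_fun setT g,
  exists M, forall z, `|g z| <= M & forall f, V f -> V (fun z => (g z)%:C * f z)].
Local Notation W := multiplier.

Lemma mult_cst (c : R) : W (fun=> c).
Proof.
split; first exact: measurable_cst.
  by exists `|c|.
by move=> f; exact: adhZ.
Qed.

Lemma multD g h : W g -> W h -> W (fun z => g z + h z).
Proof.
move=> [mg [M gM] Wg] [mh [K hK] Wh]; split; first exact: measurable_funD.
  by exists (M + K) => z; rewrite (le_trans (ler_normD _ _))// lerD.
move=> f Vf; under eq_fun do rewrite raddfD mulrDl.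
by apply: adhD; [exact: Wg|exact: Wh].
Qed.

Lemma multM g h : W g -> W h -> W (fun z => g z * h z).
Proof.
move=> [mg [M gM] Wg] [mh [K hK] Wh]; split; first exact: measurable_funM.
  by exists (M * K) => z; rewrite normrM ler_pM.
move=> f Vf; under eq_fun do rewrite rmorphM -mulrA.
by apply: Wg; exact: Wh.
Qed.

Lemma ccvg_real (u : nat -> R) (l : R) : u @ \oo --> l -> ccvg (fun N => (u N)%:C) l%:C.
Proof. by move=> ul; split=> //; exact: cvg_cst. Qed.

Lemma mult_lim (u : nat -> Cn -> R) g M : (forall N, W (u N)) ->
  (forall N z, `|u N z| <= M) -> (forall z, u ^~ z @ \oo --> g z) -> W g.
Proof.
move=> Wu uM ug; split.
- by apply: (@measurable_fun_cvg _ _ _ _ u) => [N|z _]; [case: (Wu N)|exact: ug].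
- exists M => z; apply: (cvgr_to_le (cvg_norm (ug z))); exact: nearW.
- move=> f Vf; apply: (@adh_dct (fun N z => (u N z)%:C * f z) _ (fun z => M ^+ 2 * sqc (f z))).
  + by move=> N; case: (Wu N) => _ _; exact.
  + by apply: rintZ; apply: L2_sqc; case: Vf.
  + move=> N z; rewrite sqcM ler_wpM2r ?sqc_ge0// sqcR -real_normK ?num_real//.
    by rewrite ler_pXn2r// nnegrE// (le_trans _ (uM N z)).
  + by move=> z; apply: ccvgM; [exact: ccvg_real|exact: ccvg_cst].
Qed.

(** Multiplication by a bounded function is continuous, so polynomials decide. *)
Lemma mult_of_pol g M : measurable_fun setT g -> (forall z, `|g z| <= M) ->
  (forall p : Cn -> C, pol p -> V (fun z => (g z)%:C * p z)) -> W g.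
Proof.
move=> mg gM gp; split => //; first by exists M.
have gM2 z : sqc (g z)%:C <= M ^+ 2.
  by rewrite sqcR -real_normK ?num_real// ler_pXn2r// nnegrE// (le_trans _ (gM z)).
have Lg f : L2 f -> L2 (fun z => (g z)%:C * f z).
  move=> Lf; apply: (@L2_le _ _ _ _ (fun z => M ^+ 2 * sqc (f z))).
  - by apply: cmeasurableM; [split => //; exact: measurable_cst|case: Lf].
  - by move=> z; rewrite sqcM ler_wpM2r ?sqc_ge0.
  - by apply: rintZ; exact: L2_sqc.
move=> f [Lf hf]; apply: adh_lim; first exact: Lg.
move=> e e0; have M1 : 0 < M ^+ 2 + 1 by rewrite ltr_wpDl ?sqr_ge0.
have [p pp hp] := hf _ (divr_gt0 e0 M1).
exists (fun z => (g z)%:C * p z); first exact: gp.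
have LB := L2B Lf (L2_pol a pp); have iB := L2_sqc LB.
under [X in sqnorm X]eq_fun do rewrite -mulrBr.
apply: (@le_lt_trans _ _ (M ^+ 2 * sqnorm (fun z => f z - p z))).
  rewrite /sqnorm -RintegralZl//; apply: sqnorm_le; [exact: Lg| |exact: rintZ].
  by move=> z; rewrite sqcM ler_wpM2r ?sqc_ge0.
rewrite ltr_pdivlMr// in hp; apply: le_lt_trans hp.
by rewrite mulrC ler_wpM2l ?sqnorm_ge0// lerDl.
Qed.

Lemma series_exp_le (y : R) N : `|series (exp_coeff y) N| <= expR `|y|.
Proof.
apply: (@le_trans _ _ (series (exp_coeff `|y|) N)).
  rewrite /series /= (le_trans (ler_norm_sum _ _ _))//; apply: ler_sum => k _.
  by rewrite /exp_coeff /= normrM normrX [X in _ * X]ger0_norm.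
apply: (@nondecreasing_cvgn_le _ _ _ (is_cvg_series_exp_coeff `|y|)).
apply/nondecreasing_seqP => k; rewrite seriesSr lerDl.
by rewrite /exp_coeff /= divr_ge0// exprn_ge0.
Qed.

Lemma multX g k : W g -> W (fun z => g z ^+ k).
Proof.
move=> Wg; elim: k => [|k ih]; first by under eq_fun do rewrite expr0; exact: mult_cst.
by under eq_fun do rewrite exprS; exact: multM.
Qed.

Lemma mult_exp g : W g -> W (fun z => expR (g z)).
Proof.
move=> Wg; have [mg [M gM] _] := Wg.
apply: (@mult_lim (fun N z => series (exp_coeff (g z)) N) _ (expR M)).
- elim=> [|N ih].
    by under eq_fun do rewrite /series /= big_geq//; exact: mult_cst.
  under eq_fun do rewrite seriesSr; apply: multD => //.
  by apply: multM; [exact: multX|exact: mult_cst].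
- by move=> N z; rewrite (le_trans (series_exp_le _ _))// ler_expR.
- by move=> z; exact: is_cvg_series_exp_coeff.
Qed.

Lemma pol_coord (j : 'I_n) (l : 'I_2) : pol (fun z : Cn => (z j l)%:C).
Proof.
have [->|->] := I2_cases l.
  rewrite (_ : (fun z => _) = fun z : Cn => 2^-1 * zcoord z j + 2^-1 * zconj z j).
    by apply: pol_add; apply: polZ; [exact: pol_zcoord|exact: (pol_zconj R j)].
  by apply/funext => z; rewrite halfC /zconj; apply: complex_ext => /=; rewrite /xcoord /ycoord; field.
rewrite (_ : (fun z => _) = fun z : Cn =>
    (2^-1 * - 'i%C) * zcoord z j + (2^-1 * 'i%C) * zconj z j).
  by apply: pol_add; apply: polZ; [exact: pol_zcoord|exact: (pol_zconj R j)].
by apply/funext => z; rewrite halfC /zconj; apply: complex_ext => /=; rewrite /xcoord /ycoord; field.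
Qed.

Lemma pol_exp_coeff g N : pol (fun z : Cn => (g z)%:C) ->
  pol (fun z : Cn => (series (exp_coeff (g z)) N)%:C).
Proof.
move=> pg; have pX k : pol (fun z : Cn => (g z ^+ k)%:C).
  elim: k => [|k ih]; first by under eq_fun do rewrite expr0; exact: pol_cst.
  by under eq_fun do rewrite exprS rmorphM; exact: polM.
elim: N => [|N ih].
  by under eq_fun do rewrite /series /= big_geq//; exact: pol_cst.
under eq_fun do rewrite seriesSr raddfD; apply: pol_add => //.
rewrite (_ : (fun z => _) = fun z : Cn => (g z ^+ N)%:C * (N`!%:R^-1)%:C).
  by apply: polM => //; exact: pol_cst.
by apply/funext => z; rewrite -rmorphM.
Qed.

Lemma coord_sqr_le (j : 'I_n) (l : 'I_2) (z : Cn) : z j l ^+ 2 <= 4 * (a j)%:num ^+ 2 * Q z.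
Proof.
apply: le_trans (Qexp_coord a j z); rewrite /sqc /zcoord /xcoord /ycoord /=.
by have [->|->] := I2_cases l; rewrite ?lerDl ?lerDr sqr_ge0.
Qed.

Section gaussian_factor.
Variables (j : 'I_n) (l : 'I_2).
Let c : R := (16 * (a j)%:num ^+ 2)^-1.
Let c_gt0 : 0 < c. Proof. by rewrite invr_gt0 mulr_gt0. Qed.
Let e (z : Cn) : R := expR (- (c * z j l ^+ 2)).

(** The Taylor polynomials of exp(-c x^2) are bounded by exp(c x^2), which the choice of c
    keeps below exp(Q / 4). Their products with a polynomial are therefore dominated in L^2
    although they do not converge uniformly. *)
Lemma adh_gauss (p : Cn -> C) : pol p -> V (fun z => (e z)%:C * p z).
Proof.
move=> pp; have e2 : 0 < 2^-1 :> R by rewrite invr_gt0.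
(* |p|^2 takes up half of Q in the exponent, the square of exp(c x^2) at most the other half. *)
have [K K0 hK] := slow_pol a pp e2.
pose y (z : Cn) := - (c * z j l ^+ 2).
have py : pol (fun z : Cn => (y z)%:C).
  under eq_fun do rewrite /y expr2 -mulNr !rmorphM; apply: polZ.
  by apply: polM; exact: pol_coord.
apply: (@adh_dct (fun N z => (series (exp_coeff (y z)) N)%:C * p z) _
    (fun z => K * expR (Q z))).
- by move=> N; apply: adh_pol; apply: polM => //; exact: pol_exp_coeff.
- by apply: rintZ; exact: rint_expQ.
- move=> N z; rewrite sqcM (_ : Q z = 2^-1 * Q z + 2^-1 * Q z); last by field.
  rewrite [X in _ * expR X]addrC expRD mulrCA; apply: ler_pM; rewrite ?sqc_ge0//.
  have hy : `|y z| <= 4^-1 * Q z.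
    rewrite normrN ger0_norm; last by rewrite mulr_ge0 ?sqr_ge0// ltW.
    rewrite /c mulrC ler_pdivrMr ?mulr_gt0// (le_trans (coord_sqr_le j l z))//.
    by rewrite le_eqVlt; apply/orP; left; apply/eqP; field.
  rewrite sqcR -real_normK ?num_real//.
  rewrite (_ : 2^-1 * Q z = 4^-1 * Q z + 4^-1 * Q z); last by field.
  rewrite expRD -expr2 ler_pXn2r ?nnegrE ?expR_ge0//.
  by rewrite (le_trans (series_exp_le _ _))// ler_expR.
- move=> z; apply: ccvgM; last exact: ccvg_cst.
  by apply: ccvg_real; exact: is_cvg_series_exp_coeff.
Qed.

Let measurable_e : measurable_fun setT e.
Proof.
apply: measurableT_comp; first exact: measurable_expR.
under eq_fun do rewrite -mulNr; apply: measurable_funM; first exact: measurable_cst.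
by apply: measurable_funX; exact: measurable_coord.
Qed.

Lemma mult_gauss : W e.
Proof.
apply: (@mult_of_pol _ 1) => //; last exact: adh_gauss.
move=> z; rewrite ger0_norm ?expR_ge0// -expR0 ler_expR oppr_le0.
by rewrite mulr_ge0 ?sqr_ge0// ltW.
Qed.

(** Unlike x itself, x exp(-c x^2) is bounded and can be a multiplier. *)
Lemma mult_coord_gauss : W (fun z => z j l * e z).
Proof.
(* |x| <= x^2 + 1, and both x^2 exp(-c x^2) <= 1 / c and exp(-c x^2) <= 1. *)
apply: (@mult_of_pol _ (c^-1 + 1)).
- by apply: measurable_funM => //; exact: measurable_coord.
- move=> z; rewrite normrM (ger0_norm (expR_ge0 _)).
  have h1 : c * z j l ^+ 2 <= expR (c * z j l ^+ 2).
    by rewrite (le_trans _ (expR_ge1Dx _))// lerDr.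
  have h2 : 1 <= expR (c * z j l ^+ 2).
    by rewrite -expR0 ler_expR mulr_ge0 ?sqr_ge0// ltW.
  rewrite /e expRN ler_pdivrMr ?expR_gt0//.
  have h3 : z j l ^+ 2 <= c^-1 * expR (c * z j l ^+ 2).
    by rewrite mulrC ler_pdivlMr// mulrC.
  have h4 : `|z j l| <= z j l ^+ 2 + 1.
    rewrite -[z j l ^+ 2]real_normK ?num_real//; move: (normr_ge0 (z j l)); nra.
  rewrite (le_trans h4)// mulrDl mul1r lerD//.
- move=> p pp; under eq_fun do rewrite rmorphM -mulrA mulrCA.
  by apply: adh_gauss; apply: polM => //; exact: pol_coord.
Qed.

End gaussian_factor.

Lemma mult_ext g h : g =1 h -> W g -> W h.
Proof. by move=> /funext ->. Qed.

(** The functions exp(-N exp(-N g)) lie between 0 and 1 and tend to 1 where g > 0 and to 0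
    where g <= 0. *)
Lemma mult_indic_gt0 g : W g -> W (fun z => if 0 < g z then 1 else 0).
Proof.
move=> Wg; pose u N z := expR (- (N.+1%:R * expR (- (N.+1%:R * g z)))).
apply: (@mult_lim u _ 1).
- move=> N; apply: mult_exp; apply: (@mult_ext (fun z => - N.+1%:R * expR (- N.+1%:R * g z))).
    by move=> z; rewrite !mulNr.
  apply: multM; first exact: mult_cst.
  by apply: mult_exp; apply: multM => //; exact: mult_cst.
- move=> N z; rewrite ger0_norm ?expR_ge0// -expR0 ler_expR oppr_le0.
  by rewrite mulr_ge0 ?expR_ge0.
move=> z; have [g0|g0] := ltP 0 (g z).
  have lo : (fun N : nat => 1 - 4 / g z ^+ 2 * N.+1%:R^-1) @ \oo --> (1 : R).
    rewrite -[X in _ --> X]subr0 -(mulr0 (4 / g z ^+ 2)).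
    apply: cvgB; first exact: cvg_cst.
    by apply: cvgM; [exact: cvg_cst|exact: cvg_harmonic].
  have hi : (fun _ : nat => 1 : R) @ \oo --> (1 : R) by exact: cvg_cst.
  apply: (squeeze_cvgr _ lo hi); apply: nearW => N.
  have N0 : 0 < N.+1%:R :> R by [].
  apply/andP; split; last first.
    by rewrite -expR0 ler_expR oppr_le0 mulr_ge0 ?expR_ge0.
  apply: le_trans (expR_ge1Dx _); rewrite lerD2l lerN2 expRN.
  set x := N.+1%:R * g z; have x0 : 0 < x by rewrite mulr_gt0.
  have hx : x ^+ 2 / 4 <= expR x.
    have -> : expR x = expR (x / 2) ^+ 2 by rewrite expr2 -expRD; congr expR; field.
    rewrite (_ : _ / 4 = (x / 2) ^+ 2); last by field.
    rewrite ler_pXn2r ?nnegrE ?expR_ge0 ?divr_ge0 ?(ltW x0)//.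
    by rewrite (le_trans _ (expR_ge1Dx _))// lerDr.
  rewrite ler_pdivrMr ?expR_gt0//; apply: le_trans (ler_wpM2l _ hx); last first.
    by rewrite mulr_ge0 ?divr_ge0 ?sqr_ge0 ?invr_ge0.
  rewrite le_eqVlt; apply/orP; left; apply/eqP; rewrite /x.
  by move: N0 => /lt0r_neq0; move: (N.+1%:R) => m m0; field; rewrite m0 gt_eqF.
have lo : (fun _ : nat => 0 : R) @ \oo --> (0 : R) by exact: cvg_cst.
apply: (squeeze_cvgr _ lo (@cvg_harmonic R)); apply: nearW => N.
rewrite expR_ge0 /= /u expRN; rewrite lef_pV2 ?posrE ?expR_gt0//.
apply: le_trans (expR_ge1Dx _); rewrite ler_wpDl// ler_peMr// -expR0 ler_expR.
by rewrite oppr_ge0 mulr_ge0_le0.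
Qed.

Definition mult_set (A : set Cn) : Prop := measurable A /\ W (\1_A).

Lemma mult_set_gt0 g : W g -> mult_set [set z | 0 < g z].
Proof.
move=> Wg; have [mg _ _] := Wg; split.
  rewrite (_ : [set _ | _] = setT `&` g @^-1` `]0, +oo[); first exact: mg.
  by rewrite setTI; apply/seteqP; split => z /=; rewrite in_itv/= andbT.
apply: mult_ext (mult_indic_gt0 Wg) => z; rewrite indicE.
by case: ifPn => z0; [rewrite mem_set|rewrite memNset//=; exact/negP].
Qed.

(** The functions x - c and (x - c) exp(-x^2 / (16 a_j^2)) have the same sign, and the second
    one is a multiplier. *)
Lemma mult_set_gt (j : 'I_n) (l : 'I_2) (c : R) : mult_set [set z : Cn | c < z j l].
Proof.
have W0 := multD (mult_coord_gauss j l) (multM (mult_cst (- c)) (mult_gauss j l)).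
rewrite [X in mult_set X](_ : _ = [set z : Cn | 0 < z j l * expR (- ((16 * (a j)%:num ^+ 2)^-1 * z j l ^+ 2)) +
  - c * expR (- ((16 * (a j)%:num ^+ 2)^-1 * z j l ^+ 2))]); first exact: mult_set_gt0.
apply/seteqP; split => z /=; rewrite -mulrDl; first by move=> h; rewrite mulr_gt0 ?expR_gt0// subr_gt0.
by rewrite pmulr_lgt0 ?expR_gt0// subr_gt0.
Qed.

Lemma mult_setC (A : set Cn) : mult_set A -> mult_set (~` A).
Proof.
move=> [mA WA]; split; first exact: measurableC.
apply: mult_ext (multD (mult_cst 1) (multM (mult_cst (- 1)) WA)) => z.
by rewrite !indicE in_setC; case: (z \in A) => /=; ring.
Qed.

Lemma mult_set_bigcap (F : (set Cn)^nat) : (forall k, mult_set (F k)) ->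
  mult_set (\bigcap_k F k).
Proof.
move=> hF; split; first by apply: bigcapT_measurable => k; case: (hF k).
pose u N (z : Cn) : R := \prod_(k < N) \1_(F k) z.
have u01 N z : 0 <= u N z <= 1.
  elim: N => [|N /andP[h1 h2]]; rewrite /u ?big_ord0 ?ler01 ?lexx// big_ord_recr /=.
  by rewrite indicE; case: (z \in F N); rewrite /= ?mulr1 ?mulr0 ?lexx ?ler01//; apply/andP.
apply: (@mult_lim u _ 1).
- move=> N; rewrite /u; elim: N => [|N ih].
    by under eq_fun do rewrite big_ord0; exact: mult_cst.
  by under eq_fun do rewrite big_ord_recr /=; apply: multM => //; case: (hF N).
- by move=> N z; rewrite ger0_norm; have /andP[] := u01 N z.
move=> z; apply: cvg_near_cst; rewrite indicE.
have [h|/existsNP[k /not_implyP[_ hk]]] := pselect ((\bigcap_k F k) z).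
  rewrite mem_set//; apply: nearW => N; rewrite /u big1// => k _.
  by rewrite indicE mem_set//; exact: h.
rewrite memNset; last by move=> /(_ k I).
exists k.+1 => // N /= kN; rewrite /u (bigD1 (Ordinal kN))//= indicE memNset//.
by rewrite mul0r.
Qed.

Lemma sigma_algebra_mult_set : sigma_algebra setT mult_set.
Proof.
split.
- split; first exact: measurable0.
  by apply: mult_ext (mult_cst 0) => z; rewrite indic0.
- by move=> A hA; rewrite setTD; exact: mult_setC.
- move=> F hF; rewrite -[X in mult_set X]setCK setC_bigcup; apply: mult_setC.
  by apply: mult_set_bigcap => k; exact: mult_setC.
Qed.

(** The sets whose indicator is a multiplier form a sigma-algebra that contains the
    half-spaces, and these generate. *)
Lemma measurable_mult_set (A : set Cn) : measurable A -> mult_set A.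
Proof.
(* It suffices that the identity is measurable from the sigma-algebra of multiplier sets. *)
move=> mA; pose T := g_sigma_algebraType mult_set.
have mid : measurable_fun setT (idfun : T -> Cn).
  apply: (measurable_Cn (T := T)) => j l.
  apply: (measurability _ (RGenOInfty.measurableE R)) => _ [_ [c ->] <-].
  rewrite setTI; apply: sub_sigma_algebra.
  rewrite (_ : _ @^-1` _ = [set z : Cn | c < z j l]); first exact: mult_set_gt.
  by apply/seteqP; split => z /=; rewrite in_itv/= andbT.
have := mid measurableT A mA; rewrite setTI.
by rewrite /measurable /= (sigma_algebra_id sigma_algebra_mult_set).
Qed.

Lemma adh_sum (I : Type) (r : seq I) (F : I -> Cn -> C) :
  (forall i, V (F i)) -> V (fun z => \sum_(i <- r) F i z).
Proof.
move=> hF; elim: r => [|i r ih].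
  by under eq_fun do rewrite big_nil; apply: adh_pol; exact: pol_cst.
by under eq_fun do rewrite big_cons; exact: adhD.
Qed.

Import HBNNSimple.

Lemma adh_simple (u : {nnsfun Cn >-> R}) : V (fun z => (u z)%:C).
Proof.
have Vu (y : R) : V (fun z => y%:C * (\1_(u @^-1` [set y]) z)%:C).
  apply: adhZ; have mA : measurable (u @^-1` [set y]).
    by rewrite -[X in measurable X]setTI; exact: measurable_funP.
  have [_ [_ _ /(_ _ (adh_pol (pol_cst n 1)))]] := measurable_mult_set mA.
  by under eq_fun do rewrite mulr1.
rewrite (_ : (fun z => _) = fun z => \sum_(y <- finmap.enum_fset (fset_set (range u)))
    y%:C * (\1_(u @^-1` [set y]) z)%:C); first exact: adh_sum.
apply/funext => z; rewrite fimfunE fsbig_finite//= raddf_sum.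
by apply: eq_bigr => y _; rewrite -rmorphM.
Qed.

(** Simple functions increase to h, so their squares are dominated by that of h. *)
Lemma adh_real_ge0 h : measurable_fun setT h -> (forall z, 0 <= h z) ->
  rintegrable a (fun z => h z ^+ 2) -> V (fun z => (h z)%:C).
Proof.
move=> mh h0 ih; have mEh : measurable_fun setT (EFin \o h) by exact/measurable_EFinP.
pose u N : Cn -> R := nnsfun_approx measurableT mEh N.
have cu z : u ^~ z @ \oo --> h z.
  have := @cvg_nnsfun_approx _ _ _ _ measurableT _ mEh _ z Logic.I.
  by move=> /(_ (fun x _ => h0 x)) /fine_cvg.
have nu z : nondecreasing_seq (u ^~ z).
  by move=> N N' NN; have /lefP := nd_nnsfun_approx measurableT mEh NN; exact.
have uh N z : u N z <= h z.
  have := nondecreasing_cvgn_le (nu z); rewrite (cvg_lim _ (cu z))//; apply.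
  exact: cu.
apply: (@adh_dct (fun N z => (u N z)%:C) _ (fun z => h z ^+ 2)) => //.
- by move=> N; exact: adh_simple.
- move=> N z; rewrite sqcR ler_pXn2r ?nnegrE//; exact: fun_ge0.
- by move=> z; apply: ccvg_real.
Qed.

Lemma adh_real h : measurable_fun setT h ->
  rintegrable a (fun z => h z ^+ 2) -> V (fun z => (h z)%:C).
Proof.
move=> mh ih; have le_sq (x y : R) : 0 <= x -> x <= `|y| -> `|x ^+ 2| <= y ^+ 2.
  move=> x0 xy; rewrite ger0_norm ?sqr_ge0// -[y ^+ 2]real_normK ?num_real//.
  by rewrite ler_pXn2r ?nnegrE.
have hp z : 0 <= Num.max (h z) 0 <= `|h z| by rewrite le_max lexx orbT ge_max ler_norm normr_ge0.
have hn z : 0 <= Num.max (- h z) 0 <= `|h z|.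
  by rewrite le_max lexx orbT ge_max -normrN ler_norm normr_ge0.
have mp : measurable_fun setT (fun z => Num.max (h z) 0).
  by apply: measurable_maxr => //; exact: measurable_cst.
have mn : measurable_fun setT (fun z => Num.max (- h z) 0).
  by apply: measurable_maxr; [exact: measurableT_comp|exact: measurable_cst].
rewrite (_ : (fun z => _) = fun z => (Num.max (h z) 0)%:C + (-1) * (Num.max (- h z) 0)%:C).
  apply: adhD; last apply: adhZ; apply: adh_real_ge0 => //.
  - by move=> z; case/andP: (hp z).
  - apply: (rint_le _ _ ih) => [|z]; first exact: measurable_funX.
    by apply: le_sq; case/andP: (hp z).
  - by move=> z; case/andP: (hn z).
  - apply: (rint_le _ _ ih) => [|z]; first exact: measurable_funX.
    by apply: le_sq; case/andP: (hn z).
apply/funext => z; rewrite mulN1r -rmorphB /=; congr (_%:C).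
case: (lerP 0 (h z)) => h0; first by rewrite max_r ?oppr_le0// subr0.
by rewrite max_l ?oppr_ge0 ?ltW// sub0r opprK.
Qed.

Theorem L2_dense f : L2 f -> V f.
Proof.
move=> Lf; have [[m1 m2] _] := Lf; have iL := L2_sqc Lf.
have hh (x y : R) : `|x ^+ 2| <= x ^+ 2 + y ^+ 2 /\ `|y ^+ 2| <= x ^+ 2 + y ^+ 2.
  by rewrite !ger0_norm ?sqr_ge0// lerDl lerDr !sqr_ge0.
rewrite (_ : f = fun z => (complex.Re (f z))%:C + 'i%C * (complex.Im (f z))%:C).
  apply: adhD; last apply: adhZ; apply: adh_real => //.
  - apply: (rint_le _ _ iL) => [|z]; first exact: measurable_funX.
    exact: (hh _ _).1.
  - apply: (rint_le _ _ iL) => [|z]; first exact: measurable_funX.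
    exact: (hh _ _).2.
by apply/funext => z; apply: complex_ext; rewrite ?cReD ?cImD ?cReM ?cImM /=; ring.
Qed.

End density.

(** * Forms with polynomial coefficients *)

Section polynomial_forms.
Variables (R : realType) (a : nat -> {posnum R}) (n : nat).
Local Notation Cn := (Cn R n).
Local Notation C := R[i].
Local Notation cint := (@cint R a n).
Local Notation L2 := (@L2 R a n).
Local Notation w i := ((2 * (a i)%:num ^+ 2)%:C : C).
Implicit Types f g : Cn -> C.

Lemma L2_supp f M :
  continuous (fun z => complex.Re (f z)) /\ continuous (fun z => complex.Im (f z)) ->
  (forall z, ~ cube M z -> f z = 0) -> L2 f.
Proof.
move=> [c1 c2] f0.
have [K1 K10 hK1] := bounded_cube_supp c1 (fun z hz => congr1 (@complex.Re R) (f0 z hz)).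
have [K2 K20 hK2] := bounded_cube_supp c2 (fun z hz => congr1 (@complex.Im R) (f0 z hz)).
apply: (@L2_le _ _ _ _ (cst (K1 ^+ 2 + K2 ^+ 2))).
- by split; exact: continuous_measurable_Cn.
- move=> z; rewrite /sqc /= -[X in X + _ <= _]real_normK ?num_real//.
  rewrite -[X in _ + X <= _]real_normK ?num_real//.
  by apply: lerD; rewrite ler_pXn2r ?nnegrE.
- exact: finite_measure_integrable_cst.
Qed.

Lemma Cc_L2 (phi : Cn -> C) : Cc_infty phi -> L2 phi /\ forall i, L2 (delta a i phi).
Proof.
move=> cphi; have [M M0 hM] := Cc_supp cphi; have Cphi := Cc_cC1 cphi.
have [_ cp dcp] := Cphi; split; first exact: L2_supp cp hM.
have ccst (c : C) : continuous (fun _ : Cn => complex.Re c) /\ continuous (fun _ : Cn => complex.Im c).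
  by split => z; exact: cst_continuous.
move=> i; apply: (@L2_supp _ M).
  rewrite /delta /partial_z; under eq_fun do rewrite -!mulNr.
  under [X in _ /\ continuous X]eq_fun do rewrite -!mulNr.
  apply: ccontD; first by apply: ccontM => //; apply: ccontD => //; exact: ccontM.
  apply: ccontM => //; apply: ccontM => //; under eq_fun do rewrite -mulN1r.
  under [X in _ /\ continuous X]eq_fun do rewrite -mulN1r.
  apply: ccontM => //; have [z1 z2] := csmooth_alg_zconj R i.
  by split; exact: smooth_alg_continuous.
by move=> z hz; rewrite /delta /partial_z hM// !(partial_supp _ Cphi hM hz) !mulr0 !subr0 mulr0.
Qed.

Variable s : nat.

Definition polform t (u : diff_form R n s t) := forall I J, pol (u I J).

(** The value of dbar on forms with polynomial coefficients. *)
Definition dbar_form t (u : diff_form R n s t) : diff_form R n s t.+1 := fun I K z =>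
  (-1) ^+ s * \sum_(i < n) \sum_(J : multi_index n t) eps R i J K * dbar i (u I J) z.

(** The value of the adjoint of dbar on forms with polynomial coefficients. The weights of
    forms of consecutive degrees differ by 2 a_i^2, the factor between creat and -delta. *)
Definition dbar_adj t (u : diff_form R n s t.+1) : diff_form R n s t := fun I J z =>
  (-1) ^+ s * \sum_(i < n) \sum_(K : multi_index n t.+1) eps R i J K * creat a i (u I K) z.

Lemma polform_dbar t (u : diff_form R n s t) : polform u -> polform (dbar_form u).
Proof.
move=> pu I K; apply: polZ; apply: pol_sum => i; apply: pol_sum => J; apply: polZ.
exact: pol_dbar.
Qed.

Lemma polform_dbar_adj t (u : diff_form R n s t.+1) : polform u -> polform (dbar_adj u).
Proof.
move=> pu I K; apply: polZ; apply: pol_sum => i; apply: pol_sum => J; apply: polZ.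
exact: pol_creat.
Qed.

Lemma polform_L2 t (u : diff_form R n s t) : polform u -> L2form a u.
Proof. by move=> pu I J; exact: L2_pol. Qed.

(** Polynomial forms are admissible in the definition of the adjoint of dbar. *)
Lemma polform_graph t (u : diff_form R n s t) : polform u -> dbar_graph a u (dbar_form u).
Proof.
move=> pu; split; first exact: polform_L2.
exists (fun I K z => \sum_(i < n) \sum_(J : multi_index n t) eps R i J K * dbar i (u I J) z).
split=> // [I K|I K phi cphi].
  by apply: L2_sum => i; apply: L2_sum => J; apply: L2Z; apply: L2_pol; exact: pol_dbar.
have [Lp Ld] := Cc_L2 cphi.
have i1 i J : cintegrable a (fun z => dbar i (u I J) z * (phi z)^*%C).
  by apply: L2_mulJ => //; apply: L2_pol; exact: pol_dbar.
have i2 i J : cintegrable a (fun z => u I J z * (delta a i phi z)^*%C).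
  by apply: L2_mulJ => //; exact: L2_pol.
apply/eqP; rewrite -subr_eq0 opprK; apply/eqP.
under eq_fun do rewrite mulr_suml; under eq_fun do under eq_bigr do rewrite mulr_suml.
under eq_fun do under eq_bigr do under eq_bigr do rewrite -mulrA.
under [X in _ + Defs.cint _ X]eq_fun do under eq_bigr do under eq_bigr do rewrite -mulrA.
have j1 i : cintegrable a (fun z => \sum_(J : multi_index n t) eps R i J K * (dbar i (u I J) z * (phi z)^*%C)).
  by apply: cintegrable_sum => J; exact: cintegrableZ.
have j2 i : cintegrable a (fun z => \sum_(J : multi_index n t) eps R i J K * (u I J z * (delta a i phi z)^*%C)).
  by apply: cintegrable_sum => J; exact: cintegrableZ.
rewrite (cint_sum _ j1) (cint_sum _ j2) -big_split big1//= => i _.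
rewrite !cint_sum; try by move=> J; exact: cintegrableZ.
rewrite -big_split big1//= => J _; rewrite !cintZ//.
have := pol_ibp a i (pu I J) cphi; rewrite cintD// => e.
by rewrite -mulrDr e mulr0.
Qed.

Lemma sgnJ k : ((-1) ^+ k : C)^*%C = (-1) ^+ k.
Proof. by elim: k => [|k ih]; rewrite ?expr0 ?conjc1// exprS cJM ih cJN conjc1. Qed.

Lemma cJsum (I : Type) (r : seq I) (F : I -> C) :
  (\sum_(i <- r) F i)^*%C = \sum_(i <- r) (F i)^*%C.
Proof. by apply: (big_morph _ (@cJD R)); exact: conjc0. Qed.

Lemma epsJ t i (J : multi_index n t) (K : multi_index n t.+1) :
  (eps R i J K)^*%C = eps R i J K.
Proof.
rewrite epsE; case: ifP => _; last exact: conjc0.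
exact: sgnJ.
Qed.

Lemma prod_multi_index t (J : multi_index n t) (F : 'I_n -> R) :
  \prod_(r < t) F (tnth (sval J) r) = \prod_(x in iset J) F x.
Proof.
rewrite -(big_tuple _ _ (sval J) xpredT F) big_uniq ?multi_index_uniq//.
by apply: eq_bigl => x; rewrite inE.
Qed.

(** Adding i to J multiplies the weight by a_i^2 and the power of 2 by 2, which cancels the
    factor between creat and -delta. *)
Lemma eps_weight t (I : multi_index n s) i (J : multi_index n t) (K : multi_index n t.+1) :
  eps R i J K * ((2 ^+ (s + t.+1) * weight a I K)%:C / w i) =
  eps R i J K * (2 ^+ (s + t) * weight a I J)%:C.
Proof.
rewrite [X in X * _ = X * _]epsE; case: ifP => [/andP[iJ /eqP KJ]|_]; last by rewrite !mul0r.
congr (_ * _); rewrite invCR -rmorphM; congr (_%:C); rewrite /weight.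
rewrite (prod_multi_index K (fun x : 'I_n => (a x)%:num ^+ 2)).
rewrite (prod_multi_index J (fun x : 'I_n => (a x)%:num ^+ 2)) KJ big_setU1//= addnS exprS.
have a0 : (a i)%:num != 0 :> R by [].
by field.
Qed.

Lemma graph_pol t (f g : diff_form R n s t) I (K : multi_index n t.+1) (p : Cn -> C)
   (h : Cn -> C) : L2form a f -> L2 h ->
  (forall phi, Cc_infty phi -> cint (fun z => h z * (phi z)^*%C) =
     - cint (fun z => \sum_(i < n) \sum_(J : multi_index n t)
         eps R i J K * f I J z * (delta a i phi z)^*%C)) -> pol p ->
  cint (fun z => h z * (p z)^*%C) = \sum_(i < n) \sum_(J : multi_index n t)
     eps R i J K / w i * cint (fun z => f I J z * (creat a i p z)^*%C).
Proof.
move=> Lf Lh weak pp.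
(* weak_pol is applied to the combinations of coefficients that meet delta_i. *)
pose F i z := \sum_(J : multi_index n t) eps R i J K * f I J z.
have LF i : L2 (F i) by apply: L2_sum => J; apply: L2Z.
have FE q z : \sum_(i < n) \sum_(J : multi_index n t) eps R i J K * f I J z * (delta a i q z)^*%C =
    \sum_i F i z * (delta a i q z)^*%C.
  by apply: eq_bigr => i _; rewrite mulr_suml.
have W phi : Cc_infty phi -> cint (fun z => h z * (phi z)^*%C +
      \sum_i F i z * (delta a i phi z)^*%C) = 0.
  move=> cphi; have [Lp Ld] := Cc_L2 cphi.
  rewrite cintD; [|exact: L2_mulJ|by apply: cintegrable_sum => i; exact: L2_mulJ].
  rewrite weak//; under eq_fun do rewrite FE; exact: addNr.
have Lp := L2_pol a pp; have Ld i := L2_pol a (delta_pol a i pp).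
have Lc i := L2_pol a (pol_creat a i pp).
have := weak_pol Lh LF W pp.
rewrite cintD; [|exact: L2_mulJ|by apply: cintegrable_sum => i; exact: L2_mulJ].
move=> /eqP; rewrite addr_eq0 => /eqP ->.
rewrite cint_sum; last by move=> i; exact: L2_mulJ.
rewrite -sumrN; apply: eq_bigr => i _.
rewrite (_ : (fun z => _) = fun z => \sum_(J : multi_index n t)
    (- (eps R i J K / w i)) * (f I J z * (creat a i p z)^*%C)).
  rewrite cint_sum; last by move=> J; apply: cintegrableZ; exact: L2_mulJ.
  rewrite -sumrN; apply: eq_bigr => J _; rewrite cintZ; last exact: L2_mulJ.
  by rewrite mulNr opprK.
apply/funext => z; rewrite /F mulr_suml; apply: eq_bigr => J _.
have -> : (creat a i p z)^*%C = - (w i * (delta a i p z)^*%C).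
  by rewrite creat_delta mulNr cJN cJM cJR.
rewrite mulNr !mulrN opprK -[RHS]mulrA [f I J z * _]mulrCA.
by rewrite mulKf; [rewrite mulrA|exact: two_asq_neq0].
Qed.

(** Integration by parts against a polynomial form, for every form in the domain of dbar. Taking
    f polynomial as well, dbar_adj is the formal adjoint of dbar_form. *)
Lemma graph_adjoint t (f : diff_form R n s t) h (psi : diff_form R n s t.+1) :
  dbar_graph a f h -> polform psi -> inner a h psi = inner a f (dbar_adj psi).
Proof.
move=> [Lf [g [Lg weak hg]]] ppsi; rewrite /inner; apply: eq_bigr => I _.
pose T i J K := (-1) ^+ s * (eps R i J K * (2 ^+ (s + t) * weight a I J)%:C) *
  cint (fun z => f I J z * (creat a i (psi I K) z)^*%C).
have Lc i K := L2_pol a (pol_creat a i (ppsi I K)).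
transitivity (\sum_K \sum_i \sum_J T i J K).
  apply: eq_bigr => K _.
  under eq_fun do rewrite hg -mulrA.
  rewrite cintZ; last by apply: L2_mulJ => //; exact: L2_pol.
  rewrite (graph_pol f Lf (Lg I K) (weak I K) (ppsi I K)) mulrCA mulr_sumr mulr_sumr.
  apply: eq_bigr => i _; rewrite !mulr_sumr; apply: eq_bigr => J _.
  by rewrite /T -eps_weight !mulrA; congr (_ * _); rewrite -!mulrA; congr (_ * _); rewrite mulrCA.
rewrite exchange_big /=; under eq_bigr do rewrite exchange_big /=.
rewrite exchange_big /=; apply: eq_bigr => J _.
have -> : (fun z => f I J z * (dbar_adj psi I J z)^*%C) =
    fun z => \sum_i \sum_K ((-1) ^+ s * eps R i J K) * (f I J z * (creat a i (psi I K) z)^*%C).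
  apply/funext => z; rewrite /dbar_adj cJM sgnJ mulrCA cJsum !mulr_sumr.
  apply: eq_bigr => i _; rewrite cJsum !mulr_sumr.
  by apply: eq_bigr => K _; rewrite cJM epsJ [f I J z * (eps _ _ _ _ * _)]mulrCA mulrA.
have iK i K : cintegrable a (fun z => ((-1) ^+ s * eps R i J K) * (f I J z * (creat a i (psi I K) z)^*%C)).
  by apply: cintegrableZ; exact: L2_mulJ.
rewrite cint_sum; last by move=> i; exact: cintegrable_sum.
rewrite mulr_sumr; apply: eq_bigr => i _; rewrite cint_sum// mulr_sumr.
apply: eq_bigr => K _; rewrite cintZ; last exact: L2_mulJ.
by rewrite /T [RHS]mulrCA !mulrA.
Qed.

Section linear_sum.
Variable D : (Cn -> C) -> Cn -> C.
Hypothesis DD : forall p q, pol p -> pol q -> D (fun z => p z + q z) = fun z => D p z + D q z.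
Hypothesis DZ : forall c p, pol p -> D (fun z => c * p z) = fun z => c * D p z.

Lemma lin_sum (I : Type) (r : seq I) (c : I -> C) (F : I -> Cn -> C) : (forall i, pol (F i)) ->
  D (fun z => \sum_(i <- r) c i * F i z) = fun z => \sum_(i <- r) c i * D (F i) z.
Proof.
move=> pF; elim: r => [|i r ih].
  under eq_fun do rewrite big_nil; under [RHS]eq_fun do rewrite big_nil.
  rewrite -[X in D X]/(fun _ : Cn => 0 : C).
  rewrite (_ : (fun=> 0) = (fun z : Cn => 0 * (fun=> 0 : C) z)); last by apply/funext => z; rewrite mul0r.
  rewrite DZ; last exact: pol_cst.
  by apply/funext => z; rewrite !mul0r.
under eq_fun do rewrite big_cons.
rewrite DD; [|exact: polZ|by apply: pol_sum => j; exact: polZ].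
by rewrite ih DZ//; apply/funext => z; rewrite big_cons.
Qed.

Lemma lin_sum2 (I J : finType) (c : I -> J -> C) (F : I -> J -> Cn -> C) :
  (forall i j, pol (F i j)) ->
  D (fun z => \sum_i \sum_j c i j * F i j z) = fun z => \sum_i \sum_j c i j * D (F i j) z.
Proof.
move=> pF; under eq_fun do rewrite pair_bigA.
rewrite (lin_sum _ (fun p => c p.1 p.2) (F := fun p => F p.1 p.2)); last by move=> p.
by apply/funext => z; rewrite pair_bigA.
Qed.

End linear_sum.

Lemma dbar_sum2 j (I J : finType) (c : I -> J -> C) (F : I -> J -> Cn -> C) k :
  (forall i j, pol (F i j)) ->
  dbar j (fun z => k * \sum_i \sum_j c i j * F i j z) =
  fun z => k * \sum_i \sum_l c i l * dbar j (F i l) z.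
Proof.
move=> pF; rewrite (dbarZ j k); last first.
  by apply: pol_cdiff; apply: pol_sum => i; apply: pol_sum => l; exact: polZ.
rewrite (lin_sum2 (D := dbar j)) => //.
- by move=> p q pp pq; rewrite (dbarD j (pol_cdiff pp) (pol_cdiff pq)).
- by move=> e p pp; rewrite (dbarZ j e (pol_cdiff pp)).
Qed.

Lemma creat_sum2 i' (I J : finType) (c : I -> J -> C) (F : I -> J -> Cn -> C) k :
  (forall i j, pol (F i j)) ->
  creat a i' (fun z => k * \sum_i \sum_j c i j * F i j z) =
  fun z => k * \sum_i \sum_j c i j * creat a i' (F i j) z.
Proof.
move=> pF; rewrite (creatZ a i' k); last first.
  by apply: pol_cdiff; apply: pol_sum => i; apply: pol_sum => l; exact: polZ.
rewrite (lin_sum2 (D := creat a i')) => //.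
- by move=> p q pp pq; rewrite (creatD a i' (pol_cdiff pp) (pol_cdiff pq)).
- by move=> e p pp; rewrite (creatZ a i' e (pol_cdiff pp)).
Qed.

Lemma sign_mulK k (x : C) : (-1) ^+ k * ((-1) ^+ k * x) = x.
Proof. by rewrite mulrA -exprD addnn -mul2n exprM sqrrN !expr1n mul1r. Qed.

(** The algebra of the Laplacian: E i j K stands for A_i D_j applied to the coefficient x K,
    and the commutation relations replace D_j A_i by A_i D_j plus a Kronecker symbol.
    Anticommutation of the signs cancels all mixed terms, and the Kronecker symbols sum up to
    the number of indices. *)
Lemma eps_contract t (E : 'I_n -> 'I_n -> multi_index n t.+1 -> C) (x : multi_index n t.+1 -> C)
   (K' : multi_index n t.+1) :
  \sum_j \sum_(J : multi_index n t) eps R j J K' *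
     (\sum_i \sum_K eps R i J K * (E i j K + (i == j)%:R * x K)) +
  \sum_i \sum_(M : multi_index n t.+2) eps R i K' M * (\sum_j \sum_K eps R j K M * E i j K)
  = \sum_i E i i K' + t.+1%:R * x K'.
Proof.
have -> : \sum_j \sum_(J : multi_index n t) eps R j J K' *
     (\sum_i \sum_K eps R i J K * (E i j K + (i == j)%:R * x K)) =
   \sum_i \sum_j \sum_K (\sum_(J : multi_index n t) eps R i J K * eps R j J K') *
      (E i j K + (i == j)%:R * x K).
  rewrite [RHS]exchange_big /=; apply: eq_bigr => j _.
  transitivity (\sum_(J : multi_index n t) \sum_i eps R j J K' * \sum_K eps R i J K * (E i j K + (i == j)%:R * x K)).
    by apply: eq_bigr => J _; rewrite mulr_sumr.
  rewrite exchange_big /=; apply: eq_bigr => i _.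
  under eq_bigr => J _ do rewrite mulr_sumr.
  rewrite exchange_big /=; apply: eq_bigr => K _.
  rewrite mulr_suml; apply: eq_bigr => J _.
  by rewrite mulrA [eps R j J K' * _]mulrC.
have -> : \sum_i \sum_(M : multi_index n t.+2) eps R i K' M * (\sum_j \sum_K eps R j K M * E i j K) =
   \sum_i \sum_j \sum_K (\sum_(M : multi_index n t.+2) eps R j K M * eps R i K' M) * E i j K.
  apply: eq_bigr => i _.
  under eq_bigr => M _ do rewrite mulr_sumr.
  rewrite exchange_big /=; apply: eq_bigr => j _.
  under eq_bigr => M _ do rewrite mulr_sumr.
  rewrite exchange_big /=; apply: eq_bigr => K _.
  rewrite mulr_suml; apply: eq_bigr => M _.
  by rewrite mulrA [eps R i K' M * _]mulrC.
rewrite -big_split /=.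
transitivity (\sum_i \sum_j \sum_K (((i == j) && (K == K'))%:R * E i j K +
   (i == j)%:R * ((\sum_(J : multi_index n t) eps R i J K * eps R j J K') * x K))).
  apply: eq_bigr => i _; rewrite -big_split /=; apply: eq_bigr => j _.
  rewrite -big_split /=; apply: eq_bigr => K _.
  rewrite -(eps_anticommute R i j K K') mulrDr addrAC -mulrDl; congr (_ + _).
  by rewrite mulrCA.
transitivity (\sum_i (E i i K' + \sum_K (\sum_(J : multi_index n t) eps R i J K * eps R i J K') * x K)).
  apply: eq_bigr => i _; rewrite (bigD1 i)//= [X in _ + X]big1 ?addr0; last first.
    by move=> j ji; apply: big1 => K _; rewrite eq_sym (negbTE ji) /= !mul0r addr0.
  rewrite big_split /= eqxx; congr (_ + _); last by apply: eq_bigr => K _; rewrite mul1r.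
  rewrite (bigD1 K')//= eqxx mul1r big1 ?addr0// => K KK.
  by rewrite (negbTE KK) mul0r.
rewrite big_split /=; congr (_ + _).
rewrite exchange_big /=; under eq_bigr => K _ do rewrite -mulr_suml eps_number.
rewrite (bigD1 K')//= eqxx muln1 big1 ?addr0// => K KK.
by rewrite (negbTE KK) muln0 mul0r.
Qed.

Lemma laplacian_oscil t (phi : diff_form R n s t.+1) : polform phi -> forall I K z,
  dbar_form (dbar_adj phi) I K z + dbar_adj (dbar_form phi) I K z =
  oscil a (phi I K) z + t.+1%:R * phi I K z.
Proof.
move=> pphi I K' z; rewrite {1}/dbar_form {2}/dbar_adj.
have H1 j J : dbar j (dbar_adj phi I J) z = (-1) ^+ s * \sum_i \sum_K
    eps R i J K * (creat a i (dbar j (phi I K)) z + (i == j)%:R * phi I K z).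
  rewrite /dbar_adj dbar_sum2; last by move=> i K; exact: pol_creat.
  congr (_ * _); apply: eq_bigr => i _; apply: eq_bigr => K _.
  by rewrite dbar_creat.
have H2 i M : creat a i (dbar_form phi I M) z = (-1) ^+ s * \sum_j \sum_K
    eps R j K M * creat a i (dbar j (phi I K)) z.
  by rewrite /dbar_form creat_sum2//; move=> j K; exact: pol_dbar.
under eq_bigr => j _ do under eq_bigr => J _ do rewrite H1 mulrCA.
under [X in _ + _ * X]eq_bigr => j _ do under eq_bigr => J _ do rewrite H2 mulrCA.
under eq_bigr => j _ do rewrite -mulr_sumr.
under [X in _ + _ * X]eq_bigr => j _ do rewrite -mulr_sumr.
rewrite -!mulr_sumr !sign_mulK.
exact: (eps_contract (fun i j K => creat a i (dbar j (phi I K)) z) (fun K => phi I K z)).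
Qed.

(** The theory of the norms uses the real part of the inner products alone; it is symmetric
    and bilinear over the reals. *)
Definition re_dot f g : R := complex.Re (cint (fun z => f z * (g z)^*%C)).

Lemma re_dot_self f : re_dot f f = sqnorm a f.
Proof.
by rewrite /re_dot /sqnorm /=; apply: eq_Rintegral => z _; rewrite mulcJ.
Qed.

Lemma re_dot_sym f g : L2 f -> L2 g -> re_dot f g = re_dot g f.
Proof.
move=> Lf Lg; rewrite /re_dot -[RHS]cReJ -cintJ; last exact: L2_mulJ.
by under [in RHS]eq_fun do rewrite cJM cJJ mulrC.
Qed.

Lemma re_dotDr f g h : L2 f -> L2 g -> L2 h -> re_dot f (fun z => g z + h z) = re_dot f g + re_dot f h.
Proof.
move=> Lf Lg Lh; rewrite /re_dot -cReD -cintD; [|exact: L2_mulJ|exact: L2_mulJ].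
by under eq_fun do rewrite cJD mulrDr.
Qed.

Lemma re_dotZr (k : R) f g : L2 f -> L2 g -> re_dot f (fun z => k%:C * g z) = k * re_dot f g.
Proof.
move=> Lf Lg; rewrite /re_dot; under eq_fun do rewrite cJM cJR mulrCA.
by rewrite cintZ ?cReM /= ?mul0r ?subr0//; exact: L2_mulJ.
Qed.

Lemma sqnormB f g : L2 f -> L2 g -> sqnorm a (fun z => f z - g z) = sqnorm a f - 2 * re_dot f g + sqnorm a g.
Proof.
move=> Lf Lg; have Lg' : L2 (fun z => (-1)%:C * g z) by exact: L2Z.
rewrite -!re_dot_self (_ : (fun z => f z - g z) = fun z => f z + (-1)%:C * g z); last first.
  by apply/funext => z; rewrite rmorphN1 mulN1r.
have LD := L2D Lf Lg'.
rewrite re_dotDr// (re_dot_sym LD Lf) re_dotDr// re_dotZr// (re_dot_sym LD Lg') re_dotDr// re_dotZr//.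
rewrite (re_dot_sym Lg' Lf) re_dotZr// (re_dot_sym Lg' Lg) re_dotZr//.
ring.
Qed.

Definition re_inner t (f g : diff_form R n s t) : R := complex.Re (inner a f g).

Definition inner_weight t (I : multi_index n s) (J : multi_index n t) : R := 2 ^+ (s + t) * weight a I J.

Lemma inner_weight_gt0 t I (J : multi_index n t) : 0 < inner_weight I J.
Proof.
by rewrite /inner_weight /weight mulr_gt0 ?exprn_gt0// mulr_gt0//; apply: prodr_gt0 => i _; rewrite exprn_gt0.
Qed.

Lemma cResum (I : Type) (r : seq I) (F : I -> C) :
  complex.Re (\sum_(i <- r) F i) = \sum_(i <- r) complex.Re (F i).
Proof. by apply: (big_morph _ (@cReD R)). Qed.

Lemma re_innerE t (f g : diff_form R n s t) :
  re_inner f g = \sum_I \sum_J inner_weight I J * re_dot (f I J) (g I J).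
Proof.
rewrite /re_inner /inner cResum; apply: eq_bigr => I _; rewrite cResum; apply: eq_bigr => J _.
by rewrite cReM /= mul0r subr0.
Qed.

Lemma re_inner_sym t (f g : diff_form R n s t) : L2form a f -> L2form a g -> re_inner f g = re_inner g f.
Proof.
move=> Lf Lg; rewrite !re_innerE; apply: eq_bigr => I _; apply: eq_bigr => J _.
by rewrite re_dot_sym.
Qed.

Lemma re_inner_ge0 t (f : diff_form R n s t) : 0 <= re_inner f f.
Proof.
rewrite re_innerE; apply: sumr_ge0 => I _; apply: sumr_ge0 => J _.
by rewrite re_dot_self mulr_ge0 ?sqnorm_ge0// ltW// inner_weight_gt0.
Qed.

Lemma re_innerDr t (f g h : diff_form R n s t) : L2form a f -> L2form a g -> L2form a h ->
  re_inner f (fun I J z => g I J z + h I J z) = re_inner f g + re_inner f h.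
Proof.
move=> Lf Lg Lh; rewrite !re_innerE -big_split; apply: eq_bigr => I _.
rewrite -big_split; apply: eq_bigr => J _ /=.
by rewrite re_dotDr// mulrDr.
Qed.

Lemma re_innerB t (f g : diff_form R n s t) : L2form a f -> L2form a g ->
  re_inner (fun I J z => f I J z - g I J z) (fun I J z => f I J z - g I J z) =
  re_inner f f - 2 * re_inner f g + re_inner g g.
Proof.
move=> Lf Lg; rewrite !re_innerE mulr_sumr -sumrB -big_split; apply: eq_bigr => I _.
rewrite mulr_sumr /= -sumrB -big_split; apply: eq_bigr => J _ /=.
by rewrite !re_dot_self sqnormB//; ring.
Qed.

Lemma L2norm_sqr t (f : diff_form R n s t) : L2norm a f ^+ 2 = re_inner f f.
Proof. by rewrite /L2norm sqr_sqrtr//; exact: re_inner_ge0. Qed.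

Lemma re_inner_le t (f g : diff_form R n s t) : L2form a f -> L2form a g ->
  2 * re_inner f g <= re_inner f f + re_inner g g.
Proof.
move=> Lf Lg; have := re_inner_ge0 (fun I J z => f I J z - g I J z).
by rewrite re_innerB//; move: (re_inner f f) (re_inner f g) (re_inner g g) => x y u; lra.
Qed.

Lemma pol_adjoint (i : 'I_n) (p u : Cn -> C) : pol p -> pol u ->
  (2 * (a i)%:num ^+ 2) * re_dot (dbar i p) u = re_dot p (creat a i u).
Proof.
move=> pp pu; pose f (j : 'I_n) z := (j == i)%:R * p z.
have fE q z : \sum_j f j z * (delta a j q z)^*%C = p z * (delta a i q z)^*%C.
  rewrite (bigD1 i)//= big1; first by rewrite /f eqxx mul1r addr0.
  by move=> j /negbTE ji; rewrite /f ji !mul0r.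
have Lp := L2_pol a pp; have Lu := L2_pol a pu.
have Ld := L2_pol a (pol_dbar i pp); have Lu' := L2_pol a (delta_pol a i pu).
have Lf j : L2 (f j) by exact: L2Z.
have W0 phi : Cc_infty phi -> cint (fun z => dbar i p z * (phi z)^*%C +
    \sum_j f j z * (delta a j phi z)^*%C) = 0.
  by move=> cphi; under eq_fun do rewrite fE; exact: pol_ibp.
have := weak_pol Ld Lf W0 pu; under eq_fun do rewrite fE.
rewrite cintD; [|exact: L2_mulJ|exact: L2_mulJ] => /eqP.
rewrite addr_eq0 => /eqP e; rewrite /re_dot e.
rewrite (_ : (fun z => p z * (creat a i u z)^*%C) = fun z => - w i * (p z * (delta a i u z)^*%C)).
  rewrite cintZ; last exact: L2_mulJ.
  by rewrite mulNr !cReN cReM /= mul0r subr0 mulrN.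
by apply/funext => z; rewrite creat_delta cJM cJN cJR mulrCA.
Qed.

Lemma re_dot_sumr f (F : 'I_n -> Cn -> C) : L2 f -> (forall i, L2 (F i)) ->
  re_dot f (fun z => \sum_i F i z) = \sum_i re_dot f (F i).
Proof.
move=> Lf LF; rewrite /re_dot -cResum -cint_sum; last by move=> i; exact: L2_mulJ.
by under eq_fun do rewrite cJsum mulr_sumr.
Qed.

(** The oscillator is a sum of the nonnegative operators A_i D_i. *)
Lemma oscil_gap t (p : Cn -> C) : pol p ->
  sqnorm a p <= re_dot p (fun z => oscil a p z + t.+1%:R * p z).
Proof.
move=> pp; have Lp := L2_pol a pp; have LL := L2_pol a (pol_oscil a pp).
have -> : (fun z => oscil a p z + t.+1%:R * p z) = fun z => oscil a p z + (t.+1%:R)%:C * p z.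
  by apply/funext => z; rewrite rmorph_nat.
rewrite re_dotDr//; last exact: L2Z.
rewrite re_dotZr// re_dot_self re_dot_sumr//; last first.
  by move=> i; apply: L2_pol; apply: pol_creat; exact: pol_dbar.
rewrite ler_wpDl//; last by rewrite ler_peMl ?sqnorm_ge0// ler1n.
apply: sumr_ge0 => i _; rewrite -pol_adjoint//; last exact: pol_dbar.
by rewrite re_dot_self mulr_ge0 ?sqnorm_ge0.
Qed.

Definition laplacian t (phi : diff_form R n s t.+1) : diff_form R n s t.+1 := fun I K z =>
  dbar_form (dbar_adj phi) I K z + dbar_adj (dbar_form phi) I K z.

Lemma polform_laplacian t (phi : diff_form R n s t.+1) : polform phi -> polform (laplacian phi).
Proof.
move=> pphi I K; apply: pol_add.
  exact: (polform_dbar (polform_dbar_adj pphi)).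
exact: (polform_dbar_adj (polform_dbar pphi)).
Qed.

Lemma laplacian_surj t (psi : diff_form R n s t.+1) : polform psi ->
  exists2 phi, polform phi & laplacian phi = psi.
Proof.
move=> ppsi.
have /choice[phi hphi] : forall x : multi_index n s * multi_index n t.+1,
    exists q, pol q /\ forall z, oscil a q z + t.+1%:R * q z = psi x.1 x.2 z.
  by move=> x; have [q pq hq] := oscil_surj a t (ppsi x.1 x.2); exists q.
have pphi : polform (fun I K => phi (I, K)) by move=> I K; case: (hphi (I, K)).
exists (fun I K => phi (I, K)) => //.
apply/funext => I; apply/funext => K; apply/funext => z.
by rewrite /laplacian laplacian_oscil//; case: (hphi (I, K)).
Qed.

(** The Laplacian is at least 1, so <phi, phi> <= <phi, psi> with psi its value at phi;
    expanding |phi - psi|^2 >= 0 gives the claim. *)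
Lemma laplacian_gap t (phi : diff_form R n s t.+1) : polform phi ->
  re_inner phi (laplacian phi) <= re_inner (laplacian phi) (laplacian phi).
Proof.
move=> pphi; have Lphi := polform_L2 pphi; have Llap := polform_L2 (polform_laplacian pphi).
have gap : re_inner phi phi <= re_inner phi (laplacian phi).
  rewrite !re_innerE; apply: ler_sum => I _; apply: ler_sum => K _.
  rewrite ler_wpM2l ?(ltW (inner_weight_gt0 _ _))// re_dot_self.
  rewrite (_ : laplacian phi I K = fun z => oscil a (phi I K) z + t.+1%:R * phi I K z).
    exact: oscil_gap.
  by apply/funext => z; exact: laplacian_oscil.
have := re_inner_ge0 (fun I J z => phi I J z - laplacian phi I J z); rewrite re_innerB//.
by move: gap; move: (re_inner phi phi) (re_inner phi _) (re_inner (laplacian phi) _) => x y u; lra.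
Qed.

(** The two compositions that make up the Laplacian are integrated by parts once each. *)
Lemma laplacian_energy t (phi : diff_form R n s t.+1) : polform phi ->
  re_inner phi (laplacian phi) = re_inner (dbar_adj phi) (dbar_adj phi) + re_inner (dbar_form phi) (dbar_form phi).
Proof.
move=> pphi; have pTa := polform_dbar_adj pphi; have pT := polform_dbar pphi.
have L1 := polform_L2 pphi; have L2 := polform_L2 (polform_dbar pTa).
have L3 := polform_L2 (polform_dbar_adj pT).
rewrite re_innerDr//; congr (_ + _).
  by rewrite re_inner_sym// /re_inner (graph_adjoint (polform_graph pTa) pphi).
by rewrite {1}/re_inner -(graph_adjoint (polform_graph pphi) pT).
Qed.

Lemma polform_dense t (f : diff_form R n s t) : L2form a f -> forall e : R, 0 < e ->
  exists2 psi, polform psi & re_inner (fun I J z => f I J z - psi I J z) (fun I J z => f I J z - psi I J z) <= e.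
Proof.
move=> Lf e e0; pose c : R := \sum_(I : multi_index n s) \sum_(J : multi_index n t) inner_weight I J.
have c0 : 0 < c + 1.
  by rewrite ltr_wpDl//; apply: sumr_ge0 => I _; apply: sumr_ge0 => J _; rewrite ltW// inner_weight_gt0.
have /choice[psi hpsi] : forall x : multi_index n s * multi_index n t,
    exists q, pol q /\ sqnorm a (fun z => f x.1 x.2 z - q z) < e / (c + 1).
  move=> x; have [_ /(_ _ (divr_gt0 e0 c0))[q pq hq]] := L2_dense (Lf x.1 x.2).
  by exists q.
exists (fun I J => psi (I, J)); first by move=> I J; case: (hpsi (I, J)).
rewrite re_innerE; apply: (@le_trans _ _ (c * (e / (c + 1)))).
  rewrite mulr_suml; apply: ler_sum => I _; rewrite mulr_suml; apply: ler_sum => J _.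
  by rewrite re_dot_self ler_wpM2l ?ltW ?inner_weight_gt0//; case: (hpsi (I, J)).
by rewrite mulrCA ler_piMr ?ltW// ltr_pdivrMr// mul1r ltrDl.
Qed.

Lemma adjoint_dbar_form t (f : diff_form R n s t.+1) (Tf : diff_form R n s t)
   (u : diff_form R n s t) :
  adjoint_graph a (dbar_graph a (s := s) (t := t)) f Tf -> polform u ->
  re_inner f (dbar_form u) = re_inner Tf u.
Proof.
move=> [Lf LTf adj] pu; have gu := polform_graph pu.
rewrite re_inner_sym//; last exact: polform_L2 (polform_dbar pu).
by rewrite [RHS]re_inner_sym//; [rewrite /re_inner (adj _ _ gu)|exact: polform_L2].
Qed.

(** Here e bounds the square of the distance of f to a polynomial form psi, the Laplacian of
    phi; the pairing of f with psi is split and bounded by re_inner_le on each side. *)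
Theorem basic_estimate t (f : diff_form R n s t.+1) (Tf : diff_form R n s t)
    (Sf : diff_form R n s t.+2) :
  adjoint_graph a (dbar_graph a (s := s) (t := t)) f Tf -> dbar_graph a f Sf ->
  re_inner f f <= re_inner Tf Tf + re_inner Sf Sf.
Proof.
move=> gTf gSf; have [Lf LTf _] := gTf.
have LSf : L2form a Sf.
  have [_ [g [Lg _ hg]]] := gSf; move=> I K.
  by rewrite (_ : Sf I K = fun z => (-1) ^+ s * g I K z); [exact: L2Z|exact/funext].
apply/ler_addgt0Pr => e e0; have [psi ppsi hpsi] := polform_dense Lf e0.
have [phi pphi phiE] := laplacian_surj ppsi; rewrite -{}phiE in ppsi hpsi.
have pTa := polform_dbar_adj pphi; have pT := polform_dbar pphi.
have Llap := polform_L2 ppsi.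
(* The pairing with the Laplacian of phi, split between the two domains. *)
have duality : re_inner f (laplacian phi) = re_inner Tf (dbar_adj phi) + re_inner Sf (dbar_form phi).
  rewrite re_innerDr//; [|exact: polform_L2 (polform_dbar pTa)|exact: polform_L2 (polform_dbar_adj pT)].
  by rewrite (adjoint_dbar_form gTf pTa) {2}/re_inner -(graph_adjoint gSf pT).
have := re_inner_le LTf (polform_L2 pTa); have := re_inner_le LSf (polform_L2 pT).
have := laplacian_gap pphi; have := laplacian_energy pphi; move: hpsi duality; rewrite re_innerB//.
move: (re_inner f f) (re_inner f (laplacian phi)) (re_inner (laplacian phi) _) (re_inner phi _) (re_inner Tf Tf) (re_inner Tf _) (re_inner Sf Sf)
  (re_inner Sf _) (re_inner (dbar_adj phi) _) (re_inner (dbar_form phi) _) => *; lra.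
Qed.

End polynomial_forms.

Theorem corollary23 (R : realType) (a : nat -> {posnum R})
    (a_sum : (\sum_(0 <= i <oo) ((a i)%:num)%:E < 1)%E)
    (n s t : nat) (s_le_n : (s <= n)%N) (t_le_n : (t <= n)%N)
    (f : diff_form R n s t.+1)
    (Tf : diff_form R n s t)
    (Tf_graph : adjoint_graph a (dbar_graph a (s := s) (t := t)) f Tf)
    (Sf : diff_form R n s t.+2) (Sf_graph : dbar_graph a f Sf) :
  L2norm a f ^+ 2 <= L2norm a Tf ^+ 2 + L2norm a Sf ^+ 2.
Proof. by rewrite !L2norm_sqr; exact: basic_estimate. Qed.
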